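(* Let $\mathbb{Z}'=\tfrac12+\mathbb{Z}$ be the set of half-integers and let $z,z'$ satisfy one of the following: (principal series) $z'=\overline{z}\notin\mathbb{R}$; or (complementary series) $z,z'$ are real and there exists an integer $m$ such that $z,z'\in(m,m+1)$. Let $\mathbb{P}_{\mathbf{\Gamma}_{z,z'}}$ be the determinantal point process on $\mathbb{Z}'$ with the Gamma-kernel $$\mathbf{\Gamma}_{z,z'}(x,y)=\frac{\sin(\pi z)\sin(\pi z')}{\pi\sin(\pi(z-z'))}\bigl(\Gamma(x+z+\tfrac12)\Gamma(x+z'+\tfrac12)\Gamma(y+z+\tfrac12)\Gamma(y+z'+\tfrac12)\bigr)^{-1/2}$$ $$\times\frac{\Gamma(x+z+\tfrac12)\Gamma(y+z'+\tfrac12)-\Gamma(x+z'+\tfrac12)\Gamma(y+z+\tfrac12)}{x-y},\qquad x,y\in\mathbb{Z}'.$$ Then $\mathbb{P}_{\mathbf{\Gamma}_{z,z'}}$ is rigid.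
   Context: On the diagonal $x=y$ the kernel is understood as the limit $y\to x$ of the expression regarded as a function of real $y$; if $z=z'$ it is understood as the limit $z'\to z$. The expression raised to the power $-1/2$ is positive in both series, and the positive root is taken. In both series the kernel defines an orthogonal projection in $L_2(\mathbb{Z}')$ (counting measure). Let $M$ be a complete separable metric space (here $M=\mathbb{Z}'$ with the metric of $\mathbb{R}$, so bounded sets are finite). A configuration on $M$ is a collection of particles in $M$, considered without regard to order and without accumulation points (a purely atomic Radon measure); $\mathrm{Conf}(M)$ is the space of configurations with the vague topology, and a point process on $M$ is a Borel probability measure on $\mathrm{Conf}(M)$. For a bounded Borel set $B\subset M$ and $X\in\mathrm{Conf}(M)$, $\#_B(X)$ is the number of particles of $X$ in $B$. For Borel $C\subset M$, $\mathcal{F}_C$ is the $\sigma$-algebra generated by all $\#_B$ with $B\subset C$ bounded Borel, and $\mathcal{F}_C^{\mathbb{P}}$ is its $\mathbb{P}$-completion. A point process $\mathbb{P}$ on $M$ is called rigid if for every bounded Borel $B\subset M$ the random variable $\#_B$ is $\mathcal{F}^{\mathbb{P}}_{M\setminus B}$-measurable. For the kernel $\Pi(x,y)$ of a locally trace-class orthogonal projection in $L_2(M,\mu)$, the determinantal point process $\mathbb{P}_\Pi$ is the unique Borel probability measure on $\mathrm{Conf}(M)$ such that for any bounded measurable $g$ with $g-1$ supported in a bounded set $B$, $\mathbb{E}_{\mathbb{P}_\Pi}\Psi_g=\det(1+(g-1)\Pi\chi_B)$, where $\Psi_g(X)=\prod_{x\in X}g(x)$ and $\chi_B$ is the indicator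 of $B$. *)

(* Defs.v *)
From HB Require Import structures.
From mathcomp Require Import all_boot all_order all_algebra finmap.
From mathcomp Require Import all_classical all_reals all_analysis.
From mathcomp Require Import complex.

Set Implicit Arguments.
Unset Strict Implicit.
Unset Printing Implicit Defensive.

Import Order.TTheory GRing.Theory Num.Theory.
Import numFieldNormedType.Exports.

Local Open Scope classical_set_scope.
Local Open Scope ring_scope.
Local Open Scope complex_scope.

(** ** The space Z' = 1/2 + Z *)

(* The integer n encodes the half-integer n + 1/2. *)
Definition halfint : Type := int.

HB.instance Definition _ := Countable.on halfint.
HB.instance Definition _ := isPointed.Build halfint (0 : int).

Definition hval (R : realType) (x : halfint) : R := (x : int)%:~R + 2^-1.

(** ** Configurations on Z' and their Borel sigma-algebra *)

(* X x is the number of particles of X at x (multiplicities are allowed).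
   Z' has no accumulation point in R, so every function halfint -> nat is
   locally finite. The parameter R only serves the topology below. *)
Definition conf (R : realType) : Type := halfint -> nat.

HB.instance Definition _ (R : realType) := Pointed.on (conf R).

Definition conf_integral (R : realType) (f : halfint -> R) (X : conf R) : R :=
  \sum_(x \in [set: halfint]) f x * (X x)%:R.

(* The vague topology is the coarsest one for which X |-> \int f dX is
   continuous for all continuous, boundedly supported f; on the discrete space
   Z' these are the finitely supported functions. *)
Definition vague_index (R : realType) : set ((halfint -> R) * set R) :=
  [set fU | finite_set [set x | fU.1 x != 0] /\ open fU.2].

Definition vague_subbase (R : realType) (fU : (halfint -> R) * set R) :
    set (conf R) :=
  conf_integral fU.1 @^-1` fU.2.

HB.instance Definition _ (R : realType) :=
  @isSubBaseTopological.Build (conf R) ((halfint -> R) * set R)%type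
    (@vague_index R) (@vague_subbase R).

Notation borel_conf R := (g_sigma_algebraType (@open (conf R))).

(** ** Rigidity *)

(* Bounded subsets of Z' are exactly the finite ones, of type {fset halfint}. *)
Definition count_in (R : realType) (B : {fset halfint}) (X : conf R) : nat :=
  (\sum_(x <- B) X x)%N.

Definition sigma_of (R : realType) (C : set halfint) : set (set (conf R)) :=
  <<s \bigcup_(B in [set B : {fset halfint} | [set` B] `<=` C])
        preimage_set_system setT (@count_in R B) measurable >>.

(* The null sets adjoined are all the subsets of P-null Borel sets of the whole
   space conf R, not only those of the null sets of sigma_of C. With the latter
   reading no process at all would be rigid: an event of sigma_of (~` B)
   puts no constraint on the particles in B, so the only such event included in
   {#_B = n}, for B nonempty, is the empty one. *)
Definition sigma_completed (R : realType) (P : probability (borel_conf R) R)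
    (C : set halfint) : set (set (conf R)) :=
  <<s @sigma_of R C `|` P.-negligible >>.

Definition rigid (R : realType) (P : probability (borel_conf R) R) : Prop :=
  forall B : {fset halfint},
    @measurable_fun _ _
      (g_sigma_algebraType (sigma_completed P (~` [set` B]))) nat
      setT (@count_in R B).

(** ** Determinantal point processes on Z' *)

(* The product is over the particles of X, counted with multiplicity; it is
   finite when g - 1 is finitely supported. *)
Definition Psi (R : realType) (g : halfint -> R) (X : conf R) : R :=
  \big[*%R/1]_(x \in [set: halfint]) g x ^+ X x.

(* Determinant of 1 + A for an operator A on L_2(Z') with kernel A x y vanishing
   unless x and y belong to B: the matrix of 1 + A over B. *)
Definition det_id_add (R : realType) (B : {fset halfint})
    (A : halfint -> halfint -> R[i]) : R[i] :=
  \det (\matrix_(i < #|` B|, j < #|` B|)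
    ((i == j)%:R + A (nth point B i) (nth point B j))).

Definition determinantal (R : realType) (P : probability (borel_conf R) R)
    (K : halfint -> halfint -> R[i]) : Prop :=
  forall (B : {fset halfint}) (g : halfint -> R),
    (forall x, x \notin B -> g x = 1) ->
    P.-integrable setT (EFin \o (Psi g : borel_conf R -> R)) /\
    (fine ('E_P[Psi g])%E)%:C =
      det_id_add B (fun x y => (g x - 1)%:C * K x y * (y \in B)%:R).

(** ** The Gamma-kernel *)

Definition cexp (R : realType) (s : R[i]) : R[i] :=
  (expR (complex.Re s))%:C * (cos (complex.Im s) +i* sin (complex.Im s)).

Definition csin (R : realType) (s : R[i]) : R[i] :=
  (cexp ('i%C * s) - cexp (- ('i%C * s))) / (2 * 'i%C).

(* Euler's limit n! n^s / (s (s + 1) ... (s + n)), valid for every s which is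
   not a nonpositive integer. *)
Definition cgamma (R : realType) (s : R[i]) : R[i] :=
  lim ((fun n : nat => (n`!)%:R * cexp (s * (ln (n%:R : R))%:C)
          / \prod_(k < n.+1) (s + k%:R) : R[i]^o) @ \oo).

(* The Gamma-kernel as a function of real x and y, off the diagonal. The number under the square root
   is positive, and sqrtC then gives the positive root. *)
Definition gamma_expr (R : realType) (z z' : R[i]) (x y : R) : R[i] :=
  let G (t : R) (w : R[i]) := cgamma (t%:C + w + 2^-1) in
  csin ((pi : R)%:C * z) * csin ((pi : R)%:C * z')
    / ((pi : R)%:C * csin ((pi : R)%:C * (z - z')))
  * (sqrtC (G x z * G x z' * G y z * G y z'))^-1
  * ((G x z * G y z' - G x z' * G y z) / (x - y)%:C).

Definition gamma_kernel_neq (R : realType) (z z' : R[i]) (x y : halfint) :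
    R[i] :=
  if x == y
  then lim ((gamma_expr z z' (hval R x) t : R[i]^o) @[t --> (hval R x)^'])
  else gamma_expr z z' (hval R x) (hval R y).

(* The case z = z' occurs only in the complementary series, where both
   parameters are real: hence the limit along real values of z'. *)
Definition gamma_kernel (R : realType) (z z' : R[i]) (x y : halfint) : R[i] :=
  if z == z'
  then lim ((gamma_kernel_neq z t%:C x y : R[i]^o) @[t --> (complex.Re z)^'])
  else gamma_kernel_neq z z' x y.

Definition principal_series (R : realType) (z z' : R[i]) : Prop :=
  z' = z^* /\ z \isn't Num.real.

Definition complementary_series (R : realType) (z z' : R[i]) : Prop :=
  exists (m : int) (a a' : R),
    [/\ z = a%:C, z' = a'%:C, m%:~R < a < (m + 1)%:~R
      & m%:~R < a' < (m + 1)%:~R].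

(* Main.v *)
Require Import Defs.
From HB Require Import structures.
From mathcomp Require Import all_boot all_order all_algebra finmap.
From mathcomp Require Import all_classical all_reals all_analysis.
From mathcomp Require Import complex.
From mathcomp Require Import measurable_realfun ring lra zify.

(** Let a_x be the indicator of a hole at x. Almost surely there are no
multiple particles, so a_x = 1 - X x, and the number of particles in a finite
set B is an affine function of the a_x with x in B. If there are finitely
supported f with f = 1 on B for which the variance of the sum of f x * a_x is
as small as one likes, then by Chebyshev and Borel-Cantelli the number of
particles in B is almost surely a limit of functions of the particles outside
B ([rigid_of_small_variance]). This is the method of Ghosh and Peres.

After a shift of x by an integer, the kernel is that of parameters u, v with
real parts in the interval from 0 to 1. Write k x for its value at (x, x) and
J x y for K x y * K y x. The covariance of a_x and a_y is - J x y for distinct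
x, y and k x - (k x)^2 for x = y. Once
    k x - (k x)^2 = sum over y of J x y     (J x x := 0)
is known, the variance is half the sum of (f x - f y)^2 J x y. Since
J x y is at most w / (x - y)^2 with a weight w that is bounded on average at
every scale, the functions equal to 1 up to level n, to 0 from level 2n on and
linear in between have bounded variance. Two of them with very different n are
almost uncorrelated, so the mean of m of them has variance O(1/m)
([qform_small]).

The displayed identity, which expresses that K is a projection, is proved by
differences along the diagonal ([row_sum_reproducing]): J (x+1) (n+1) - J x n
is a factor depending on x times a function M x n, and the diagonal difference
of M is itself a difference in n, so that its sum over n telescopes. The defect
of the identity then satisfies a first order recurrence with constant data, and
its limits at both infinities force it to vanish.

What remains is to compute. Off the diagonal, J is a multiple of
(rho + 1/rho - 2) / (x - y)^2, where rho is a quotient of two values of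
n |-> Gamma(n + u) / Gamma(n + v) ([kernel_off]); the recurrence of Gamma gives
the identities for J and M, and the growth of Gamma ratios gives the weight. On
the diagonal a derivative of Gamma ratios appears, and k x is a multiple of the
sum over n >= x of 1 / ((n + u)(n + v)) ([gamma_diag_limit]). The multiple is
such that k x tends to 1 at minus infinity: this is the partial fraction
expansion of the cotangent ([cotangent_series], [sine_factor_total]). When
u = v, all of these data are limits as one of the parameters tends to the
other, and the difference of digamma values replaces the ratio rho
([kernel_equal_off], [rigid_equal]). *)

Set Implicit Arguments.
Unset Strict Implicit.
Unset Printing Implicit Defensive.

Import Order.TTheory GRing.Theory Num.Theory.
Import numFieldNormedType.Exports.

Local Open Scope classical_set_scope.
Local Open Scope ring_scope.

(** * Configurations, holes and a criterion for rigidity *)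

Section measurability.
Variable R : realType.

Lemma nat_eq_of_dist_lt1 (a b : nat) : `|a%:R - b%:R| < 1 :> R -> a = b.
Proof.
rewrite ltr_norml => /andP[h1 h2]; have [lt|lt|//] := ltngtP a b.
  have : a%:R + 1 <= b%:R :> R by rewrite natr1 ler_nat.
  by move=> h3; exfalso; lra.
have : b%:R + 1 <= a%:R :> R by rewrite natr1 ler_nat.
by move=> h3; exfalso; lra.
Qed.

Lemma conf_integral_site (x : halfint) (X : conf R) :
  conf_integral (fun y => (y == x)%:R) X = (X x)%:R.
Proof.
rewrite /conf_integral.
rewrite (_ : [set: halfint] = [set` [fset x]%fset] `|` ~` [set` [fset x]%fset]); last by rewrite setUv.
rewrite -(@fsbig_widen _ _ _ _ [set` [fset x]%fset])//.
- by rewrite -fsbig_seq//= big_seq_fset1 eqxx mul1r.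
- move=> y /= [_ yx]; rewrite (_ : (y == x) = false) ?mul0r//.
  by apply/eqP => e; apply: yx; rewrite e inE.
Qed.

(** The indicator of a site is a test function of the vague topology, and an
    integer is determined by the ball of radius 1 around it: the event X x = n
    is open. *)
Lemma measurable_site (x : halfint) (A : set nat) :
  measurable ([set X | A (X x)] : set (borel_conf R)).
Proof.
have H n : measurable ([set X | X x = n] : set (borel_conf R)).
  apply: sub_sigma_algebra.
  have -> : [set X : conf R | X x = n] =
     vague_subbase ((fun y => (y == x)%:R : R), ball (n%:R : R) 1).
    rewrite /vague_subbase/=; apply/seteqP; split => X /=.
      by rewrite conf_integral_site => ->; exact: ballxx.
    by rewrite conf_integral_site /ball/= distrC => /nat_eq_of_dist_lt1.
  pose fU := ((fun y : halfint => (y == x)%:R : R), ball (n%:R : R) 1).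
  have iU : vague_index fU.
    split; last exact: ball_open.
    apply: (@sub_finite_set _ _ [set x]) => // y /=.
    by have [->//|_] := eqVneq y x; rewrite eqxx.
  exists [set [set X | vague_subbase fU X]]; last by rewrite bigcup_set1.
  move=> B /= ->; exists [fset fU]%fset; first by move=> g; rewrite in_fset1 => /eqP ->; rewrite inE.
  apply/seteqP; split => X /=; first by move=> h; apply: (h fU); rewrite /= in_fset1 eqxx.
  by move=> h g /=; rewrite in_fset1 => /eqP ->.
rewrite (_ : [set X | _] = \bigcup_(n in A) [set X | X x = n]).
  exact: bigcup_measurable.
by apply/seteqP; split => [X/= AX|X [n An /= ->]//]; exists (X x).
Qed.
End measurability.

Section emptiness_probabilities.
Variable R : realType.

Lemma Psi_seq (B : {fset halfint}) (g : halfint -> R) (X : conf R) :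
  (forall x, x \notin B -> g x = 1) -> Psi g X = \prod_(x <- B) g x ^+ X x.
Proof.
move=> g1; rewrite /Psi.
rewrite -(@fsbig_widen _ _ _ _ [set` B])//; first by rewrite -fsbig_seq.
by move=> x /= [_ xB]; rewrite g1 ?expr1n//; apply/negP.
Qed.

Lemma det22 (S : comNzRingType) (F : 'I_2 -> 'I_2 -> S) :
  \det (\matrix_(i, j) F i j) =
  F ord0 ord0 * F ord_max ord_max - F ord0 ord_max * F ord_max ord0.
Proof.
rewrite (expand_det_row _ ord0) !big_ord_recl big_ord0 /cofactor !det_mx11 !mxE.
have -> : lift ord0 (0 : 'I_1) = ord_max :> 'I_2 by apply/val_inj.
have -> : lift ord_max (0 : 'I_1) = ord0 :> 'I_2 by apply/val_inj.
by rewrite /= addn0 addn1 expr0 expr1; ring.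
Qed.

Lemma det_id_add1 (x : halfint) (A : halfint -> halfint -> R[i]) :
  det_id_add [fset x]%fset A = 1 + A x x.
Proof.
rewrite /det_id_add.
have -> : enum_fset [fset x]%fset = [:: x].
  apply/perm_small_eq => //; apply: uniq_perm => // y.
  by rewrite in_fset1 mem_seq1.
by rewrite det_mx11 mxE eqxx.
Qed.

Lemma det_id_add2 (x y : halfint) (A : halfint -> halfint -> R[i]) : x != y ->
  det_id_add [fset x; y]%fset A = (1 + A x x) * (1 + A y y) - A x y * A y x.
Proof.
move=> xy; rewrite /det_id_add.
have : perm_eq (enum_fset [fset x; y]%fset) [:: x; y].
  apply: uniq_perm => //=; first by rewrite inE xy.
  by move=> t; rewrite !inE.
move: (enum_fset _) => s pe.
have [->|->] : s = [:: x; y] \/ s = [:: y; x].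
  have sz := perm_size pe; case: s pe sz => [|a [|b [|]]]// pe _.
  have := perm_mem pe a; have := perm_mem pe b; have := perm_uniq pe.
  rewrite /= !inE !eqxx /= orbT !andbT xy => ab.
  move=> /esym/orP[]/eqP eb /esym/orP[]/eqP ea; move: ab; rewrite ea eb ?eqxx//;
    by [left|right].
- by rewrite det22 /= !add0r.
- by rewrite det22 /= !add0r mulrC [A y x * _]mulrC.
Qed.

Variables (P : probability (borel_conf R) R) (K : halfint -> halfint -> R[i]).
Hypothesis hP : determinantal P K.

(** Holes are easier to handle than particles: a function g vanishing on some
    sites turns Psi g into the indicator that they are all empty. *)
Definition vacant (x : halfint) (X : borel_conf R) : R := (X x == 0%N)%:R.

Definition mean (f : borel_conf R -> R) : R := \int[P]_X f X.

Lemma fine_expectation (f : borel_conf R -> R) : fine ('E_P[f])%E = mean f.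
Proof. by rewrite unlock. Qed.

Let pgf (t : R) (x y : halfint) : R := if y == x then t else 1.

Lemma mean_pow (x : halfint) (t : R) :
  P.-integrable setT (fun X : borel_conf R => (t ^+ X x)%:E) /\
  (mean (fun X => t ^+ X x))%:C%C = 1 + (t - 1)%:C%C * K x x.
Proof.
have g1 y : y \notin [fset x]%fset -> pgf t x y = 1.
  by rewrite in_fset1 /pgf => /negbTE ->.
have E X : Psi (pgf t x) X = t ^+ X x.
  by rewrite (Psi_seq _ g1) big_seq_fset1 /pgf eqxx.
have [] := hP g1; rewrite fine_expectation det_id_add1 in_fset1 eqxx mulr1 /pgf eqxx.
rewrite (_ : Psi _ = (fun X => t ^+ X x)); last exact/funext.
by [].
Qed.

Lemma mean_vacant x : P.-integrable setT (EFin \o vacant x) /\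
  (mean (vacant x))%:C%C = 1 - K x x.
Proof.
have [i e] := mean_pow x 0.
rewrite (_ : vacant x = (fun X => 0 ^+ X x)); last first.
  by apply/funext => X; rewrite expr0n.
by split => //; rewrite e sub0r rmorphN rmorph1 mulN1r.
Qed.

Lemma mean_vacant2 x y : x != y ->
  P.-integrable setT (EFin \o (fun X => vacant x X * vacant y X)) /\
  (mean (fun X => vacant x X * vacant y X))%:C%C =
    (1 - K x x) * (1 - K y y) - K x y * K y x.
Proof.
move=> xy; pose g t : R := if (t == x) || (t == y) then 0 else 1.
have g1 t : t \notin [fset x; y]%fset -> g t = 1.
  by rewrite !inE /g => /negbTE ->.
have E X : Psi g X = vacant x X * vacant y X.
  rewrite (Psi_seq _ g1) big_fsetU1 ?inE//= big_seq_fset1 /g !eqxx orbT/=.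
  by rewrite !expr0n.
have [] := hP g1; rewrite fine_expectation det_id_add2// !inE !eqxx !orbT !mulr1 /g !eqxx orbT/=.
rewrite (_ : Psi _ = (fun X => vacant x X * vacant y X)); last exact/funext.
by move=> ? ->; split => //; rewrite add0r rmorphN rmorph1; ring.
Qed.

Let mT := @measurableT _ (borel_conf R).

Lemma meanB (f g : borel_conf R -> R) : P.-integrable setT (EFin \o f) ->
  P.-integrable setT (EFin \o g) -> P.-integrable setT (EFin \o (f \- g)) /\
  mean (f \- g) = mean f - mean g.
Proof. by move=> fi gi; split; [exact: (integrableB mT fi gi)|exact: RintegralB]. Qed.

Lemma meanD (f g : borel_conf R -> R) : P.-integrable setT (EFin \o f) ->
  P.-integrable setT (EFin \o g) -> P.-integrable setT (EFin \o (f \+ g)) /\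
  mean (f \+ g) = mean f + mean g.
Proof. by move=> fi gi; split; [exact: (integrableD mT fi gi)|exact: RintegralD]. Qed.

Lemma meanZ (c : R) (f : borel_conf R -> R) : P.-integrable setT (EFin \o f) ->
  P.-integrable setT (EFin \o (fun X => c * f X)) /\
  mean (fun X => c * f X) = c * mean f.
Proof.
move=> fi; split; last by rewrite /mean RintegralZl.
exact: (integrableZl mT c fi).
Qed.

Lemma mean_sum (I : Type) (s : seq I) (f : I -> borel_conf R -> R) :
  (forall i, P.-integrable setT (EFin \o f i)) ->
  P.-integrable setT (EFin \o (fun X => \sum_(i <- s) f i X)) /\
  mean (fun X => \sum_(i <- s) f i X) = \sum_(i <- s) mean (f i).
Proof.
move=> fi; elim: s => [|i s [IH1 IH2]].
  under eq_fun do rewrite big_nil.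
  rewrite big_nil; split; last by rewrite /mean Rintegral_cst// mul0r.
  exact: (integrable0 P setT).
have [H1 H2] := meanD (fi i) IH1.
rewrite big_cons -IH2 -H2.
rewrite (_ : (fun X => \sum_(j <- i :: s) f j X) =
  (f i \+ (fun X => \sum_(j <- s) f j X))) //.
by apply/funext => X; rewrite big_cons.
Qed.

Lemma markov_mean (h : borel_conf R -> R) (A : set (borel_conf R)) (c : R) :
  measurable A -> P.-integrable setT (EFin \o h) -> (forall X, 0 <= h X) ->
  0 <= c -> (forall X, A X -> 1 <= c * h X) -> (P A <= (c * mean h)%:E)%E.
Proof.
move=> mA ih h0 c0 Ah; have [ich <-] := meanZ c ih.
rewrite /mean /Rintegral fineK; last exact: integrable_fin_num.
rewrite -[A]setIT -integral_indic//; apply: ge0_le_integral => //=.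
- by apply/measurable_EFinP; exact: measurable_indic.
- by have /integrableP[] := ich.
- move=> X _; rewrite lee_fin indicE; have [/set_mem AX|_] := boolP (X \in A).
    exact: Ah.
  by rewrite mulr_ge0.
Qed.

(** The polynomial h(j) = 2^j - 2 + 0^j of the number j of particles vanishes
    at 0 and 1 and is at least 1 from 2 on. Its mean is a second difference of
    t |-> 1 + (t - 1) K(x,x), which is affine. *)
Lemma simple_site x : P [set X | (1 < X x)%N] = 0%E.
Proof.
pose h (X : borel_conf R) : R := 2 ^+ X x - 2 * 1 ^+ X x + 0 ^+ X x.
have [i2 e2] := mean_pow x 2; have [i1 e1] := mean_pow x 1.
have [i0 e0] := mean_pow x 0.
have [i3 e3] := meanZ 2 i1.
have [i4 e4] := meanB i2 i3; have [i5 e5] := meanD i4 i0.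
have h0 : mean h = 0.
  apply: (@complexI R); rewrite rmorph0; rewrite [mean h]e5 e4 e3.
  rewrite rmorphD rmorphB rmorphM /= e0 e1 e2; ring.
have : (P [set X | (1 < X x)%N] <= (1 * mean h)%:E)%E.
  apply: markov_mean => //; first exact: (measurable_site x [set n | (1 < n)%N]).
    move=> X; rewrite /h expr1n; case: (X x) => [|[|n]]; rewrite ?expr0 ?expr1 ?expr0n/=; [lra|lra|].
    have : 1 <= 2 ^+ n.+1 :> R by apply: exprn_ege1; rewrite ler1n.
    by rewrite [2 ^+ n.+2]exprS; lra.
  move=> X; rewrite /h expr1n /=; case: (X x) => [|[|n]]//= _.
  have : 1 <= 2 ^+ n :> R by apply: exprn_ege1; rewrite ler1n.
  by rewrite !exprS mul0r; lra.
by rewrite h0 mulr0 => H; apply/eqP; rewrite -measure_le0.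
Qed.

Definition cov (x y : halfint) : R :=
  mean (fun X => vacant x X * vacant y X) - mean (vacant x) * mean (vacant y).

Lemma vacant_idem x X : vacant x X * vacant x X = vacant x X.
Proof. by rewrite /vacant; case: eqP; rewrite ?mul1r ?mul0r. Qed.

Lemma integrable_vacant2 x y :
  P.-integrable setT (EFin \o (fun X => vacant x X * vacant y X)).
Proof.
have [<-|xy] := eqVneq x y; last by have [] := mean_vacant2 xy.
rewrite (_ : (fun X => _) = vacant x); first by have [] := mean_vacant x.
by apply/funext => X; rewrite vacant_idem.
Qed.

Definition dev (f : halfint -> R) (s : seq halfint) (X : borel_conf R) : R :=
  \sum_(x <- s) f x * (vacant x X - mean (vacant x)).

Lemma mean_cst (c : R) : P.-integrable setT (EFin \o (fun _ : borel_conf R => c)) /\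
  mean (fun=> c) = c.
Proof.
split; last by rewrite /mean Rintegral_cst//= probability_setT mulr1.
by apply: finite_measure_integrable_cst; exact: mT.
Qed.

Lemma mean_dev2 f s : P.-integrable setT (EFin \o (fun X => dev f s X ^+ 2)) /\
  mean (fun X => dev f s X ^+ 2) =
  \sum_(x <- s) \sum_(y <- s) f x * f y * cov x y.
Proof.
pose c x := mean (vacant x).
pose F x y X := f x * f y * (vacant x X * vacant y X - c y * vacant x X
   - c x * vacant y X + c x * c y).
have E : (fun X => dev f s X ^+ 2) = (fun X => \sum_(x <- s) \sum_(y <- s) F x y X).
  apply/funext => X; rewrite expr2 /dev big_distrl; apply: eq_bigr => x _.
  rewrite /= big_distrr; apply: eq_bigr => y _; rewrite /F /c /=; ring.
have iF x y : P.-integrable setT (EFin \o F x y) /\ mean (F x y) = f x * f y * cov x y.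
  have [i1 e1] := mean_vacant x; have [i2 e2] := mean_vacant y.
  have i0 := integrable_vacant2 x y.
  have [i3 e3] := meanZ (c y) i1; have [i4 e4] := meanZ (c x) i2.
  have [i5 e5] := meanB i0 i3; have [i6 e6] := meanB i5 i4.
  have [i8 e8] := mean_cst (c x * c y).
  have [i7 e7] := meanD i6 i8.
  have [i9 e9] := meanZ (f x * f y) i7.
  split; first exact: i9.
  by rewrite [LHS]e9 e7 e6 e5 e4 e3 e8 /cov /c; ring.
have iF1 x : P.-integrable setT (EFin \o (fun X => \sum_(y <- s) F x y X)) /\
    mean (fun X => \sum_(y <- s) F x y X) = \sum_(y <- s) f x * f y * cov x y.
  have [H1 H2] := mean_sum s (fun y => (iF x y).1); split => //.
  by rewrite H2; apply: eq_bigr => y _; exact: (iF x y).2.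
rewrite E; have [H1 H2] := mean_sum s (fun x => (iF1 x).1); split => //.
by rewrite H2; apply: eq_bigr => x _; exact: (iF1 x).2.
Qed.

Lemma measurable_vacant x : measurable_fun setT (vacant x).
Proof.
have [/integrableP[m _] _] := mean_vacant x.
exact/measurable_EFinP.
Qed.

Lemma measurable_dev f s : measurable_fun setT (dev f s).
Proof.
apply: measurable_sum => x; apply: measurable_funM; first exact: measurable_cst.
by apply: measurable_funB; [exact: measurable_vacant|exact: measurable_cst].
Qed.

Lemma chebyshev_dev f s :
  measurable [set X | (2^-1 <= `|dev f s X|)%R] /\
  (P [set X | (2^-1 <= `|dev f s X|)%R] <=
    (4 * \sum_(x <- s) \sum_(y <- s) f x * f y * cov x y)%:E)%E.
Proof.
have m : measurable [set X | (2^-1 <= `|dev f s X|)%R].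
  have mn : measurable_fun setT (fun X => `|dev f s X|).
    by apply: measurableT_comp => //; exact: measurable_dev.
  have := mn mT _ (measurable_itv `[2^-1, +oo[).
  by rewrite setTI; congr measurable; apply/seteqP; split => X /=;
    rewrite in_itv /= andbT.
split => //; have [i <-] := mean_dev2 f s.
apply: markov_mean => // [X|X /= h]; first exact: sqr_ge0.
by rewrite -real_normK ?num_real//; move: h; move: (`|dev f s X|) => t h; nra.
Qed.

Lemma limsup_null (D : nat -> set (borel_conf R)) :
  (forall n, measurable (D n) /\ (P (D n) <= (1 / (2 ^ n.+1)%:R)%:E)%E) ->
  P.-negligible (lim_sup_set D).
Proof.
move=> DP; have mD n : measurable (D n) by have [] := DP n.
apply/negligibleP.
  by apply: bigcap_measurableType => j _; apply: bigcup_measurable.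
apply: lim_sup_set_cvg0 => //.
apply: (@le_lt_trans _ _ (\sum_(n <oo) (1 / (2 ^ n.+1)%:R)%:E)%E).
  by apply: lee_nneseries => // n _; exact: (DP n).2.
by apply: le_lt_trans (ltry (1 : R)); exact: (@epsilon_trick0 R 1 xpredT).
Qed.

Lemma many_particles_null : P.-negligible [set X : borel_conf R | exists x, (1 < X x)%N].
Proof.
pose D (x : option halfint) :=
  oapp (fun y => [set X : borel_conf R | (1 < X y)%N]) set0 x.
rewrite (_ : [set X | _] = \bigcup_n D (choice.unpickle n)); last first.
  apply/seteqP; split => X /=.
    by move=> [x Xx]; exists (choice.pickle x) => //=; rewrite choice.pickleK.
  by move=> [n _ /=]; case: choice.unpickle => // x Xx; exists x.
apply: negligible_bigcup => n; case: choice.unpickle => [x|] /=.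
  apply/negligibleP; last exact: simple_site.
  exact: (measurable_site x [set n | (1 < n)%N]).
exact: negligible_set0.
Qed.

Lemma measurable_site_completed (B : {fset halfint}) (x : halfint) : x \notin B ->
  @measurable_fun _ _ (g_sigma_algebraType (sigma_completed P (~` [set` B]))) nat
    setT (fun X => X x).
Proof.
move=> xB _ A mA; rewrite setTI.
do 2!apply: sub_sigma_algebra; left; apply: sub_sigma_algebra.
exists [fset x]%fset.
  by move=> y /=; rewrite in_fset1 => /eqP ->; exact/negP.
exists A => //; rewrite setTI; apply/seteqP; split => X /=;
  by rewrite /count_in big_seq_fset1.
Qed.

(** Choose f n equal to 1 on B, with the variance of its statistic of order
    2^-n. Almost surely the centred statistics are eventually smaller than 1/2
    in absolute value, so that the number of particles in B is eventually the
    only integer within 1/2 of Y n X, which depends only on the particles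
    outside B. *)
Lemma rigid_of_small_variance :
  (forall (B : {fset halfint}) (e : R), 0 < e ->
    exists s f, [/\ uniq s, (forall x, x \in B -> x \in s /\ f x = 1) &
      \sum_(x <- s) \sum_(y <- s) f x * f y * cov x y < e]) ->
  rigid P.
Proof.
move=> sv B.
have [sf sfP] : {sf : nat -> seq halfint * (halfint -> R) & forall n,
   [/\ uniq (sf n).1, (forall x, x \in B -> x \in (sf n).1 /\ (sf n).2 x = 1) &
      4 * \sum_(x <- (sf n).1) \sum_(y <- (sf n).1) (sf n).2 x * (sf n).2 y * cov x y
      <= 1 / (2 ^ n.+1)%:R]}.
  apply: (@choice _ _ (fun n sf => [/\ uniq sf.1, (forall x, x \in B -> x \in sf.1 /\ sf.2 x = 1) &
      4 * \sum_(x <- sf.1) \sum_(y <- sf.1) sf.2 x * sf.2 y * cov x y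
      <= 1 / (2 ^ n.+1)%:R])) => n.
  have [|s [f [us Bs se]]] := sv B (1 / (2 ^ n.+1)%:R / 4).
    by rewrite !divr_gt0// ltr0n expn_gt0.
  exists (s, f); split => //=; move: se; rewrite ltr_pdivlMr// mulrC; exact: ltW.
pose s n := (sf n).1; pose f n := (sf n).2.
pose D n := [set X | (2^-1 <= `|dev (f n) (s n) X|)%R].
have N1 : P.-negligible (lim_sup_set D).
  apply: limsup_null => n; have [m Pm] := chebyshev_dev (f n) (s n).
  split => //; apply: le_trans Pm _; rewrite lee_fin.
  by have [] := sfP n.
pose N := lim_sup_set D `|` [set X : borel_conf R | exists x, (1 < X x)%N].
have negN : P.-negligible N by apply: negligibleU => //; exact: many_particles_null.
pose C n := \sum_(x <- s n) f n x * (1 - mean (vacant x)).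
(* For configurations without multiple particles, dev (f n) (s n) X is Y n X
   minus the number of particles in B. *)
pose Y n (X : conf R) : R := C n - \sum_(x <- s n | x \notin B) f n x * (X x)%:R.
have YE n X : ~ N X -> dev (f n) (s n) X = Y n X - (@count_in R B X)%:R.
  move=> NX; have X1 x : vacant x X = 1 - (X x)%:R.
    have : (X x <= 1)%N by rewrite leqNgt; apply/negP => X1; apply: NX; right; exists x.
    by rewrite /vacant; case: (X x) => [|[|]]//= _; rewrite ?subr0 ?subrr.
  have [us Bs _] := sfP n; rewrite -/(s n) -/(f n) in us Bs.
  have -> : (@count_in R B X)%:R = \sum_(x <- s n | x \in B) f n x * (X x)%:R.
    rewrite /count_in natr_sum -[RHS]big_filter.
    rewrite (perm_big [seq x <- s n | x \in B]); last first.
      apply: uniq_perm; [exact: fset_uniq|exact: filter_uniq|] => x.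
      by rewrite mem_filter; case xB : (x \in B) => //=; have [-> _] := Bs x xB.
    rewrite !big_filter; apply: eq_bigr => x xB; have [_ ->] := Bs x xB.
    by rewrite mul1r.
  rewrite /dev /Y /C -addrA -opprD -[RHS]/(_ - (_ + _)) addrC.
  rewrite [X in - X]addrC -(bigID (fun x => x \in B) xpredT)/= addrC -sumrB.
  by apply: eq_bigr => x _; rewrite X1; ring.
pose T := g_sigma_algebraType (sigma_completed P (~` [set` B])).
have mN (A : set T) : A `<=` N -> measurable A.
  by move=> AN; do 2!apply: sub_sigma_algebra; right; exact: negligibleS negN.
have mY n : measurable_fun setT (Y n : T -> R).
  apply: measurable_funB; first exact: measurable_cst.
  rewrite (_ : (fun X => _) = (fun X : T => \sum_(x <- [seq x <- s n | x \notin B])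
     f n x * (if x \in B then 0 else (X x)%:R))); last first.
    by apply/funext => X; rewrite big_filter; apply: eq_bigr => x /negbTE ->.
  apply: measurable_sum => x; apply: measurable_funM; first exact: measurable_cst.
  case xB : (x \in B); first exact: measurable_cst.
  have := measurable_site_completed (negbT xB).
  apply: (@measurableT_comp _ _ _ _ _ _ (fun n : nat => n%:R : R)).
  by move=> _ A _; rewrite setTI.
pose L m := \bigcup_j \bigcap_(i in [set i | (j <= i)%N]) [set X : T | `|Y i X - m%:R| < 2^-1].
have mL m : measurable (L m).
  apply: bigcup_measurable => j _; apply: bigcap_measurableType => i _.
  have mn : measurable_fun setT (fun X : T => `|Y i X - m%:R|).
    apply: measurableT_comp => //; apply: measurable_funB => //.
  have := mn measurableT _ (measurable_itv `]-oo, 2^-1[).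
  by rewrite setTI; congr measurable; apply/seteqP; split => X /=; rewrite in_itv.
have LE m X : ~ N X -> L m X <-> @count_in R B X = m.
  move=> NX; have [j Pj] : exists j, forall i, (j <= i)%N -> `|Y i X - (@count_in R B X)%:R| < 2^-1.
    apply: contrapT => H; apply: (NX); left => j _.
    apply: contrapT => Hj; apply: (H); exists j => i ji.
    rewrite -YE// ltNge; apply/negP => h; apply: Hj; exists i => //.
  split.
    move=> [j' _ /(_ (maxn j j') (leq_maxr _ _)) /= h].
    have h' := Pj _ (leq_maxl j j').
    apply: (@nat_eq_of_dist_lt1 R).
    move: h h'; rewrite !ltr_norml => /andP[a1 a2] /andP[a3 a4].
    by apply/andP; split; lra.
  by move=> <-; exists j.
move=> _ A mA; rewrite setTI.
rewrite (_ : _ @^-1` _ = \bigcup_(m in A) [set X : T | @count_in R B X = m]); last first.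
  by apply/seteqP; split => [X /= AX|X [m Am /= ->]//]; exists (@count_in R B X).
apply: bigcup_measurable => m _.
rewrite (_ : [set X : T | _] = (L m `\` N) `|` ([set X : T | @count_in R B X = m] `&` N)).
  apply: measurableU; last by apply: mN => X [].
  by apply: measurableD => //; exact: mN.
apply/seteqP; split => X /=.
  by move=> e; have [NX|NX] := pselect (N X); [right|left; split => //; apply/LE].
by case=> [[LX NX]|[]//]; apply/LE.
Qed.

End emptiness_probabilities.

(** * Weights that are bounded on average *)

Section weights.
Variable R : realType.
Implicit Types (v : nat -> R) (w : nat -> nat -> R).

Lemma sum_le_telescope (F G : nat -> R) (n N : nat) :
  (forall k, (n <= k)%N -> F k <= G k - G k.+1) -> (forall k, 0 <= G k) ->
  \sum_(n <= k < N) F k <= G n.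
Proof.
move=> FG G0; have [nN|Nn] := leqP n N; last first.
  by rewrite big_geq// ltnW.
have : \sum_(n <= k < N) F k <= \sum_(n <= k < N) (G k - G k.+1).
  by rewrite !big_nat; apply: ler_sum => k /andP[nk _]; exact: FG.
move=> /le_trans; apply.
rewrite (eq_bigr (fun k => - (G k.+1 - G k))); last by move=> k _; rewrite opprB.
by rewrite sumrN telescope_sumr// opprB gerBl.
Qed.

(** The behaviour of a power n^s with -1 < s < 1. *)
Definition balanced v := exists C : R, [/\ 0 < C,
  forall n, (0 < n)%N -> \sum_(0 <= k < n) v k <= C * n%:R * v n &
  forall n N, (0 < n)%N -> \sum_(n <= k < N) v k / k%:R ^+ 2 <= C * v n / n%:R].

(** Such a v grows like n^(a - b). Both sums telescope: v n * (n + b - 1) has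
    the increments (1 + a - b) v n, and v n / (n + b) has decrements
    comparable to v n / n^2. *)
Lemma balanced_rec v (a b : R) : 0 < a -> 0 < b -> -1 < a - b < 1 ->
  (forall n, 0 < v n) -> (forall n, v n.+1 * (n%:R + b) = v n * (n%:R + a)) ->
  balanced v.
Proof.
move=> a0 b0 /andP[d1 d2] v0 vS.
have n0 n : 0 <= n%:R :> R by exact: ler0n.
have vS' n : v n.+1 = v n * (n%:R + a) / (n%:R + b).
  by rewrite -vS mulfK// gt_eqF// ltr_wpDl.
(* The shift by -1 makes the increments of h exact multiples of v. *)
pose h n := v n * (n%:R + b - 1).
have hS n : h n.+1 = h n + (1 + a - b) * v n.
  have := n0 n; rewrite /h vS' -natr1 => nn; field; apply/negP => /eqP; lra.
have hsum n : (1 + a - b) * \sum_(0 <= k < n) v k = h n - h 0%N.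
  elim: n => [|n IH]; first by rewrite big_geq// mulr0 subrr.
  by rewrite big_nat_recr//= mulrDr IH hS; ring.
have hv n : (0 < n)%N -> v 0%N * a <= h n.
  elim: n => // -[_ _|n IH _]; first by rewrite hS /h; lra.
  by rewrite hS; apply: le_trans (IH isT) _; rewrite lerDl mulr_ge0// ?ltW//; lra.
pose C1 := (1 + b) * (1 + a^-1) / (1 + a - b).
pose C2 := (1 + b) * (2 + b) / (1 - a + b).
have ai : 0 < a^-1 by rewrite invr_gt0.
have C10 : 0 < C1 by apply: divr_gt0; [apply: mulr_gt0|]; lra.
have C20 : 0 < C2 by apply: divr_gt0; [apply: mulr_gt0|]; lra.
exists (C1 + C2); split; first exact: addr_gt0.
- move=> n n1; have n1' : 1 <= n%:R :> R by rewrite ler1n.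
  apply: (@le_trans _ _ (C1 * n%:R * v n)); last first.
    by rewrite !ler_wpM2r// ?ltW// ltrDl.
  rewrite /C1 -mulrA mulrAC ler_pdivlMr; last lra.
  rewrite mulrC hsum.
  have hn := hv _ n1.
  have : h n <= (1 + b) * (n%:R * v n).
    by rewrite /h mulrA [leRHS]mulrC ler_pM2l//; nra.
  have : v 0%N <= h n * a^-1 by rewrite ler_pdivlMr.
  have -> : h 0%N = v 0%N * (b - 1) by rewrite /h add0r.
  move=> l1 l2; have vb : v 0%N * b >= 0 by rewrite mulr_ge0// ltW.
  have := ler_wpM2l (ltW (addr_gt0 (@ltr01 R) ai)) l2.
  by rewrite mulrA [(1 + a^-1) * _]mulrC; nra.
- move=> n N n1.
  pose G k := C2 * (v k / (k%:R + b)).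
  have G0 k : 0 <= G k.
    by rewrite ltW// /G mulr_gt0// divr_gt0// ltr_wpDl.
  apply: (@le_trans _ _ (G n)); last first.
    have n1' : 0 < n%:R :> R by rewrite ltr0n.
    rewrite /G -mulrA; apply: ler_pM.
    - exact: ltW.
    - by rewrite ltW// divr_gt0// ltr_wpDl.
    - by rewrite lerDr ltW.
    - by rewrite ler_pM2l// lef_pV2 ?posrE ?ltr_wpDl// lerDl ltW.
  apply: sum_le_telescope => // k nk.
  have k1 : 1 <= k%:R :> R by rewrite ler1n (leq_trans n1).
  have -> : G k - G k.+1 = (1 + b) * (2 + b) * v k / ((k%:R + b) * (k%:R + 1 + b)).
    by rewrite /G /C2 vS' -natr1; field; rewrite !gt_eqF//; lra.
  rewrite [X in _ <= X / _]mulrC -[leRHS]mulrA ler_pM2l//.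
  rewrite ler_pdivlMr; last by apply: mulr_gt0; lra.
  rewrite mulrC ler_pdivrMr ?exprn_gt0//; last lra.
  rewrite expr2 mulrACA; apply: ler_pM; nra.
Qed.

(** A weight whose averages over the ranges of size n are bounded. These are
    the sums met when a kernel bounded by w / (x - y)^2 is summed over far
    pairs: for one point or for all points of level below n, within that range
    or beyond it. *)
Definition tame w := exists C : R, [/\ 0 < C, (forall i j, 0 <= w i j),
  (forall n, (0 < n)%N -> \sum_(0 <= j < n) w n j <= C * n%:R),
  (forall n N, (0 < n)%N ->
    \sum_(n <= j < N) w n j / j%:R ^+ 2 <= C / n%:R) &
  (forall n, (0 < n)%N ->
    \sum_(0 <= i < n) \sum_(0 <= j < n) w i j <= C * n%:R ^+ 2) /\
  (forall n N, (0 < n)%N ->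
    \sum_(0 <= i < n) \sum_(n <= j < N) w i j / j%:R ^+ 2 <= C)].

Lemma tame_add w1 w2 : tame w1 -> tame w2 -> tame (fun i j => w1 i j + w2 i j).
Proof.
move=> [C [C0 w0 p1 p2 [p3 p4]]] [D [D0 u0 q1 q2 [q3 q4]]].
exists (C + D); split.
- exact: addr_gt0.
- by move=> i j; rewrite addr_ge0.
- by move=> n n0; rewrite big_split/= mulrDl lerD ?p1 ?q1.
- move=> n N n0; rewrite mulrDl (le_trans _ (lerD (p2 n N n0) (q2 n N n0)))//.
  by rewrite -big_split/=; apply: ler_sum => j _; rewrite mulrDl.
- split=> [n n0|n N n0].
    rewrite mulrDl (le_trans _ (lerD (p3 n n0) (q3 n n0)))//.
    by rewrite -big_split/=; apply: ler_sum => j _; rewrite big_split.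
  rewrite (le_trans _ (lerD (p4 n N n0) (q4 n N n0)))//.
  rewrite -big_split/=; apply: ler_sum => i _; rewrite -big_split/=.
  by apply: ler_sum => j _; rewrite mulrDl.
Qed.

Lemma tame_ratio v : (forall n, 0 < v n) -> balanced v ->
  balanced (fun n => (v n)^-1) -> tame (fun i j => v i / v j).
Proof.
move=> v0 [C [C0 c1 c2]] [D [D0 d1 d2]].
have S1 n : (0 < n)%N -> \sum_(0 <= j < n) v n / v j <= D * n%:R.
  move=> n0; rewrite -big_distrr/= mulrC -ler_pdivlMr//; exact: d1.
have S2 n N : (0 < n)%N -> \sum_(n <= j < N) v n / v j / j%:R ^+ 2 <= D / n%:R.
  move=> n0; under eq_bigr do rewrite -mulrA.
  rewrite -big_distrr/= mulrC -ler_pdivlMr//.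
  by rewrite mulrAC; exact: d2.
exists (D + C * D); split => //.
- by rewrite addr_gt0 ?mulr_gt0.
- by move=> i j; rewrite divr_ge0 ?ltW.
- move=> n n0; apply: le_trans (S1 n n0) _.
  by rewrite ler_wpM2r// lerDl mulr_ge0 ?ltW.
- move=> n N n0; apply: le_trans (S2 n N n0) _.
  by rewrite ler_wpM2r ?invr_ge0// lerDl mulr_ge0 ?ltW.
- split=> [n n0|n N n0].
    apply: (@le_trans _ _ (C * D * n%:R ^+ 2)); last first.
      by rewrite ler_wpM2r ?exprn_ge0// lerDr ltW.
    under eq_bigr do rewrite -big_distrr/=.
    rewrite -big_distrl/=.
    apply: (@le_trans _ _ ((C * n%:R * v n) * (D * n%:R * (v n)^-1))).
      apply: ler_pM; [|by apply: sumr_ge0 => j _; rewrite invr_ge0 ltW|exact: c1|exact: d1].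
      by apply: sumr_ge0 => j _; rewrite ltW.
    by rewrite le_eqVlt; apply/orP; left; apply/eqP; field; rewrite gt_eqF.
  apply: (@le_trans _ _ (C * D)); last by rewrite lerDr ltW.
  under eq_bigr => i _ do (under eq_bigr do rewrite -mulrA; rewrite -big_distrr/=).
  rewrite -big_distrl/=.
  apply: (@le_trans _ _ ((C * n%:R * v n) * (D * (v n)^-1 / n%:R))).
    apply: ler_pM; [| |exact: c1|exact: d2].
      by apply: sumr_ge0 => j _; rewrite ltW.
    by apply: sumr_ge0 => j _; rewrite divr_ge0 ?invr_ge0 ?exprn_ge0// ltW.
  rewrite le_eqVlt; apply/orP; left; apply/eqP; field.
  by rewrite pnatr_eq0 -lt0n n0 gt_eqF.
Qed.

Lemma tame_sym_ratio v : (forall n, 0 < v n) -> balanced v ->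
  balanced (fun n => (v n)^-1) -> tame (fun i j => v i / v j + v j / v i).
Proof.
move=> v0 b1 b2; apply: tame_add; first exact: tame_ratio.
have := @tame_ratio (fun n => (v n)^-1).
rewrite (_ : (fun i j => (v i)^-1 / (v j)^-1) = (fun i j => v j / v i)).
  apply => //; first by move=> n; rewrite invr_gt0.
  by rewrite (_ : (fun n => _) = v)//; apply/funext => n; rewrite invrK.
by apply/funext => i; apply/funext => j; rewrite invrK mulrC.
Qed.

End weights.

(** * Sums over the integers, by levels *)

Section bilateral_sums.
Variable R : realType.
Implicit Types F G H : int -> R.

(** The points n and - (n + 1) have the same level, so the points of level
    below N form an interval symmetric about -1/2. *)
Definition lev (x : int) : nat := match x with Posz i => i | Negz i => i end.

Definition bsum F (N : nat) : R := \sum_(0 <= i < N) (F i%:Z + F (Negz i)).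

Lemma bsumS F N : bsum F N.+1 = bsum F N + (F N%:Z + F (Negz N)).
Proof. by rewrite /bsum big_nat_recr. Qed.

Lemma bsum0 F : bsum F 0 = 0.
Proof. by rewrite /bsum big_geq. Qed.

Lemma eq_bsum F G N : (forall x, (lev x < N)%N -> F x = G x) -> bsum F N = bsum G N.
Proof.
by move=> FG; apply: eq_big_nat => i /andP[_ iN]; rewrite !FG.
Qed.

Lemma le_bsum F G N : (forall x, (lev x < N)%N -> F x <= G x) -> bsum F N <= bsum G N.
Proof.
move=> FG; rewrite /bsum !big_nat; apply: ler_sum => i /andP[_ iN].
by rewrite lerD// FG.
Qed.

Lemma bsum_ge0 F N : (forall x, 0 <= F x) -> 0 <= bsum F N.
Proof. by move=> F0; apply: sumr_ge0 => i _; rewrite addr_ge0. Qed.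

Lemma bsumD F G N : bsum (fun x => F x + G x) N = bsum F N + bsum G N.
Proof. by rewrite /bsum -big_split/=; apply: eq_bigr => i _; ring. Qed.

Lemma bsumB F G N : bsum (fun x => F x - G x) N = bsum F N - bsum G N.
Proof. by rewrite /bsum -sumrB; apply: eq_bigr => i _; ring. Qed.

Lemma bsumZ a F N : bsum (fun x => a * F x) N = a * bsum F N.
Proof. by rewrite /bsum big_distrr; apply: eq_bigr => i _ /=; ring. Qed.

Lemma bsum_lev (f : nat -> R) N : bsum (fun x => f (lev x)) N = 2 * \sum_(0 <= i < N) f i.
Proof. by rewrite /bsum big_distrr; apply: eq_bigr => i _ /=; ring. Qed.

Lemma bsum_cat F n N : (n <= N)%N ->
  bsum F N = bsum F n + \sum_(n <= i < N) (F i%:Z + F (Negz i)).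
Proof. by move=> nN; rewrite /bsum -big_cat_nat. Qed.

Lemma bsum_trunc F n N : (n <= N)%N -> (forall x, (n <= lev x)%N -> F x = 0) ->
  bsum F N = bsum F n.
Proof.
move=> nN F0; rewrite (bsum_cat _ nN) big_nat big1 ?addr0// => i /andP[ni _].
by rewrite !F0 ?addr0.
Qed.

Lemma exchange_bsum (F : int -> int -> R) n N :
  bsum (fun x => bsum (F x) N) n = bsum (fun y => bsum (F ^~ y) n) N.
Proof.
rewrite /bsum; under eq_bigr do rewrite -big_split/=.
rewrite exchange_big/=; apply: eq_bigr => i _; rewrite -big_split/=.
by apply: eq_bigr => j _; ring.
Qed.

Lemma bsum_shift F N :
  bsum (fun n => F (n + 1)) N = bsum F N + F N%:Z - F (- N%:Z).
Proof.
elim: N => [|N IH]; first by rewrite !bsum0 add0r subrr.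
rewrite !bsumS IH (_ : (N%:Z + 1)%R = N.+1%:Z); last by lia.
rewrite (_ : Negz N + 1 = - N%:Z); last by lia.
by rewrite (_ : - N.+1%:Z = Negz N); [ring|lia].
Qed.

Lemma bsum_telescope F N :
  bsum (fun n => F (n + 1) - F n) N = F N%:Z - F (- N%:Z).
Proof. by rewrite bsumB bsum_shift; ring. Qed.

Lemma bsum_nd F : (forall x, 0 <= F x) -> nondecreasing_seq (bsum F).
Proof.
move=> F0; apply/nondecreasing_seqP => n.
by rewrite bsumS lerDl addr_ge0.
Qed.

Lemma bsum_cvg F (B : R) : (forall x, 0 <= F x) -> (forall N, bsum F N <= B) ->
  bsum F @ \oo --> limn (bsum F).
Proof.
move=> F0 FB; apply: nondecreasing_is_cvgn; first exact: bsum_nd.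
by exists B => _ [N _ <-].
Qed.

Lemma bsum_cvg_const (F : nat -> int -> R) (G : int -> R) n :
  (forall x, F m x @[m --> \oo] --> G x) -> bsum (F m) n @[m --> \oo] --> bsum G n.
Proof.
move=> FG; elim: n => [|n IH].
  by under eq_fun do rewrite bsum0; rewrite bsum0; exact: cvg_cst.
under eq_fun do rewrite bsumS; rewrite bsumS.
by apply: cvgD => //; apply: cvgD.
Qed.

Lemma bsum_single (F : int -> R) x N : (lev x < N)%N ->
  (forall y, y != x -> F y = 0) -> bsum F N = F x.
Proof.
move=> xN F0; pose n := lev x.
rewrite (bsum_cat _ xN) bsumS.
rewrite (_ : bsum F (lev x) = 0).
  rewrite add0r [X in _ + X]big_nat [X in _ + X]big1 => [|i /andP[xi _]].
    rewrite addr0; case: x {xN n} F0 => i F0 /=; first by rewrite (F0 (Negz i)) ?addr0.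
    by rewrite (F0 (Posz i)) ?add0r.
  by rewrite !F0 ?addr0//; case: x xi {xN F0 n} => j /=; lia.
rewrite -[RHS](bsum0 (fun=> 0)).
rewrite (@eq_bsum _ (fun=> 0)) ?bsum0; last first.
  by move=> y yx; apply: F0; apply/eqP => yx'; move: yx; rewrite yx' ltnn.
by rewrite /bsum big1// => i _; rewrite addr0.
Qed.

Lemma intr_abs (x : int) : `|x%:~R| = `|x|%N%:R :> R.
Proof. by rewrite -intr_norm -abszE pmulrn. Qed.

Lemma lev_dist (x y : int) : (lev y - lev x <= `|x - y|)%N.
Proof. by case: x => i; case: y => j /=; lia. Qed.

End bilateral_sums.

(** * Small variances, and the projection identity *)

Section kernel_squares.
Variable R : realType.
Variables (J : int -> int -> R) (k : int -> R) (w : nat -> nat -> R) (C : R).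
Hypotheses (C0 : 0 < C) (tw : tame w).
Hypotheses (Jsym : forall x y, J x y = J y x) (Jxx : forall x, J x x = 0).
Hypothesis J0 : forall x y, 0 <= J x y.
Hypothesis JD : forall x y, (x - y)%:~R ^+ 2 * J x y <= C * w (lev x) (lev y).

Lemma far_bound (x y : int) (a : R) : 0 < a -> a <= `|(x - y)%:~R| ->
  J x y <= C * w (lev x) (lev y) / a ^+ 2.
Proof.
move=> a0 ad; rewrite ler_pdivlMr ?exprn_gt0// mulrC.
apply: le_trans (JD x y); rewrite ler_wpM2r// -[leRHS]real_normK ?num_real//.
by rewrite ler_pXn2r ?nnegrE// ltW.
Qed.

Lemma far_bound_lev (x y : int) : (0 < lev y)%N -> (2 * lev x <= lev y)%N ->
  J x y <= 4 * C * w (lev x) (lev y) / (lev y)%:R ^+ 2.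
Proof.
move=> y0 xy; have y0' : 0 < (lev y)%:R :> R by rewrite ltr0n.
have /le_trans : J x y <= C * w (lev x) (lev y) / ((lev y)%:R / 2) ^+ 2.
  apply: far_bound; first by rewrite divr_gt0.
  rewrite intr_abs.
  rewrite ler_pdivrMr// -natrM ler_nat.
  by have := lev_dist x y; lia.
apply; rewrite le_eqVlt; apply/orP; left; apply/eqP; field.
by rewrite gt_eqF.
Qed.

(** A point where f does not vanish has level below n / 2, hence its distance
    to a point of level j >= n is at least j / 2: the last sum in the
    definition of tame applies, uniformly in n. *)
Lemma tail_J : exists2 C' : R, 0 < C' & forall (f : int -> R) n N, (0 < n)%N ->
  (forall x, 0 <= f x <= 1) ->
  (forall x, (n <= 2 * lev x)%N -> f x = 0) -> (n <= N)%N ->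
  bsum (fun x => f x * (bsum (J x) N - bsum (J x) n)) n <= C'.
Proof.
have [D [D0 w0 _ _ [_ p4]]] := tw.
exists (16 * C * D) => [|f n N n0 f01 fn nN]; first by rewrite !mulr_gt0.
apply: (@le_trans _ _ (bsum (fun x => \sum_(n <= j < N)
   (2 * (4 * C)) * (w (lev x) j / j%:R ^+ 2)) n)).
  apply: le_bsum => x xn; have /andP[fx0 fx1] := f01 x.
  have [nx|xn'] := leqP n (2 * lev x)%N.
    rewrite fn// mul0r; apply: sumr_ge0 => j _.
    by rewrite mulr_ge0 ?divr_ge0// mulr_ge0// mulr_ge0// ltW.
  rewrite (bsum_cat _ nN) addrAC subrr add0r.
  have S0 : 0 <= \sum_(n <= i < N) (J x i%:Z + J x (Negz i)).
    by apply: sumr_ge0 => i _; rewrite addr_ge0.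
  apply: (le_trans (ler_piMl S0 fx1)).
  rewrite !big_nat; apply: ler_sum => j /andP[nj _].
  have H y : lev y = j -> J x y <= 4 * C * w (lev x) j / j%:R ^+ 2.
    move=> yj; have := @far_bound_lev x y; rewrite yj; apply; first by apply: leq_trans nj.
    by apply: leq_trans nj; rewrite ltnW.
  have := lerD (H j%:Z erefl) (H (Negz j) erefl); move=> /le_trans; apply.
  by rewrite -!mulrA -mulrDl -mulr2n -[_ *+ 2]mulr_natl !mulrA lexx.
rewrite (bsum_lev (fun i => \sum_(n <= j < N) 2 * (4 * C) * (w i j / j%:R ^+ 2)) n).
under eq_bigr do rewrite -big_distrr/=.
rewrite -big_distrr/=.
have := p4 n N n0; have : 0 < C := C0; move: (\sum_(0 <= i < n) _) => S; nra.
Qed.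

Definition row_sum x := limn (bsum (J x)).

Lemma cvg_row_sum x : bsum (J x) N @[N --> \oo] --> row_sum x.
Proof.
have [C' C'0 tl] := tail_J; pose n := (2 * lev x).+1.
apply: (@bsum_cvg _ _ (bsum (J x) n + C')) => // N.
have [Nn|nN] := leqP N n.
  by apply: (le_trans (bsum_nd (J0 x) Nn)); rewrite lerDl ltW.
pose f (y : int) : R := (y == x)%:R.
have := tl f n N isT _ _ (ltnW nN).
rewrite (@bsum_single _ _ x n); last first.
- by move=> y /negbTE yx; rewrite /f yx mul0r.
- by rewrite ltnS leq_pmull.
rewrite /f eqxx mul1r => H; rewrite -lerBlDl; apply: H.
  by move=> y; case: (y == x) => /=; rewrite ?lexx ?ler01.
move=> y; case: eqP => [->|//]; rewrite /n; lia.
Qed.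

Lemma bsum_le_row_sum x N : bsum (J x) N <= row_sum x.
Proof.
apply: (@limr_ge _ (\oo : set_system nat)); first exact: (cvgP _ (@cvg_row_sum x)).
by exists N => // M /= NM; exact: bsum_nd.
Qed.

Lemma row_sum_le x B n : (forall N, (n <= N)%N -> bsum (J x) N <= B) -> row_sum x <= B.
Proof.
move=> H; apply: (@limr_le _ (\oo : set_system nat)); first exact: (cvgP _ (@cvg_row_sum x)).
by exists n.
Qed.

Lemma J_cvg0 x : J x N%:Z @[N --> \oo] --> 0 /\ J x (Negz N) @[N --> \oo] --> 0.
Proof.
have H : J x N%:Z + J x (Negz N) @[N --> \oo] --> 0.
  rewrite (_ : (fun N : nat => _) = (fun N => bsum (J x) N.+1 - bsum (J x) N)); last first.
    by apply/funext => N; rewrite bsumS addrAC subrr add0r.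
  rewrite -(subrr (row_sum x)); apply: cvgB; last exact: cvg_row_sum.
  by rewrite (cvg_shiftS (bsum (J x))); exact: cvg_row_sum.
by split; apply: (squeeze_cvgr _ (cvg_cst _) H); apply: nearW => N;
  rewrite J0 ?lerDl ?lerDr J0.
Qed.

Definition clamp (t : R) : R := Num.max 0 (Num.min 1 t).

Lemma clamp_lip a c : `|clamp a - clamp c| <= `|a - c|.
Proof.
wlog ac : a c / a <= c.
  by move=> h; have [/h//|/ltW/h] := leP a c; rewrite distrC [X in _ <= X]distrC.
rewrite [X in _ <= X]distrC [X in _ <= X]ger0_norm ?subr_ge0// ler_norml /clamp.
case: (leP 1 a) => h1; case: (leP 1 c) => h2; try lra.
all: do ?case: (leP 0) => h3; try lra.
all: case: (leP 0) => h4; lra.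
Qed.

Definition plateau (n : nat) (x : int) : R := clamp (2 - (lev x)%:R / n%:R).

Lemma plateau01 n x : 0 <= plateau n x <= 1.
Proof.
rewrite /plateau /clamp; set t := 2 - _; by case: (leP 1 t) => h1; [case: (leP 0 (1 : R))|case: (leP 0 t)] => h2;
  apply/andP; split; lra.
Qed.

Lemma plateau_one n x : (0 < n)%N -> (lev x <= n)%N -> plateau n x = 1.
Proof.
move=> n0 xn; have n0' : 0 < n%:R :> R by rewrite ltr0n.
have : (lev x)%:R / n%:R <= 1 :> R by rewrite ler_pdivrMr// mul1r ler_nat.
rewrite /plateau /clamp; set t := _ / _ => h.
by case: (leP 1) => h1; [case: (leP 0) => h2; lra|lra].
Qed.

Lemma plateau_zero n x : (0 < n)%N -> (2 * n <= lev x)%N -> plateau n x = 0.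
Proof.
move=> n0 xn; have n0' : 0 < n%:R :> R by rewrite ltr0n.
have : 2 <= (lev x)%:R / n%:R :> R by rewrite ler_pdivlMr// -natrM ler_nat.
rewrite /plateau /clamp; set t := _ / _ => h.
by case: (leP 1) => h1; [lra|case: (leP 0) => h2; lra].
Qed.

Lemma plateau_lip n x y : (0 < n)%N ->
  (plateau n x - plateau n y) ^+ 2 <= (x - y)%:~R ^+ 2 / n%:R ^+ 2.
Proof.
move=> n0; have n0' : 0 < n%:R :> R by rewrite ltr0n.
rewrite -expr_div_n -[leLHS]real_normK ?num_real// -[leRHS]real_normK ?num_real//.
rewrite ler_pXn2r ?nnegrE//; apply: (le_trans (clamp_lip _ _)).
rewrite normrM normfV (gtr0_norm n0') ler_pdivlMr//.
rewrite -{3}(gtr0_norm n0') -normrM.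
rewrite (_ : _ * _ = ((lev y)%:Z - (lev x)%:Z)%:~R); last first.
  by rewrite rmorphB /= -!pmulrn; field; rewrite gt_eqF.
rewrite !intr_abs ler_nat; have := lev_dist x y; have := lev_dist y x; lia.
Qed.

(** When k - k^2 is the row sum of J, this is the covariance of the linear
    statistics of f and g. *)
Definition qform (L : nat) (f g : int -> R) : R :=
  bsum (fun x => f x * (g x * row_sum x - bsum (fun y => g y * J x y) L)) L.

Lemma qform_ext L N f g : (L <= N)%N -> (forall x, (L <= lev x)%N -> f x = 0) ->
  (forall x, (L <= lev x)%N -> g x = 0) -> qform N f g = qform L f g.
Proof.
move=> LN f0 g0; rewrite /qform (bsum_trunc LN); last by move=> x /f0 ->; rewrite mul0r.
apply: eq_bsum => x _; rewrite (bsum_trunc LN)// => y /g0 ->.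
by rewrite mul0r.
Qed.

Lemma qform_sym L f g : qform L f g = qform L g f.
Proof.
have E f' g' : qform L f' g' = bsum (fun x => f' x * g' x * row_sum x) L -
    bsum (fun x => bsum (fun y => f' x * g' y * J x y) L) L.
  rewrite /qform -bsumB; apply: eq_bsum => x _; rewrite mulrBr mulrA -bsumZ.
  by congr (_ - _); apply: eq_bsum => y _; rewrite mulrA.
rewrite !E exchange_bsum; congr (_ - _); apply: eq_bsum => x _; first by ring.
by apply: eq_bsum => y _; rewrite Jsym; ring.
Qed.

Lemma qform_addl L f1 f2 g : qform L (fun x => f1 x + f2 x) g = qform L f1 g + qform L f2 g.
Proof. by rewrite /qform -bsumD; apply: eq_bsum => x _; rewrite mulrDl. Qed.

Lemma qform_sqD L f g : qform L (fun x => f x + g x) (fun x => f x + g x) =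
  qform L f f + 2 * qform L f g + qform L g g.
Proof.
rewrite (qform_addl L f g (fun x => f x + g x)).
rewrite (qform_sym L f (fun x => f x + g x)) (qform_addl L f g f).
rewrite (qform_sym L g (fun x => f x + g x)) (qform_addl L f g g) (qform_sym L g f).
by ring.
Qed.

Lemma qform_scale L a f g : qform L (fun x => a * f x) g = a * qform L f g.
Proof. by rewrite /qform -bsumZ; apply: eq_bsum => x _; rewrite mulrA. Qed.

(** Symmetry turns the quadratic form into half the sum of (f x - f y)^2 J x
    y, plus the mass that leaves the window. The Lipschitz constant 1/n makes
    the former an average of the weight over a square of side of order n; the
    latter is bounded by the tails. *)
Lemma qform_plateau_bounded : exists2 B : R, 0 < B & forall n, (0 < n)%N ->
  qform (2 * n) (plateau n) (plateau n) <= B.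
Proof.
have [C' C'0 tl] := tail_J; have [D [D0 w0 _ _ [p3 _]]] := tw.
exists (C' + 32 * C * D) => [|n n0]; first by rewrite addr_gt0// !mulr_gt0.
set f := plateau n; pose N := (4 * n)%N.
have n0' : 0 < n%:R :> R by rewrite ltr0n.
have fz x : (2 * n <= lev x)%N -> f x = 0 by exact: plateau_zero.
rewrite -(@qform_ext _ N) ?leq_mul2r ?orbT//.
pose S := bsum (fun x => bsum (fun y => (f x ^+ 2 - f x * f y) * J x y) N) N.
have -> : qform N f f = bsum (fun x => f x ^+ 2 * (row_sum x - bsum (J x) N)) N + S.
  rewrite /qform /S -bsumD; apply: eq_bsum => x _.
  rewrite (_ : bsum (fun y => (_ - _) * J x y) N =
     f x ^+ 2 * bsum (J x) N - f x * bsum (fun y => f y * J x y) N); first by ring.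
  rewrite -!bsumZ -bsumB; apply: eq_bsum => y _; ring.
apply: lerD.
  have h : (fun M => bsum (fun x => f x ^+ 2 * (bsum (J x) M - bsum (J x) N)) N) @ \oo
     --> bsum (fun x => f x ^+ 2 * (row_sum x - bsum (J x) N)) N.
    apply: bsum_cvg_const => x; apply: cvgMr; apply: cvgB; last exact: cvg_cst.
    exact: cvg_row_sum.
  rewrite -(cvg_lim _ h)//; apply: limr_le; first exact: (cvgP _ h).
  exists N => // M /= NM; apply: tl => //.
  - by rewrite muln_gt0.
  - by move=> x; have := plateau01 n x; rewrite -/f expr2 => /andP[? ?]; apply/andP; split; nra.
  - by move=> x Nx; rewrite fz ?expr0n//; rewrite /N in Nx; lia.
have S2 : 2 * S = bsum (fun x => bsum (fun y => (f x - f y) ^+ 2 * J x y) N) N.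
  have E : S = bsum (fun x => bsum (fun y => (f y ^+ 2 - f x * f y) * J x y) N) N.
    rewrite /S exchange_bsum; apply: eq_bsum => x _; apply: eq_bsum => y _.
    by rewrite Jsym; ring.
  rewrite mulr2n mulrDl !mul1r {2}E /S -bsumD; apply: eq_bsum => x _.
  by rewrite -bsumD; apply: eq_bsum => y _; ring.
have : 2 * S <= C / n%:R ^+ 2 * (2 * (2 * (D * N%:R ^+ 2))).
  rewrite S2.
  apply: (@le_trans _ _ (bsum (fun x => bsum (fun y => C / n%:R ^+ 2 * w (lev x) (lev y)) N) N)).
    apply: le_bsum => x _; apply: le_bsum => y _.
    apply: (le_trans (ler_wpM2r (J0 x y) (plateau_lip x y n0))).
    by rewrite mulrAC [leRHS]mulrAC ler_wpM2r ?invr_ge0 ?exprn_ge0.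
  rewrite (@eq_bsum _ _ (fun x => C / n%:R ^+ 2 * (2 * \sum_(0 <= j < N) w (lev x) j))); last first.
    by move=> x _; rewrite bsumZ (bsum_lev (w (lev x))).
  rewrite bsumZ ler_wpM2l ?divr_ge0 ?exprn_ge0 ?(ltW C0)//.
  rewrite bsumZ ler_wpM2l// (bsum_lev (fun i => \sum_(0 <= j < N) w i j)).
  by rewrite ler_wpM2l// p3// muln_gt0.
rewrite (_ : _ * (2 * _) = 2 * (32 * C * D)); last first.
  by rewrite /N natrM; field; rewrite gt_eqF.
by rewrite ler_pM2l.
Qed.

(** Where F lives the wide plateau is 1, and what remains is a tail of the
    convergent row sums. *)
Lemma qform_plateau_cvg0 (L0 : nat) (F : int -> R) (e : R) : 0 < e ->
  (forall x, (L0 <= lev x)%N -> F x = 0) ->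
  exists n0, forall n, (n0 <= n)%N -> `|qform (2 * n) F (plateau n)| <= e.
Proof.
move=> e0 F0.
have h : (fun n => bsum (fun x => `|F x| * (row_sum x - bsum (J x) n)) L0) @ \oo -->
   bsum (fun x => `|F x| * (row_sum x - row_sum x)) L0.
  apply: bsum_cvg_const => x; apply: cvgMr; apply: cvgB; first exact: cvg_cst.
  exact: cvg_row_sum.
rewrite (@eq_bsum _ _ (fun x => 0 * F x)) in h; last by move=> x _; rewrite subrr mulr0 mul0r.
rewrite bsumZ mul0r in h.
have /cvgrPdist_le/(_ e e0) [n1 _ n1P] := h.
exists (maxn (maxn n1 L0) 1) => n; rewrite !geq_max => /andP[/andP[nn1 nL0] n0].
apply: le_trans (n1P n nn1); rewrite sub0r normrN.
rewrite [leRHS]ger0_norm; last first.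
  by apply: bsum_ge0 => x; rewrite mulr_ge0// subr_ge0 bsum_le_row_sum.
rewrite /qform (@bsum_trunc _ _ L0 (2 * n)%N); last 2 first.
- by rewrite (leq_trans nL0)// leq_pmull.
- by move=> x /F0 ->; rewrite mul0r.
apply: (@le_trans _ _ (bsum (fun x => `|F x * (plateau n x * row_sum x - bsum (fun y => plateau n y * J x y) (2 * n))|) L0)).
  rewrite /bsum; apply: (le_trans (ler_norm_sum _ _ _)); apply: ler_sum => i _.
  exact: ler_normD.
apply: le_bsum => x xL0; rewrite normrM ler_wpM2l//.
rewrite plateau_one//; last by apply: leq_trans nL0; rewrite ltnW.
rewrite mul1r ger0_norm.
  rewrite lerD2l lerN2.
  have -> : bsum (J x) n = bsum (fun y => plateau n y * J x y) n.
    by apply: eq_bsum => y yn; rewrite plateau_one ?mul1r// ltnW.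
  apply: bsum_nd; last by rewrite leq_pmull.
  by move=> y; rewrite mulr_ge0//; have /andP[] := plateau01 n y.
rewrite subr_ge0; apply: le_trans (bsum_le_row_sum x (2 * n)).
by apply: le_bsum => y _; rewrite ler_piMl//; have /andP[] := plateau01 n y.
Qed.

(** The sum of m plateaus of sufficiently separated scales has a variance at
    most linear in m, so their mean has a variance of order 1/m. *)
Lemma qform_small (L0 : nat) (e : R) : 0 < e ->
  exists L f, [/\ forall x, (lev x < L0)%N -> (lev x < L)%N /\ f x = 1,
    forall x, (L <= lev x)%N -> f x = 0 & qform L f f < e].
Proof.
move=> e0; have [B B0 VB] := qform_plateau_bounded.
have IH m : exists L f, [/\ (L0 <= L)%N, forall x, (lev x < L0)%N -> f x = m%:R,
    forall x, (L <= lev x)%N -> f x = 0 & qform L f f <= m%:R * (B + 2)].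
  elim: m => [|m [L [f [L0L f1 f0 Vf]]]].
    exists L0, (fun=> 0); split => //; rewrite mul0r /qform.
    rewrite (@eq_bsum _ _ (fun x => 0 * 0)); last by move=> x _; rewrite mul0r mulr0.
    by rewrite bsumZ mul0r.
  have [n0 n0P] := qform_plateau_cvg0 (@ltr01 R) f0.
  pose n := maxn (maxn n0 L) 1.
  have nn0 : (n0 <= n)%N by rewrite /n; lia.
  have nL : (L <= n)%N by rewrite /n; lia.
  have n1 : (0 < n)%N by rewrite /n; lia.
  have nL2 : (L <= 2 * n)%N by lia.
  exists (2 * n)%N, (fun x => f x + plateau n x); split.
  - by lia.
  - by move=> x xL0; rewrite f1// plateau_one ?natr1//; lia.
  - by move=> x xn; rewrite plateau_zero// f0 ?addr0//; lia.
  rewrite qform_sqD (@qform_ext L (2 * n) f f)//.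
  have := n0P n nn0; rewrite ler_norml => /andP[_ h].
  have := VB n n1; rewrite -natr1 => h2; move: Vf h h2.
  move: (qform L f f) (qform _ f _) (qform _ (plateau n) _) => a1 a2 a3; lra.
have [m m1 mB] : exists2 m, (0 < m)%N & (B + 2) / e < m%:R.
  exists (Num.trunc ((B + 2) / e)).+1 => //.
  exact: truncnS_gt.
have [L [f [L0L f1 f0 Vf]]] := IH m; have m0 : 0 < m%:R :> R by rewrite ltr0n.
exists L, (fun x => m%:R^-1 * f x); split.
- move=> x xL0; split; first exact: leq_trans L0L.
  by rewrite f1// mulVf// gt_eqF.
- by move=> x /f0 ->; rewrite mulr0.
rewrite qform_scale qform_sym qform_scale.
apply: (@le_lt_trans _ _ (m%:R^-1 * (m%:R^-1 * (m%:R * (B + 2))))).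
  by rewrite !ler_pM2l ?invr_gt0.
rewrite mulKf ?gt_eqF// mulrC ltr_pdivrMr//.
by rewrite mulrC -ltr_pdivrMr.
Qed.

Hypothesis Jk : forall x y, J x y <= k x * k y.
Hypothesis Jk1 : forall x y, J x y <= (1 - k x) * (1 - k y).
Hypothesis k01 : forall x, 0 <= k x <= 1.
Hypothesis kpos : forall n, (0 < n)%N -> k n%:Z <= C / n%:R.
Hypothesis kneg : forall n, (0 < n)%N -> 1 - k (Negz n) <= C / n%:R.

(** Near the diagonal the weight gives no bound. But J is at most the product
    of the two densities of particles, and at most the product of the two
    densities of holes; far to the right the former are small, far to the left
    the latter. *)
Lemma near_bound x y : (0 < lev x)%N -> (2 * `|x - y| <= lev x)%N ->
  J x y <= 2 * C ^+ 2 / (lev x)%:R ^+ 2.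
Proof.
move=> x0 xy.
have H (p : int -> R) : 0 <= p y -> J x y <= p x * p y ->
    (0 < lev y)%N -> (lev x <= 2 * lev y)%N ->
    p x <= C / (lev x)%:R -> p y <= C / (lev y)%:R ->
    J x y <= 2 * C ^+ 2 / (lev x)%:R ^+ 2.
  move=> p0 Jp y0 xy2 px py; apply: le_trans Jp _.
  have x0' : 0 < (lev x)%:R :> R by rewrite ltr0n.
  have y0' : 0 < (lev y)%:R :> R by rewrite ltr0n.
  have py' : p y <= 2 * C / (lev x)%:R.
    apply: (le_trans py); rewrite ler_pdivlMr// mulrAC ler_pdivrMr//.
    by rewrite -mulrA mulrCA ler_pM2l// -natrM ler_nat.
  rewrite (_ : _ / _ = C / (lev x)%:R * (2 * C / (lev x)%:R)); last first.
    by field; rewrite gt_eqF.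
  have [px0|px0] := leP 0 (p x); first exact: ler_pM.
  apply: (@le_trans _ _ 0); first by rewrite mulr_le0_ge0// ltW.
  by rewrite ltW// mulr_gt0// divr_gt0// mulr_gt0.
case: x x0 xy H => i x0 xy H; case: y xy H => j /= xy H; rewrite /= in x0 *.
- apply: (H k) => //; [by have /andP[] := k01 j|lia|lia|exact: kpos|].
  by apply: kpos; lia.
- exfalso; lia.
- exfalso; lia.
- apply: (H (fun x => 1 - k x)) => //; [by have /andP[_] := k01 (Negz j); rewrite subr_ge0|lia|lia|exact: kneg|].
  by apply: kneg; lia.
Qed.

(** For x of level n, the near pairs contribute n terms of order n^-2, and the
    far pairs are controlled by the weight. *)
Lemma row_sum_decay : exists2 C' : R, 0 < C' & forall x, (0 < lev x)%N -> row_sum x <= C' / (lev x)%:R.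
Proof.
have [D [D0 w0 p1 p2 _]] := tw.
exists (2 * (6 * C ^+ 2 + 4 * C * D + 9 * C * D)).
  by rewrite mulr_gt0// !addr_gt0// !mulr_gt0// exprn_gt0.
move=> x x0; set n := lev x in x0 *.
have n0 : 0 < n%:R :> R by rewrite ltr0n.
pose A j := (j <= 2 * n)%N%:R * (2 * C ^+ 2 / n%:R ^+ 2)
   + (if (j < n)%N then 4 * C * w n j / n%:R ^+ 2 else 9 * C * w n j / j%:R ^+ 2).
have JA y : J x y <= A (lev y).
  have A2 : 0 <= (if (lev y < n)%N then 4 * C * w n (lev y) / n%:R ^+ 2
      else 9 * C * w n (lev y) / (lev y)%:R ^+ 2).
    by have := ltW C0; case: ifP => _ C0'; rewrite divr_ge0 ?exprn_ge0// !mulr_ge0.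
  have A1 : 0 <= 2 * C ^+ 2 / n%:R ^+ 2.
    by rewrite divr_ge0 ?exprn_ge0// mulr_ge0 ?exprn_ge0// ltW.
  have [near|far] := leqP (2 * `|x - y|)%N n.
    have -> : A (lev y) = 2 * C ^+ 2 / n%:R ^+ 2 + (A (lev y) - 2 * C ^+ 2 / n%:R ^+ 2).
      by ring.
    rewrite /A (_ : (lev y <= 2 * n)%N); last by have := lev_dist x y; rewrite -/n; lia.
    rewrite mul1r; apply: (le_trans (near_bound x0 near)); rewrite -/n; lra.
  apply: (@le_trans _ _ (if (lev y < n)%N then 4 * C * w n (lev y) / n%:R ^+ 2
      else 9 * C * w n (lev y) / (lev y)%:R ^+ 2)); last first.
    by rewrite /A lerDr mulr_ge0.
  case: ltnP => yn.
    have /le_trans : J x y <= C * w n (lev y) / (n%:R / 2) ^+ 2.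
      apply: far_bound; first by rewrite divr_gt0.
      by rewrite intr_abs ler_pdivrMr// -natrM ler_nat; lia.
    apply; rewrite le_eqVlt; apply/orP; left; apply/eqP; field.
    by rewrite gt_eqF.
  have y0 : 0 < (lev y)%:R :> R by rewrite ltr0n; lia.
  have /le_trans : J x y <= C * w n (lev y) / ((lev y)%:R / 3) ^+ 2.
    apply: far_bound; first by rewrite divr_gt0.
    by rewrite intr_abs ler_pdivrMr// -natrM ler_nat; have := lev_dist x y; rewrite -/n; lia.
  apply; rewrite le_eqVlt; apply/orP; left; apply/eqP; field.
  by rewrite gt_eqF.
apply: (@row_sum_le _ _ (2 * n).+1) => N nN.
apply: (le_trans (le_bsum (fun y _ => JA y))).
rewrite (bsum_lev A) -mulrA ler_pM2l//.
rewrite /A big_split/= -big_distrl/=.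
have S1 : \sum_(0 <= i < N) (i <= 2 * n)%N%:R <= 3 * n%:R :> R.
  rewrite (big_cat_nat (n := (2 * n).+1))//=.
  rewrite [X in _ + X]big_nat [X in _ + X]big1 => [|i /andP[ni _]]; last first.
    by rewrite leqNgt ni.
  rewrite addr0 big_nat (eq_bigr (fun=> 1)) => [|i /andP[_]]; last first.
    by rewrite ltnS => ->.
  rewrite -big_nat sumr_const_nat subn0 -[X in X <= _]/((2 * n).+1%:R) -natrM ler_nat; lia.
have S2 : \sum_(0 <= i < N) (if (i < n)%N then 4 * C * w n i / n%:R ^+ 2 else
    9 * C * w n i / i%:R ^+ 2) <= (4 * C * D + 9 * C * D) / n%:R.
  have nN' : (n <= N)%N by lia.
  rewrite (big_cat_nat (n := n))//= [leRHS]mulrDl; apply: lerD.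
    rewrite big_nat (eq_bigr (fun i => 4 * C / n%:R ^+ 2 * w n i)) => [|i /andP[_ ->]]; last by ring.
    rewrite -big_nat -big_distrr/=.
    apply: (@le_trans _ _ (4 * C / n%:R ^+ 2 * (D * n%:R))).
      by rewrite ler_wpM2l ?p1// divr_ge0 ?exprn_ge0// mulr_ge0// ltW.
    by rewrite le_eqVlt; apply/orP; left; apply/eqP; field; rewrite gt_eqF.
  rewrite big_nat (eq_bigr (fun i => 9 * C * (w n i / i%:R ^+ 2))) => [|i /andP[ni _]]; last first.
    by rewrite ltnNge ni/=; ring.
  rewrite -big_nat -big_distrr/= -[leRHS]mulrA ler_pM2l ?mulr_gt0//.
  exact: p2.
rewrite -[X in _ <= X / _]addrA [leRHS]mulrDl; apply: lerD => //.
have P0 : 0 <= 2 * C ^+ 2 / n%:R ^+ 2 by rewrite divr_ge0 ?exprn_ge0// mulr_ge0 ?exprn_ge0// ltW.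
apply: (le_trans (ler_wpM2r P0 S1)).
by rewrite le_eqVlt; apply/orP; left; apply/eqP; field; rewrite gt_eqF.
Qed.

Lemma cvg0_le_inv (F : nat -> R) (B : R) : (forall n, (0 < n)%N -> 0 <= F n <= B / n%:R) ->
  F n @[n --> \oo] --> 0.
Proof.
move=> FB; rewrite -(cvg_shiftS F).
have : B * (harmonic n) @[n --> \oo] --> (0 : R).
  by rewrite -[0](mulr0 B); apply: cvgMr; exact: cvg_harmonic.
apply: (squeeze_cvgr _ (cvg_cst _)); apply: nearW => n /=.
exact: (FB n.+1).
Qed.

Lemma cvg_pos_neg (f : int -> R) (l : R) : (fun n : nat => f (Negz n)) @ \oo --> l ->
  (fun n : nat => f (- n%:Z)) @ \oo --> l.
Proof.
rewrite -(cvg_shiftS (fun n : nat => f (- n%:Z))) => h.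
by rewrite (_ : (fun n : nat => f (- n.+1%:Z)) = (fun n => f (Negz n))).
Qed.

Lemma int_const (f : int -> R) : (forall x, f (x + 1) = f x) -> forall x, f x = f 0.
Proof.
move=> fS; case=> n.
  by elim: n => // n <-; rewrite -(fS n); congr f; lia.
elim: n => [|n IH]; first by rewrite -fS.
by rewrite -fS -IH; congr f; lia.
Qed.

Variables (q : int -> R) (b : R) (M H : int -> int -> R).
Hypotheses (q0 : forall x, q x != 0) (b0 : b != 0).
Hypothesis krec : forall x, k (x + 1) = k x - b / q x.
Hypothesis Mxx : forall x, M x x = 0.
Hypothesis JM : forall x n, J (x + 1) (n + 1) - J x n = 2 * b ^+ 2 * M x n / q x.
Hypothesis MH : forall x n, n != x ->
  M (x + 1) (n + 1) - M x n = H x (n + 1) - H x n.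
Hypothesis Hx0 : forall x, H x x = - (2 * q x)^-1.
Hypothesis Hx1 : forall x, H x (x + 1) = (2 * q (x + 1))^-1.
Hypothesis Hpos : forall x, H x n%:Z @[n --> \oo] --> 0.
Hypothesis Hneg : forall x, H x (- n%:Z) @[n --> \oo] --> 0.

Lemma cvg_bsum_shift (F : int -> R) (l : R) : bsum F @ \oo --> l ->
  F n%:Z @[n --> \oo] --> 0 -> F (- n%:Z) @[n --> \oo] --> 0 ->
  bsum (fun n => F (n + 1)) @ \oo --> l.
Proof.
move=> Fl F1 F2; rewrite (_ : bsum _ = fun N => bsum F N + F N%:Z - F (- N%:Z)); last first.
  by apply/funext => N; rewrite bsum_shift.
by rewrite -[l]addr0 -[l + 0]subr0; apply: cvgB => //; apply: cvgD.
Qed.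

Let Jp x : J x n%:Z @[n --> \oo] --> 0. Proof. by have [] := J_cvg0 x. Qed.
Let Jn x : J x (- n%:Z) @[n --> \oo] --> 0.
Proof. by apply: (cvg_pos_neg (f := J x)); have [] := J_cvg0 x. Qed.

Lemma M_of_J x n : M x n = q x / (2 * b ^+ 2) * (J (x + 1) (n + 1) - J x n).
Proof. by rewrite JM; field; rewrite q0 b0. Qed.

Definition drift x := q x / (2 * b ^+ 2) * (row_sum (x + 1) - row_sum x).

Lemma cvg_drift x : bsum (M x) @ \oo --> drift x.
Proof.
rewrite (_ : bsum (M x) = fun N => q x / (2 * b ^+ 2) *
   (bsum (fun n => J (x + 1) (n + 1)) N - bsum (J x) N)); last first.
  apply/funext => N; rewrite -bsumB -bsumZ; apply: eq_bsum => n _; exact: M_of_J.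
apply: cvgMr; apply: cvgB; last exact: cvg_row_sum.
by apply: cvg_bsum_shift; [exact: cvg_row_sum|exact: Jp|exact: Jn].
Qed.

Lemma M_cvg0 x : M x n%:Z @[n --> \oo] --> 0 /\ M x (- n%:Z) @[n --> \oo] --> 0.
Proof.
have K (u : nat -> int) : J (x + 1) (u n + 1) @[n --> \oo] --> 0 ->
    J x (u n) @[n --> \oo] --> 0 -> M x (u n) @[n --> \oo] --> 0.
  move=> h1 h2; under eq_fun do rewrite M_of_J.
  by rewrite -(mulr0 (q x / (2 * b ^+ 2))) -(subrr 0); apply: cvgMr; apply: cvgB.
split; apply: K => //.
  rewrite (_ : (fun n : nat => _) = (fun n : nat => J (x + 1) n.+1%:Z)).
    by have := Jp (x + 1); rewrite -(cvg_shiftS (fun n : nat => J (x + 1) n%:Z)).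
  by apply/funext => n; congr J; lia.
apply: (cvg_pos_neg (f := fun y => J (x + 1) (y + 1))).
have := Jn (x + 1); rewrite (_ : (fun n => _ (Negz n + 1)) = (fun n : nat => J (x + 1) (- n%:Z)))//.
by apply/funext => n; congr J; lia.
Qed.

(** The identity for M telescopes in n except at n = x, where M vanishes; the
    two values of H there give the right-hand side. *)
Lemma drift_step x : drift (x + 1) - drift x = - ((2 * q x)^-1 + (2 * q (x + 1))^-1).
Proof.
pose c := (2 * q x)^-1 + (2 * q (x + 1))^-1.
have h1 : bsum (fun n => M (x + 1) (n + 1) - M x n) @ \oo --> drift (x + 1) - drift x.
  rewrite (_ : bsum _ = fun N => bsum (fun n => M (x + 1) (n + 1)) N - bsum (M x) N); last first.
    by apply/funext => N; rewrite bsumB.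
  apply: cvgB; last exact: cvg_drift.
  by apply: cvg_bsum_shift; [exact: cvg_drift|have [] := M_cvg0 (x + 1)|have [] := M_cvg0 (x + 1)].
have h2 : bsum (fun n => M (x + 1) (n + 1) - M x n) @ \oo --> - c.
  have : (fun N : nat => H x N%:Z - H x (- N%:Z) - c) @ \oo --> 0 - 0 - c.
    by apply: cvgB; [apply: cvgB|exact: cvg_cst].
  rewrite subrr sub0r; apply: cvg_trans; apply: near_eq_cvg.
  exists (lev x).+1 => // N /= xN.
  rewrite (@eq_bsum _ _ (fun n => (H x (n + 1) - H x n) - (n == x)%:R * c)).
    rewrite bsumB bsum_telescope; congr (_ - _).
    by rewrite (@bsum_single _ _ x N)// ?eqxx ?mul1r// => y /negbTE ->; rewrite mul0r.
  move=> n _; have [->|nx] := eqVneq n x; last by rewrite MH// mul0r subr0.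
  by rewrite !Mxx Hx0 Hx1 /c (_ : true%:R = 1 :> R)//; ring.
exact: (cvg_unique _ h1 h2).
Qed.

(** The drift formula integrates to a first order recurrence for k - k^2 -
    row_sum with a constant e. Since k tends to 0 at plus infinity, to 1 at
    minus infinity, and the row sums to 0 at both ends, the defect and e
    vanish. *)
Lemma row_sum_reproducing x : row_sum x = k x - k x ^+ 2.
Proof.
(* The error of the drift formula; it is the same for all x, and so is the
   quantity d, which contains the contribution of e to the defect. *)
pose e x := k x + k (x + 1) - 1 - 2 * b * drift x.
have eS y : e (y + 1) = e y.
  have ms : drift (y + 1) = drift y - ((2 * q y)^-1 + (2 * q (y + 1))^-1).
    by rewrite -drift_step; ring.
  by rewrite /e ms !krec; field; rewrite !q0.
have e0 := int_const eS.
pose d x := k x - k x * k x - row_sum x + e 0 * k x.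
have dS y : d (y + 1) = d y.
  have sS : row_sum (y + 1) = row_sum y + 2 * b ^+ 2 * drift y / q y.
    by rewrite /drift; field; rewrite q0 b0.
  by rewrite /d sS -(e0 y) /e !krec; field; rewrite q0.
have d0 := int_const dS.
have kp : k n%:Z @[n --> \oo] --> 0.
  by apply: (@cvg0_le_inv _ C) => n n0; rewrite kpos// andbT; have /andP[] := k01 n.
have kn : k (Negz n) @[n --> \oo] --> (1 : R).
  have : 1 - k (Negz n) @[n --> \oo] --> 0.
    apply: (@cvg0_le_inv _ C) => n n0; rewrite kneg// andbT.
    by have /andP[_] := k01 (Negz n); rewrite subr_ge0.
  move=> h; rewrite (_ : (fun n : nat => k (Negz n)) = (fun n => 1 - (1 - k (Negz n)))).
    by rewrite -[X in _ --> X](subr0 (1 : R)); apply: cvgB => //; exact: cvg_cst.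
  by apply/funext => n; rewrite subKr.
have [C' C'0 sC'] := row_sum_decay.
have sj0 y : 0 <= row_sum y by have := bsum_le_row_sum y 0; rewrite bsum0.
have sp : row_sum n%:Z @[n --> \oo] --> 0.
  by apply: (@cvg0_le_inv _ C') => n n0; rewrite sj0 sC'.
have sn : row_sum (Negz n) @[n --> \oo] --> 0.
  by apply: (@cvg0_le_inv _ C') => n n0; rewrite sj0 sC'.
have d00 : d 0 = 0.
  have h : d n%:Z @[n --> \oo] --> 0 - 0 * 0 - 0 + e 0 * 0.
    by apply: cvgD; [apply: cvgB => //; apply: cvgB => //; exact: cvgM|exact: cvgMr].
  have := cvg_unique _ h (_ : d n%:Z @[n --> \oo] --> d 0).
  rewrite !mulr0 !subr0 addr0 => ->//.
  by under eq_fun do rewrite d0; exact: cvg_cst.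
have e00 : e 0 = 0.
  have h : d (Negz n) @[n --> \oo] --> 1 - 1 * 1 - 0 + e 0 * 1.
    by apply: cvgD; [apply: cvgB => //; apply: cvgB => //; exact: cvgM|exact: cvgMr].
  have := cvg_unique _ h (_ : d (Negz n) @[n --> \oo] --> d 0).
  rewrite !mulr1 subrr sub0r oppr0 add0r d00 => ->//.
  by under eq_fun do rewrite d0; rewrite d00; exact: cvg_cst.
by have := d0 x; rewrite d00 /d e00 mul0r addr0 -expr2 => /eqP; rewrite subr_eq0 => /eqP <-.
Qed.

End kernel_squares.

(** * Limits of complex-valued functions *)

Local Open Scope complex_scope.

Notation normc := ComplexField.Normc.normc.

Section complex_limits.
Variable R : realType.
Local Notation C := (R[i]).
Implicit Types z u v : C.

Lemma normcE z : `|z| = (normc z)%:C. Proof. by []. Qed.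

Lemma normc_ge0 z : 0 <= normc z.
Proof. by case: z => a b; rewrite sqrtr_ge0. Qed.

Lemma normc_eq0 z : (normc z == 0) = (z == 0).
Proof.
apply/eqP/eqP => [|->]; first exact: ComplexField.Normc.eq0_normc.
exact: ComplexField.Normc.normc0.
Qed.

Lemma normc_gt0 z : (0 < normc z) = (z != 0).
Proof. by rewrite lt_neqAle normc_ge0 andbT eq_sym normc_eq0. Qed.

Lemma normcM z u : normc (z * u) = normc z * normc u.
Proof. exact: ComplexField.Normc.normcM. Qed.

Lemma normcV z : normc z^-1 = (normc z)^-1.
Proof. exact: ComplexField.Normc.normcV. Qed.

Lemma ler_normcD z u : normc (z + u) <= normc z + normc u.
Proof. by rewrite -lecR rmorphD /= -!normcE ler_normD. Qed.

Lemma normcN z : normc (- z) = normc z.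
Proof. by apply: complexI; rewrite -!normcE normrN. Qed.

Lemma normcB_sym z u : normc (z - u) = normc (u - z).
Proof. by rewrite -normcN opprB. Qed.

Lemma ler_normcB z u : normc (z - u) <= normc z + normc u.
Proof. by rewrite -(normcN u) ler_normcD. Qed.

Lemma ler_sub_normc z u : normc z - normc u <= normc (z - u).
Proof. by have := ler_normcD (z - u) u; rewrite subrK => h; rewrite lerBlDr. Qed.

Lemma normc_real (a : R) : normc a%:C = `|a|.
Proof. by rewrite /normc /= expr0n/= addr0 sqrtr_sqr. Qed.

Lemma real_cD (a b : R) : (a + b)%:C = a%:C + b%:C.
Proof. exact: rmorphD. Qed.

Lemma real_cB (a b : R) : (a - b)%:C = a%:C - b%:C.
Proof. exact: rmorphB. Qed.

Lemma real_cN (a : R) : (- a)%:C = - a%:C.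
Proof. exact: rmorphN. Qed.

Lemma real_cM (a b : R) : (a * b)%:C = a%:C * b%:C.
Proof. exact: rmorphM. Qed.

Lemma real_cV (a : R) : (a^-1)%:C = (a%:C)^-1.
Proof. exact: fmorphV. Qed.

Lemma real_cX (a : R) n : (a ^+ n)%:C = a%:C ^+ n.
Proof. exact: rmorphXn. Qed.

Lemma normcX z n : normc (z ^+ n) = normc z ^+ n.
Proof.
elim: n => [|n IH]; first by rewrite !expr0 (normc_real 1) normr1.
by rewrite !exprS normcM IH.
Qed.

Lemma normc_prod (I : Type) (s : seq I) (f : I -> C) :
  normc (\prod_(i <- s) f i) = \prod_(i <- s) normc (f i).
Proof.
elim: s => [|i s IH]; first by rewrite !big_nil (normc_real 1) normr1.
by rewrite !big_cons normcM IH.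
Qed.

Lemma ler_normc_sum (I : Type) (s : seq I) (f : I -> C) :
  normc (\sum_(i <- s) f i) <= \sum_(i <- s) normc (f i).
Proof.
elim: s => [|i s IH]; first by rewrite !big_nil (normc_real 0) normr0.
by rewrite !big_cons (le_trans (ler_normcD _ _))// lerD2l.
Qed.

Lemma normc_conj z : normc z^*%C = normc z.
Proof. by case: z => a b; rewrite /normc /= sqrrN. Qed.

Lemma normc_Re z : `|complex.Re z| <= normc z.
Proof. by rewrite -lecR -normcE normc_ge_Re. Qed.

Lemma normc_Im z : `|complex.Im z| <= normc z.
Proof.
case: z => a b /=; rewrite -sqrtr_sqr ler_wsqrtr// lerDr sqr_ge0//.
Qed.

Lemma normc_le_ReIm z : normc z <= `|complex.Re z| + `|complex.Im z|.
Proof.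
rewrite {1}[z]complexE; apply: (le_trans (ler_normcD _ _)).
rewrite normcM !normc_real lerD2l /normc /= expr0n/= add0r expr1n sqrtr1 mul1r.
exact: lexx.
Qed.

Lemma sqr_normcE z : (normc z ^+ 2)%:C = z * z^*%C.
Proof. by rewrite rmorphXn /= -normcE sqr_normc. Qed.

Definition tends (T : Type) (F : set_system T) (f : T -> C) (l : C) :=
  normc (f t - l) @[t --> F] --> (0 : R).

Section filter.
Context (T : Type) (F : set_system T) {FF : ProperFilter F}.
Implicit Types (f g : T -> C).

Lemma tends_lim f l : tends F f l -> lim ((f : T -> R[i]^o) @ F) = l.
Proof.
move=> fl; apply: (@cvg_lim R[i]^o); first exact: norm_hausdorff.
apply/(@cvgrPdist_lt _ R[i]^o) => e e0.
have e0' := e0; move: e0'; rewrite ltcE /= => /andP[/eqP ei er].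
have eE : e = (complex.Re e)%:C by rewrite [e in LHS]complexE ei mulr0 addr0.
have /cvgrPdist_lt/(_ (complex.Re e) er) := fl; apply: filterS => t /=.
rewrite sub0r normrN ger0_norm ?normc_ge0// => h.
by rewrite distrC normcE eE ltcR.
Qed.

Lemma tends_cst l : tends F (fun=> l) l.
Proof.
rewrite /tends subrr; under eq_fun do rewrite (normc_real 0) normr0.
exact: cvg_cst.
Qed.

Lemma tends_squeeze (f : T -> C) (g : T -> R) l :
  (\forall t \near F, normc (f t - l) <= g t) -> g @ F --> 0 -> tends F f l.
Proof.
move=> fg g0; apply: (squeeze_cvgr _ (cvg_cst _) g0).
by apply: filterS fg => t ->; rewrite normc_ge0.
Qed.

Lemma tendsD f g a b : tends F f a -> tends F g b ->
  tends F (fun t => f t + g t) (a + b).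
Proof.
move=> fa gb; apply: (@tends_squeeze _ (fun t => normc (f t - a) + normc (g t - b))).
  by apply: nearW => t; rewrite opprD addrACA ler_normcD.
by rewrite -(addr0 0); apply: cvgD.
Qed.

Lemma tendsN f a : tends F f a -> tends F (fun t => - f t) (- a).
Proof.
move=> fa; apply: (@tends_squeeze _ (fun t => normc (f t - a)))=> //.
by apply: nearW => t; rewrite -opprD normcN.
Qed.

Lemma tendsB f g a b : tends F f a -> tends F g b ->
  tends F (fun t => f t - g t) (a - b).
Proof. by move=> fa gb; apply: tendsD => //; apply: tendsN. Qed.

Lemma tends_normc f a : tends F f a -> normc (f t) @[t --> F] --> normc a.
Proof.
move=> fa; apply/cvgrPdist_lt => e e0.
have /cvgrPdist_lt/(_ e e0) := fa; apply: filterS => t.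
rewrite sub0r normrN (ger0_norm (normc_ge0 _)); apply: le_lt_trans.
have := ler_sub_normc (f t) a; have := ler_sub_normc a (f t).
by rewrite (normcB_sym a) ler_norml => h1 h2; apply/andP; split; lra.
Qed.

Lemma tendsM f g a b : tends F f a -> tends F g b ->
  tends F (fun t => f t * g t) (a * b).
Proof.
move=> fa gb; apply: (@tends_squeeze _ (fun t => normc (f t - a) * normc (g t) + normc a * normc (g t - b))).
  apply: nearW => t; rewrite -!normcM (le_trans _ (ler_normcD _ _))//.
  by rewrite le_eqVlt; apply/orP; left; apply/eqP; congr normc; ring.
rewrite (_ : 0 = 0 * normc b + normc a * 0); last by rewrite mul0r mulr0 addr0.
apply: cvgD; first by apply: cvgM => //; apply: tends_normc.
by apply: cvgM => //; exact: cvg_cst.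
Qed.

Lemma tendsV f a : a != 0 -> tends F f a -> tends F (fun t => (f t)^-1) a^-1.
Proof.
move=> a0 fa; have na : 0 < normc a by rewrite normc_gt0.
apply: (@tends_squeeze _ (fun t => normc (f t - a) * (2 / normc a ^+ 2))); last first.
  by rewrite -(mul0r (2 / normc a ^+ 2)); apply: cvgM => //; exact: cvg_cst.
have /cvgrPdist_lt/(_ (normc a / 2)) := fa; rewrite divr_gt0// => /(_ isT).
apply: filterS => t; rewrite sub0r normrN (ger0_norm (normc_ge0 _)) => h.
have h2 : normc a / 2 < normc (f t).
  have := ler_sub_normc a (f t); rewrite normcB_sym => h3.
  move: h h3; move: (normc _) (normc _) (normc _) => x y w; lra.
have ft0 : 0 < normc (f t) by apply: lt_trans h2; rewrite divr_gt0.
have ft : f t != 0 by rewrite -normc_gt0.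
rewrite (_ : (f t)^-1 - a^-1 = - (f t - a) * ((f t)^-1 * a^-1)); last first.
  by field; rewrite ft a0.
rewrite normcM normcN ler_wpM2l ?normc_ge0// normcM !normcV.
rewrite expr2 invfM mulrA ler_pM2r ?invr_gt0//.
by rewrite -[2 / _]invrK invf_div lef_pV2 ?posrE// ?divr_gt0// ltW.
Qed.

Lemma tends_ext f g l : (\forall t \near F, f t = g t) -> tends F f l -> tends F g l.
Proof.
move=> fg; apply: cvg_trans; apply: near_eq_cvg.
by apply: filterS fg => t ->.
Qed.

Lemma tends_uniq f a b : tends F f a -> tends F f b -> a = b.
Proof.
move=> fa fb; have := tendsB fa fb.
under [X in tends _ X]eq_fun do rewrite subrr.
move=> h; have h' : normc (0 - (a - b)) @[_ --> F] --> (0 : R) := h.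
have cc : normc (0 - (a - b)) @[_ --> F] --> normc (0 - (a - b)) by exact: cvg_cst.
have e0 : normc (0 - (a - b)) = 0 by exact: (cvg_unique _ cc h').
by move/eqP: e0; rewrite normc_eq0 sub0r oppr_eq0 subr_eq0 => /eqP.
Qed.

Lemma tends_Re f a : tends F f a -> complex.Re (f t) @[t --> F] --> complex.Re a.
Proof.
move=> fa; apply/cvgrPdist_lt => e e0.
have /cvgrPdist_lt/(_ e e0) := fa; apply: filterS => t.
rewrite sub0r normrN (ger0_norm (normc_ge0 _)); apply: le_lt_trans.
rewrite normcB_sym; apply: le_trans (normc_Re _).
by case: a {fa} (f t) => [? ?] [? ?].
Qed.

Lemma tends_ReIm f a : complex.Re (f t) @[t --> F] --> complex.Re a ->
  complex.Im (f t) @[t --> F] --> complex.Im a -> tends F f a.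
Proof.
move=> h1 h2; apply: (@tends_squeeze _ (fun t => `|complex.Re (f t) - complex.Re a| + `|complex.Im (f t) - complex.Im a|)).
  apply: nearW => t; apply: (le_trans (normc_le_ReIm _)).
  by case: a (f t) {h1 h2} => [? ?] [? ?].
have H (g : T -> R) (c : R) : g @ F --> c -> `|g t - c| @[t --> F] --> 0.
  move=> gc; rewrite -(normr0 R) -(subrr c); apply: cvg_norm; apply: cvgB => //.
  exact: cvg_cst.
by rewrite -(addr0 0); apply: cvgD; apply: H.
Qed.

Lemma tends_real (f : T -> R) (a : R) : f @ F --> a -> tends F (fun t => (f t)%:C) a%:C.
Proof. by move=> fa; apply: tends_ReIm => //=; exact: cvg_cst. Qed.

End filter.
End complex_limits.

(** * Estimates for the exponential *)

Section exponential.
Variable R : realType.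
Local Notation C := (R[i]).
Implicit Types (x y : R) (s t w : C).

Lemma sin_mvt x : 0 <= x -> exists2 c, 0 <= c <= x & sin x = x * cos c.
Proof.
move=> x0; have [|c] := @MVT_segment R sin cos 0 x x0.
- by apply: continuous_subspaceT; exact: continuous_sin.
by rewrite in_itv/= => cx; rewrite sin0 !subr0 => ->; exists c => //; rewrite mulrC.
Qed.

Lemma abs_sin_le x : `|sin x| <= `|x|.
Proof.
wlog x0 : x / 0 <= x.
  by move=> h; have [/h//|/ltW x0] := leP 0 x; have := h (- x);
    rewrite sinN !normrN; apply; rewrite oppr_ge0.
have [c _ ->] := sin_mvt x0.
by rewrite normrM ler_piMr// cos_max.
Qed.

Lemma sin_sqr_le x : sin x ^+ 2 <= x ^+ 2.
Proof.
by rewrite -[leLHS]real_normK ?num_real// -[leRHS]real_normK ?num_real// ler_pXn2r ?nnegrE ?abs_sin_le.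
Qed.

Lemma one_sub_cos x : 1 - cos x = 2 * sin (x / 2) ^+ 2.
Proof.
rewrite {1}(_ : x = (x / 2) *+ 2); last by rewrite mulr2n; field.
by rewrite cos_mulr2n sin2cos2 mulr2n; ring.
Qed.

Lemma one_sub_cos_ge0 x : 0 <= 1 - cos x.
Proof. by rewrite subr_ge0 cos_le1. Qed.

Lemma one_sub_cos_le x : 1 - cos x <= x ^+ 2 / 2.
Proof. by rewrite one_sub_cos; have := sin_sqr_le (x / 2); rewrite !expr2; nra. Qed.

Lemma abs_sin_sub_le x : `|x| <= 1 -> `|sin x - x| <= x ^+ 2.
Proof.
wlog x0 : x / 0 <= x.
  move=> h; have [/h//|/ltW x0 x1] := leP 0 x.
  have := h (- x); rewrite oppr_ge0 normrN sinN sqrrN => /(_ x0 x1).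
  by rewrite (_ : - sin x - - x = - (sin x - x)) ?normrN//; ring.
rewrite ger0_norm// => x1; have [c /andP[c0 cx] ->] := sin_mvt x0.
rewrite distrC ger0_norm; last by have := one_sub_cos_ge0 c; nra.
have := one_sub_cos_le c; rewrite !expr2 => h; nra.
Qed.

Lemma expR_sub_le x : `|x| <= 1 / 2 -> 0 <= expR x - 1 - x <= 2 * x ^+ 2.
Proof.
rewrite ler_norml => /andP[x1 x2]; have := expR_ge1Dx x => h; apply/andP; split; first lra.
have : (1 - x) * expR x <= 1.
  have h2 := expR_ge1Dx (- x); have e0 := expR_gt0 x.
  have : expR x * expR (- x) = 1 by rewrite -expRD subrr expR0.
  move: (expR x) (expR (- x)) h2 e0 => u v h2 e0; nra.
by move: (expR x) h => e; rewrite expr2; nra.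
Qed.

Lemma cexp0 : cexp 0 = 1 :> C.
Proof. by rewrite /cexp /= expR0 cos0 sin0 mul1r. Qed.

Lemma cexpD s t : cexp (s + t) = cexp s * cexp t.
Proof.
case: s t => a b [c d]; rewrite /cexp /= expRD cosD sinD.
by apply/eqP; rewrite eq_complex /=; apply/andP; split; apply/eqP; ring.
Qed.

Lemma normc_cexp s : normc (cexp s) = expR (complex.Re s).
Proof.
rewrite /cexp normcM normc_real ger0_norm ?expR_ge0//.
by rewrite /normc cos2Dsin2 sqrtr1 mulr1.
Qed.

Lemma cexp_neq0 s : cexp s != 0.
Proof. by rewrite -normc_gt0 normc_cexp expR_gt0. Qed.

Lemma cexpN s : cexp (- s) = (cexp s)^-1.
Proof.
apply: (mulfI (cexp_neq0 s)); by rewrite -cexpD subrr cexp0 divff ?cexp_neq0.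
Qed.

Lemma cexp_real x : cexp x%:C = (expR x)%:C.
Proof. by rewrite /cexp /= cos0 sin0 mulr1. Qed.

Lemma cexp_conj s : cexp s^*%C = (cexp s)^*%C.
Proof.
case: s => a b; rewrite /cexp /= cosN sinN.
by apply/eqP; rewrite eq_complex /=; apply/andP; split; apply/eqP; ring.
Qed.

Lemma cexp_sub_le w : normc w <= 1 / 2 -> normc (cexp w - 1 - w) <= 12 * normc w ^+ 2.
Proof.
move=> w1; have ha := le_trans (normc_Re w) w1; have hb := le_trans (normc_Im w) w1.
have na : complex.Re w ^+ 2 <= normc w ^+ 2.
  by rewrite -[leLHS]real_normK ?num_real// ler_pXn2r ?nnegrE ?normc_ge0// normc_Re.
have nb : complex.Im w ^+ 2 <= normc w ^+ 2.
  by rewrite -[leLHS]real_normK ?num_real// ler_pXn2r ?nnegrE ?normc_ge0// normc_Im.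
have E : cexp w - 1 - w = ((expR (complex.Re w) * cos (complex.Im w) - 1 - complex.Re w)
   +i* (expR (complex.Re w) * sin (complex.Im w) - complex.Im w)).
  by case: w {w1 ha hb na nb} => a b; rewrite /cexp; apply/eqP; rewrite eq_complex /=;
    apply/andP; split; apply/eqP; ring.
rewrite E; apply: (le_trans (normc_le_ReIm _)) => /=.
move: (complex.Re w) (complex.Im w) ha hb na nb => a b ha hb na nb.
have /andP[e1 e2] := expR_sub_le ha.
have c1 := one_sub_cos_ge0 b; have c2 := one_sub_cos_le b.
have s1 : `|sin b - b| <= b ^+ 2 by apply: abs_sin_sub_le; lra.
have s2 := abs_sin_le b.
set e := expR a in e1 e2 *; set co := cos b in c1 c2 *; set si := sin b in s1 s2 *.
have ha' := ha; move: ha'; rewrite ler_norml => /andP[a1 a2].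
have e3 : e <= 2 by move: e2; rewrite expr2; nra.
have e4 : `|e - 1| <= 2 * `|a|.
  have : 2 * a ^+ 2 <= `|a|.
    by rewrite -[a ^+ 2]real_normK ?num_real// expr2; have := normr_ge0 a; nra.
  move=> h; apply: (@le_trans _ _ (`|e - 1 - a| + `|a|)).
    by apply: le_trans (ler_normD _ _); rewrite subrK.
  by rewrite ger0_norm//; lra.
have t1 : `|e * co - 1 - a| <= 2 * a ^+ 2 + b ^+ 2.
  rewrite (_ : _ - _ = (e - 1 - a) - e * (1 - co)); last by ring.
  apply: (le_trans (ler_normB _ _)); apply: lerD; first by rewrite ger0_norm.
  rewrite ger0_norm; last by rewrite mulr_ge0// expR_ge0.
  have e0 : 0 <= e by exact: expR_ge0.
  by move: c2; rewrite !expr2; nra.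
have t2 : `|e * si - b| <= a ^+ 2 + 2 * b ^+ 2.
  rewrite (_ : _ - _ = (e - 1) * si + (si - b)); last by ring.
  apply: (le_trans (ler_normD _ _)).
  have : `|(e - 1) * si| <= a ^+ 2 + b ^+ 2.
    rewrite normrM -[a ^+ 2]real_normK ?num_real// -[b ^+ 2]real_normK ?num_real// !expr2.
    have := normr_ge0 (e - 1); have := normr_ge0 si; have := normr_ge0 a; have := normr_ge0 b.
    move: `|e - 1| `|si| `|a| `|b| s2 e4 => u1 u2 u3 u4 h1 h2 h3 h4 h5 h6.
    have : u1 * u2 <= 2 * u3 * u4 by apply: ler_pM.
    have := sqr_ge0 (u3 - u4); rewrite expr2; nra.
  lra.
have := sqr_ge0 (normc w); move: na nb t1 t2; lra.
Qed.

End exponential.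

(** * Euler's limit for the Gamma function *)

Section infinite_products.
Variable R : realType.
Local Notation C := (R[i]).

Lemma cvg_of_norm_bounded (u : nat -> R) (B : R) :
  (forall n, \sum_(0 <= k < n) `|u k| <= B) -> cvgn (series u).
Proof.
move=> uB; apply: normed_cvg; apply: nondecreasing_is_cvgn.
  rewrite [X in nondecreasing_seq X](_ : _ = fun n => \sum_(0 <= k < n) `|u k|)//.
  by apply/nondecreasing_seqP => n; rewrite big_nat_recr//= lerDl.
by exists B => _ [n _ <-]; exact: uB.
Qed.

Lemma tends_series (u : nat -> C) (B : R) :
  (forall n, \sum_(0 <= k < n) normc (u k) <= B) ->
  exists l, tends \oo (fun n => \sum_(0 <= k < n) u k) l.
Proof.
move=> uB.
have H (p : C -> R) : (forall z, `|p z| <= normc z) -> cvgn (series (fun k => p (u k))).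
  move=> pn; apply: (@cvg_of_norm_bounded _ B) => n; apply: le_trans (uB n).
  by apply: ler_sum => k _; exact: pn.
have hr := H _ (@normc_Re R); have hi := H _ (@normc_Im R).
exists (limn (series (fun k => complex.Re (u k))) +i* limn (series (fun k => complex.Im (u k)))).
have Es n : \sum_(0 <= k < n) u k = series (fun k => complex.Re (u k)) n +i* series (fun k => complex.Im (u k)) n.
  rewrite /series /=; elim: n => [|n IH]; first by rewrite !big_geq.
  by rewrite !big_nat_recr//= IH; case: (u n).
by apply: tends_ReIm => /=; under eq_fun do rewrite Es /=.
Qed.

Lemma prod_le_expR (u : nat -> R) (B : R) n : (forall k, 0 <= u k) ->
  \sum_(0 <= k < n) u k <= B -> \prod_(0 <= k < n) (1 + u k) <= expR B.
Proof.
move=> u0 uB; apply: (@le_trans _ _ (expR (\sum_(0 <= k < n) u k))); last by rewrite ler_expR.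
rewrite expR_sum; apply: ler_prod => k _; rewrite expR_ge1Dx andbT.
by rewrite addr_ge0.
Qed.

Lemma normc_prod_le (e : nat -> C) n (B : R) : \sum_(0 <= k < n) normc (e k) <= B ->
  normc (\prod_(0 <= k < n) (1 + e k)) <= expR B.
Proof.
move=> eB; rewrite normc_prod.
apply: le_trans (prod_le_expR (fun k => normc_ge0 (e k)) eB).
apply: ler_prod => k _; rewrite normc_ge0 /=.
by apply: (le_trans (ler_normcD _ _)); rewrite (normc_real 1) normr1.
Qed.

Lemma tends_prod (e : nat -> C) (B : R) :
  (forall n, \sum_(0 <= k < n) normc (e k) <= B) ->
  exists l, tends \oo (fun n => \prod_(0 <= k < n) (1 + e k)) l.
Proof.
move=> eB; pose P n := \prod_(0 <= k < n) (1 + e k).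
have [n|l hl] := @tends_series (fun n => P n * e n) (expR B * B).
  apply: (@le_trans _ _ (\sum_(0 <= k < n) expR B * normc (e k))).
    by apply: ler_sum => k _; rewrite normcM ler_wpM2r ?normc_ge0 ?normc_prod_le.
  by rewrite -big_distrr/= ler_wpM2l ?expR_ge0.
exists (1 + l).
have -> : (fun n => \prod_(0 <= k < n) (1 + e k)) = (fun n => 1 + \sum_(0 <= k < n) P k * e k).
  apply/funext => n; elim: n => [|n IH]; first by rewrite !big_geq// addr0.
  by rewrite !big_nat_recr//= IH addrA -IH /P; ring.
by apply: tendsD => //; exact: tends_cst.
Qed.

Lemma lower_bound_of_eventual (u : nat -> R) (n0 : nat) (a : R) : 0 < a ->
  (forall k, 0 < u k) -> (forall k, (n0 <= k)%N -> a <= u k) ->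
  exists2 d, 0 < d & forall k, d <= u k.
Proof.
elim: n0 a => [|n0 IH] a a0 u0 ua; first by exists a => // k; exact: ua.
apply: (IH (Num.min a (u n0))) => //; first by rewrite lt_min a0 u0.
move=> k; rewrite leq_eqVlt => /orP[/eqP <-|nk]; first by rewrite ge_min lexx orbT.
by rewrite ge_min ua.
Qed.

(** The inverses of the factors satisfy the same summability condition, so
    their product converges too, and the two limits are inverse to each other.
    *)
Lemma tends_prod_neq0 (e : nat -> C) (B : R) :
  (forall n, \sum_(0 <= k < n) normc (e k) <= B) -> (forall k, 1 + e k != 0) ->
  exists2 l, l != 0 & tends \oo (fun n => \prod_(0 <= k < n) (1 + e k)) l.
Proof.
move=> eB e0; have [l hl] := tends_prod eB.
have nB n : \sum_(0 <= k < n) `|normc (e k)| <= B.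
  by apply: le_trans (eB n); apply: ler_sum => k _; rewrite ger0_norm ?normc_ge0.
have /cvg_series_cvg_0/cvgrPdist_lt/(_ (1 / 2)) := cvg_of_norm_bounded nB.
rewrite divr_gt0// => /(_ isT) [n0 _ n0P].
have [|||d d0 dP] := @lower_bound_of_eventual (fun k => normc (1 + e k)) n0 (1 / 2).
- by rewrite divr_gt0.
- by move=> k; rewrite normc_gt0.
- move=> k /n0P; rewrite sub0r normrN ger0_norm ?normc_ge0// => h.
  have := ler_sub_normc 1 (- e k); rewrite opprK normcN (normc_real 1) normr1 => h2.
  by move: h h2; move: (normc _) (normc _) => x y; lra.
have [n|l' hl'] := @tends_prod (fun k => (1 + e k)^-1 - 1) (B / d).
  apply: (@le_trans _ _ (\sum_(0 <= k < n) normc (e k) / d)); last first.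
    by rewrite -big_distrl/= ler_wpM2r ?invr_ge0 ?(ltW d0).
  apply: ler_sum => k _.
  rewrite (_ : _ - 1 = - e k * (1 + e k)^-1); last by field.
  by rewrite normcM normcN normcV ler_wpM2l ?normc_ge0// lef_pV2 ?posrE// normc_gt0.
exists l => //; apply/eqP => l0.
have h1 : tends \oo (fun n : nat => 1 : C) (l * l').
  apply: (tends_ext _ (tendsM hl hl')); apply: nearW => n /=.
  by rewrite -big_split/= big1// => k _; rewrite [1 + (_ - 1)]addrC subrK divff ?e0.
have h2 : tends \oo (fun n : nat => 1 : C) 1 by exact: tends_cst.
have e1 : l * l' = 1 by exact: (tends_uniq h1 h2).
by move/eqP: e1; rewrite l0 mul0r eq_sym oner_eq0.
Qed.

Lemma bounded_sum_inv_sqr (u : nat -> R) (n0 : nat) (K : R) : (forall k, 0 <= u k) ->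
  (forall k, (n0 <= k)%N -> u k <= K / k.+1%:R ^+ 2) -> exists B, forall n, \sum_(0 <= k < n) u k <= B.
Proof.
move=> u0 uK; have K0 : 0 <= K.
  have := uK n0 (leqnn _); move=> /(le_trans (u0 n0)).
  by rewrite pmulr_lge0// invr_gt0 exprn_gt0.
exists (\sum_(0 <= k < n0) u k + 2 * K) => n.
have S m : \sum_(0 <= k < m) K / k.+1%:R ^+ 2 <= K * (2 - 2 / m.+1%:R).
  elim: m => [|m IH]; first by rewrite big_geq// divr1 subrr mulr0.
  rewrite big_nat_recr//=; apply: (le_trans (lerD IH (lexx _))).
  rewrite -mulrDr ler_wpM2l// -lerBrDl.
  have m1 : 1 <= m.+1%:R :> R by rewrite ler1n.
  rewrite -[m.+2]addn1 natrD /=; move: (m.+1%:R) m1 => t t1.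
  have -> : 2 - 2 / (t + 1) - (2 - 2 / t) = 2 / (t * (t + 1)).
    by field; rewrite !gt_eqF//; lra.
  rewrite ler_pdivlMr ?mulr_gt0//; try lra.
  rewrite mulrC ler_pdivrMr ?exprn_gt0//; last lra.
  by rewrite expr2; nra.
have [nn0|n0n] := leqP n n0.
  rewrite (big_cat_nat (n := n) (p := n0))//= -addrA lerDl addr_ge0 ?mulr_ge0//.
  exact: sumr_ge0.
rewrite (big_cat_nat (n := n0))//=; last exact: ltnW.
rewrite lerD2l; apply: (@le_trans _ _ (\sum_(n0 <= k < n) K / k.+1%:R ^+ 2)).
  by rewrite !big_nat; apply: ler_sum => k /andP[nk _]; exact: uK.
apply: (@le_trans _ _ (\sum_(0 <= k < n) K / k.+1%:R ^+ 2)).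
  rewrite [leRHS](big_cat_nat (n := n0))//=; last exact: ltnW.
  by rewrite lerDr sumr_ge0// => k _; rewrite divr_ge0 ?exprn_ge0.
apply: (le_trans (S n)); rewrite [leRHS]mulrC ler_wpM2l// gerBl.
by rewrite divr_ge0.
Qed.

End infinite_products.

Section gamma.
Variable R : realType.
Local Notation C := (R[i]).
Implicit Types s t : C.

Definition gauss s (n : nat) : C :=
  (n`!)%:R * cexp (s * (ln (n%:R : R))%:C) / \prod_(k < n.+1) (s + k%:R).

Definition nonpole s := forall k : nat, s + k%:R != 0.

Lemma nonpole_shift s : nonpole s -> nonpole (s + 1).
Proof. by move=> sp k; rewrite -addrA (addrC 1) natr1. Qed.

Lemma prod_nonpole s n : nonpole s -> \prod_(k < n) (s + k%:R) != 0.
Proof. by move=> sp; apply/prodf_neq0 => k _; exact: sp. Qed.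

Lemma fact_neq0 n : (n`!)%:R != 0 :> C.
Proof. by rewrite pnatr_eq0 -lt0n fact_gt0. Qed.

Lemma gauss_neq0 s n : nonpole s -> gauss s n != 0.
Proof.
move=> sp; apply: mulf_neq0.
  by apply: mulf_neq0; [exact: fact_neq0|exact: cexp_neq0].
by rewrite invr_eq0; exact: prod_nonpole.
Qed.

Lemma natC n : n%:R = (n%:R)%:C :> C.
Proof. by rewrite rmorph_nat. Qed.

Lemma normc_nat n : normc (n%:R : C) = n%:R.
Proof. by rewrite natC normc_real ger0_norm. Qed.

Definition gauss_ratio s (n : nat) : C :=
  cexp (s * (ln (1 + n.+1%:R^-1 : R))%:C) / (1 + s / n.+2%:R).

Lemma gauss_step s n : nonpole s -> gauss s n.+2 = gauss s n.+1 * gauss_ratio s n.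
Proof.
move=> sp; rewrite /gauss /gauss_ratio big_ord_recr/= factS natrM.
have -> : ln (n.+2%:R : R) = ln (n.+1%:R : R) + ln (1 + n.+1%:R^-1).
  rewrite -lnM ?posrE ?addr_gt0 ?invr_gt0//; congr ln.
  by rewrite -[n.+2]addn1 natrD mulrDr mulr1 divff.
rewrite real_cD [s * (_ + _)]mulrDr cexpD.
have h := sp n.+2; have hn : n.+2%:R != 0 :> C by rewrite pnatr_eq0.
have hp := prod_nonpole n.+2 sp.
have h' : n.+2%:R + s != 0 by rewrite addrC.
move: (\prod_(i < n.+2) _) (n.+2%:R : C) hp h hn h' => p N hp h hn h'.
by field; rewrite ?hp ?hn ?h ?h'.
Qed.

(** The exponential of s ln(1 + 1/(n+1)) and the factor 1 + s/(n+2) agree to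
    first order in 1/n. *)
Lemma gauss_ratio_bound s : exists n0 K, forall n, (n0 <= n)%N ->
  normc (gauss_ratio s n - 1) <= K / n.+1%:R ^+ 2.
Proof.
pose a := normc s; have a0 : 0 <= a by exact: normc_ge0.
exists (Num.trunc (2 * a)), (2 * (12 * a ^+ 2 + a)) => n hn.
have n1 : 2 * a <= n.+1%:R.
  by apply: (le_trans (ltW (truncnS_gt (2 * a)))); rewrite ler_nat ltnS.
have m0 : 0 < n.+1%:R :> R by [].
pose l : R := ln (1 + n.+1%:R^-1).
have l1 : l <= n.+1%:R^-1.
  by apply: le_ln1Dx; apply: (@lt_trans _ _ 0); rewrite ?invr_gt0// ltrN10.
have l2 : n.+2%:R^-1 <= l.
  have p : 0 < 1 + n.+1%:R^-1 :> R by rewrite addr_gt0 ?invr_gt0.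
  rewrite -lerN2 -lnV ?posrE//.
  rewrite (_ : (1 + n.+1%:R^-1)^-1 = 1 + (- n.+2%:R^-1) :> R); last first.
    have t0 : n.+1%:R != 0 :> R by rewrite gt_eqF.
    have t1 : n.+1%:R + 1 != 0 :> R by rewrite gt_eqF// addr_gt0.
    rewrite -[n.+2]addn1 natrD /=; move: (n.+1%:R : R) t0 t1 => t t0 t1.
    by field; rewrite t0 t1.
  by apply: le_ln1Dx; rewrite ltrN2 invf_lt1// ltr1n.
have l0 : 0 <= l by apply: le_trans l2; rewrite invr_ge0.
pose w := s * l%:C.
have nw : normc w = a * l by rewrite normcM normc_real (ger0_norm l0).
have wn : normc w <= a / n.+1%:R by rewrite nw ler_wpM2l.
have w1 : normc w <= 1 / 2.
  by apply: (le_trans wn); rewrite ler_pdivrMr//; lra.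
pose d := 1 + s / n.+2%:R.
have d2 : 1 / 2 <= normc d.
  have := ler_sub_normc 1 (- (s / n.+2%:R)); rewrite opprK normcN (normc_real 1) normr1.
  rewrite normcM normcV normc_nat -/a -/d.
  have : a / n.+2%:R <= 1 / 2.
    rewrite ler_pdivrMr//; apply: (@le_trans _ _ (n.+1%:R / 2)); first lra.
    by rewrite mulrC mul1r ler_wpM2l// ler_nat.
  by move: (normc d) (a / _) => x y; lra.
have d0 : d != 0 by rewrite -normc_gt0; apply: lt_le_trans d2; rewrite divr_gt0.
rewrite (_ : _ - 1 = ((cexp w - 1 - w) + s * (l - n.+2%:R^-1)%:C) / d); last first.
  rewrite /gauss_ratio -/l -/w -/d rmorphB fmorphV rmorph_nat /= -[1 in LHS](divff d0) -mulrBl.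
  by congr (_ / _); rewrite /d /w; ring.
rewrite normcM normcV.
have B : normc (cexp w - 1 - w + s * (l - n.+2%:R^-1)%:C) <= (12 * a ^+ 2 + a) / n.+1%:R ^+ 2.
  apply: (le_trans (ler_normcD _ _)); rewrite mulrDl; apply: lerD.
    apply: (le_trans (cexp_sub_le w1)); rewrite -mulrA ler_wpM2l// -expr_div_n.
    by rewrite ler_pXn2r ?nnegrE ?normc_ge0// divr_ge0.
  rewrite normcM normc_real -/a ler_wpM2l// ger0_norm ?subr_ge0//.
  apply: (@le_trans _ _ (n.+1%:R^-1 - n.+2%:R^-1)); first by rewrite lerD2r.
  rewrite -[n.+2]addn1 natrD /=; move: (n.+1%:R) m0 => t t0.
  rewrite (_ : _ - _ = (t * (t + 1))^-1); last by field; rewrite !gt_eqF// addr_gt0.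
  rewrite lef_pV2 ?posrE ?exprn_gt0 ?mulr_gt0 ?addr_gt0//.
  by rewrite expr2 ler_wpM2l// ?ltW// ltrDl.
apply: (@le_trans _ _ ((12 * a ^+ 2 + a) / n.+1%:R ^+ 2 * 2)).
  apply: ler_pM => //; rewrite ?normc_ge0 ?invr_ge0 ?normc_ge0//.
  rewrite -[leRHS]invrK lef_pV2 ?posrE ?invr_gt0 ?normc_gt0//.
  by rewrite -div1r.
by rewrite mulrAC [X in X / _]mulrC.
Qed.

(** Consecutive values of Euler's expression differ by a factor 1 + O(1/n^2),
    and none of these factors vanishes. *)
Lemma cgamma_tends s : nonpole s -> tends \oo (gauss s) (cgamma s) /\ cgamma s != 0.
Proof.
move=> sp; pose e n := gauss_ratio s n - 1.
have E n : gauss s n.+1 = gauss s 1 * \prod_(0 <= k < n) (1 + e k).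
  elim: n => [|n IH]; first by rewrite big_geq// mulr1.
  by rewrite gauss_step// IH big_nat_recr//= /e addrC subrK mulrA.
have [n0 [K eK]] := gauss_ratio_bound s.
have [B eB] := bounded_sum_inv_sqr (fun k => normc_ge0 (e k)) eK.
have [k|l l0 hl] := tends_prod_neq0 eB.
  rewrite /e addrC subrK; apply/eqP => r0.
  by have := gauss_neq0 k.+2 sp; rewrite gauss_step// r0 mulr0 eqxx.
have h : tends \oo (gauss s) (gauss s 1 * l).
  rewrite /tends -(cvg_shiftS (fun n => normc (gauss s n - gauss s 1 * l))).
  under eq_fun do rewrite E.
  by apply: tendsM => //; exact: tends_cst.
have -> : cgamma s = gauss s 1 * l by exact: (tends_lim h).
by split => //; rewrite mulf_neq0// gauss_neq0.
Qed.

Lemma cgammaS s : nonpole s -> cgamma (s + 1) = s * cgamma s.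
Proof.
move=> sp; have [h h0] := cgamma_tends sp.
have [h1 h10] := cgamma_tends (nonpole_shift sp).
apply: (tends_uniq h1).
have s0 : s != 0 by have := sp 0; rewrite addr0.
rewrite -[s * _]mulr1.
pose f n := s * gauss s n * (1 + (s + 1) / n%:R)^-1.
have inv0 : tends \oo (fun n => (n%:R : C)^-1) 0.
  rewrite /tends; under eq_fun do rewrite subr0 normcV normc_nat.
  pose u (n : nat) : R := n%:R^-1.
  have hh : u @ \oo --> (0 : R) by rewrite -(cvg_shiftS u); exact: cvg_harmonic.
  exact: hh.
have : tends \oo f (s * cgamma s * (1 + (s + 1) * 0)^-1).
  apply: tendsM; first by apply: tendsM => //; exact: tends_cst.
  apply: tendsV; first by rewrite mulr0 addr0 oner_eq0.
  apply: tendsD; first exact: tends_cst.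
  by apply: tendsM => //; exact: tends_cst.
rewrite mulr0 addr0 invr1; apply: tends_ext.
exists 1 => // n /= n1; rewrite /f /gauss [(s + 1) * _%:C]mulrDl [1 * _%:C]mul1r cexpD.
rewrite cexp_real lnK ?posrE ?ltr0n// rmorph_nat.
rewrite big_ord_recl/= [in RHS]big_ord_recr/= addr0.
rewrite (eq_bigr (fun i : 'I_n => s + 1 + i%:R)); last first.
  by move=> i _; rewrite /bump /= add1n -natr1; ring.
have n0 : n%:R != 0 :> C by rewrite pnatr_eq0 -lt0n.
have hp := prod_nonpole n (nonpole_shift sp).
have hn := nonpole_shift sp n.
have hn' : n%:R + (s + 1) != 0 by rewrite addrC.
by field; rewrite ?hp ?n0 ?s0 ?hn ?hn'.
Qed.

Lemma nonpole_conj s : nonpole s -> nonpole s^*%C.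
Proof. by move=> sp k; rewrite -(conjc_nat R k) -rmorphD conjc_eq0. Qed.

Lemma conj_mul_real s (a : R) : (s * a%:C)^*%C = s^*%C * a%:C.
Proof.
by case: s => x y; apply/eqP; rewrite eq_complex /=; apply/andP; split; apply/eqP; ring.
Qed.

Lemma gauss_conj s n : gauss s^*%C n = (gauss s n)^*%C.
Proof.
have E (A B D : C) : (A * B / D)^*%C = A^*%C * B^*%C / D^*%C.
  by rewrite !rmorphM fmorphV.
rewrite /gauss E conjc_nat rmorph_prod -cexp_conj conj_mul_real; congr (_ * _ / _); apply: eq_bigr => k _.
by rewrite rmorphD /= conjc_nat.
Qed.

Lemma cgamma_conj s : nonpole s -> cgamma s^*%C = (cgamma s)^*%C.
Proof.
move=> sp; have [h _] := cgamma_tends sp.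
have [h1 _] := cgamma_tends (nonpole_conj sp).
apply: (tends_uniq h1); rewrite /tends.
under eq_fun do rewrite gauss_conj -rmorphB normc_conj.
exact: h.
Qed.

Lemma nonpole_pos (a : R) : 0 < a -> nonpole a%:C.
Proof.
move=> a0 k; rewrite natC -rmorphD /= -normc_gt0 normc_real.
by rewrite normr_gt0 gt_eqF// ltr_wpDr.
Qed.

Lemma cgamma_pos (a : R) : 0 < a -> exists2 g : R, 0 < g & cgamma a%:C = g%:C.
Proof.
move=> a0; have [h h0] := cgamma_tends (nonpole_pos a0).
have E n : exists2 g : R, 0 <= g & gauss a%:C n = g%:C.
  exists ((n`!)%:R * expR (a * ln n%:R) / \prod_(k < n.+1) (a + k%:R)).
    rewrite divr_ge0 ?mulr_ge0 ?expR_ge0//; apply: prodr_ge0 => k _.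
    by rewrite addr_ge0// ltW.
  have E' (A B D : R) : (A * B / D)%:C = A%:C * B%:C / D%:C.
    by rewrite !rmorphM fmorphV.
  rewrite /gauss E' rmorph_nat -rmorphM /= cexp_real rmorph_prod.
  congr (_ * _ / _); apply: eq_bigr => k _.
  by rewrite rmorphD /= rmorph_nat.
have re : (fun n => complex.Re (gauss a%:C n)) @ \oo --> complex.Re (cgamma a%:C).
  exact: (tends_Re h).
have r0 : 0 <= complex.Re (cgamma a%:C).
  rewrite -(cvg_lim _ re)//; apply: limr_ge; first exact: (cvgP _ re).
  by apply: nearW => n; have [g g0 ->] := E n.
have hc : cgamma a%:C = (complex.Re (cgamma a%:C))%:C.
  apply: (tends_uniq h); apply: (tends_ext _ (tends_real re)).
  by apply: nearW => n; have [g g0 ->] := E n.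
exists (complex.Re (cgamma a%:C)) => //.
rewrite lt_neqAle r0 andbT eq_sym; apply/eqP => r00.
by move: h0; rewrite hc r00 eqxx.
Qed.

End gamma.

(** * Quotients of Gamma values under a real shift *)

Section gamma_ratio.
Variable R : realType.
Local Notation C := (R[i]).
Implicit Types s t : C.

Lemma lower_linear s : nonpole s -> exists2 d, 0 < d & forall k : nat,
  d * k.+1%:R <= normc (s + k%:R).
Proof.
move=> sp; pose a := normc s.
have [|k|k kn|d d0 dP] := @lower_bound_of_eventual _
   (fun k => normc (s + k%:R) / k.+1%:R) (Num.trunc (2 * a + 1)).+1 (1 / 2).
- by rewrite divr_gt0.
- by rewrite divr_gt0// normc_gt0.
- rewrite ler_pdivlMr//.
  have h : 2 * a + 1 <= k%:R.
    by apply: (le_trans (ltW (truncnS_gt (2 * a + 1)))); rewrite ler_nat.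
  have := ler_sub_normc k%:R (- s); rewrite opprK normcN normc_nat (addrC k%:R s) -/a.
  have -> : k.+1%:R = k%:R + 1 :> R by rewrite natr1.
  lra.
by exists d => // k; rewrite -ler_pdivlMr.
Qed.

Lemma lower_linear_perturb s (b h : R) (k : nat) : 0 < b -> b * k.+1%:R <= normc (s + k%:R) ->
  `|h| <= b / 2 -> b / 2 * k.+1%:R <= normc (s + h%:C + k%:R).
Proof.
move=> b0 bP hb; have k1 : 1 <= k.+1%:R :> R by rewrite ler1n.
have := ler_sub_normc (s + k%:R) (- h%:C); rewrite opprK normcN normc_real (addrAC s) => h1.
by apply: le_trans h1; move: bP hb k1; move: (normc _) (k.+1%:R : R) => x y; nra.
Qed.

Lemma prod_expansion (x : nat -> C) n (T : R) : \sum_(0 <= k < n) normc (x k) <= T ->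
  T <= 1 / 2 ->
  normc (\prod_(0 <= k < n) (1 + x k) - 1 - \sum_(0 <= k < n) x k) <= 2 * T ^+ 2.
Proof.
move=> xT T2; set t := \sum_(0 <= k < n) normc (x k) in xT.
have t0 : 0 <= t by apply: sumr_ge0 => k _; exact: normc_ge0.
have [h1 h2] : normc (\prod_(0 <= k < n) (1 + x k) - 1) <= \prod_(0 <= k < n) (1 + normc (x k)) - 1 /\
   normc (\prod_(0 <= k < n) (1 + x k) - 1 - \sum_(0 <= k < n) x k) <=
     \prod_(0 <= k < n) (1 + normc (x k)) - 1 - t.
  rewrite /t; elim: n {t xT t0} => [|n [IH1 IH2]].
    by rewrite !big_geq// !subrr (normc_real 0) normr0 ?subr0 ?subrr lexx.
  rewrite !big_nat_recr//=.
  set P := \prod_(0 <= i < n) (1 + x i) in IH1 IH2 *.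
  set Q := \prod_(0 <= i < n) (1 + normc (x i)) in IH1 IH2 *.
  have xn := normc_ge0 (x n).
  have Px : normc ((P - 1) * x n) <= (Q - 1) * normc (x n).
    by rewrite normcM ler_wpM2r.
  split.
    rewrite (_ : P * _ - 1 = (P - 1) + ((P - 1) * x n + x n)); last by ring.
    apply: (le_trans (ler_normcD _ _)); have := ler_normcD ((P - 1) * x n) (x n).
    by move: IH1 Px; move: (normc _) (normc (_ * _)) (normc (_ + _)) => u v w; nra.
  rewrite (_ : _ - _ - _ = (P - 1 - \sum_(0 <= i < n) x i) + (P - 1) * x n); last by ring.
  apply: (le_trans (ler_normcD _ _)); move: IH2 Px.
  by move: (normc _) (normc (_ * _)) => u v; nra.
apply: (le_trans h2).
have h3 : \prod_(0 <= k < n) (1 + normc (x k)) <= expR t.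
  by apply: prod_le_expR => [k|]; [exact: normc_ge0|].
have [_ h4] : True /\ expR t - 1 - t <= 2 * t ^+ 2.
  have /andP[_ ?] : 0 <= expR t - 1 - t <= 2 * t ^+ 2.
    by apply: expR_sub_le; rewrite ger0_norm// (le_trans xT).
  by [].
apply: (@le_trans _ _ (2 * t ^+ 2)); first lra.
by rewrite ler_pM2l// ler_pXn2r ?nnegrE// (le_trans t0).
Qed.

Definition gamma_quot s t (h : R) : C :=
  cgamma s * cgamma (t + h%:C) / (cgamma (s + h%:C) * cgamma t).

Definition inv_term s t (k : nat) : C := ((s + k%:R) * (t + k%:R))^-1.

Lemma sum_inv_sqr_bounded (K : R) : 0 <= K ->
  exists2 B, 0 < B & forall n, \sum_(0 <= k < n) K / k.+1%:R ^+ 2 <= B.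
Proof.
move=> K0; have [|k _|B hB] := @bounded_sum_inv_sqr _ (fun k => K / k.+1%:R ^+ 2) 0 K.
- by move=> k; rewrite divr_ge0// exprn_ge0.
- by [].
exists (`|B| + 1); first by rewrite ltr_wpDl.
by move=> n; apply: (le_trans (hB n)); rewrite (le_trans (ler_norm _))// lerDl.
Qed.

Lemma inv_term_le s t (d e : R) (k : nat) : 0 < d -> 0 < e ->
  d * k.+1%:R <= normc (s + k%:R) -> e * k.+1%:R <= normc (t + k%:R) ->
  normc (inv_term s t k) <= (d * e)^-1 / k.+1%:R ^+ 2.
Proof.
move=> d0 e0 hd he; rewrite /inv_term normcV normcM -invfM.
have k0 : 0 < k.+1%:R :> R by [].
rewrite lef_pV2 ?posrE ?mulr_gt0 ?exprn_gt0//.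
- by rewrite expr2 mulrACA; apply: ler_pM => //; rewrite mulr_ge0// ltW.
- by apply: lt_le_trans hd; rewrite mulr_gt0.
- by apply: lt_le_trans he; rewrite mulr_gt0.
Qed.

Lemma inv_term_tends s t : nonpole s -> nonpole t ->
  exists l, tends \oo (fun n => \sum_(0 <= k < n) inv_term s t k) l.
Proof.
move=> /lower_linear[d d0 dP] /lower_linear[e e0 eP].
have [|B B0 hB] := @sum_inv_sqr_bounded (d * e)^-1.
  by rewrite invr_ge0 mulr_ge0// ltW.
apply: (@tends_series _ _ B) => n; apply: le_trans (hB n).
by apply: ler_sum => k _; exact: inv_term_le.
Qed.

(** The quotient is the infinite product over k of 1 + h (t - s) / ((s + k)(t
    + h + k)); its derivative at h = 0 is the sum of (t - s) / ((s + k)(t +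
    k)), a difference of two digamma values. *)
Lemma gamma_quot_expansion s t (l : C) : nonpole s -> nonpole t ->
  tends \oo (fun n => \sum_(0 <= k < n) inv_term s t k) l ->
  exists h0 K : R, [/\ 0 < h0, 0 < K & forall h : R, `|h| <= h0 ->
    [/\ nonpole (s + h%:C), nonpole (t + h%:C) &
    normc (gamma_quot s t h - 1 - h%:C * ((t - s) * l)) <= K * h ^+ 2]].
Proof.
move=> sp tp hl.
have [d d0 dP] := lower_linear sp; have [e e0 eP] := lower_linear tp.
pose a := normc (t - s); have a0 : 0 <= a by exact: normc_ge0.
have [|S S0 hS] := @sum_inv_sqr_bounded (2 * a / (d * e)).
  by rewrite divr_ge0 ?mulr_ge0// ltW.
have [|S' S'0 hS'] := @sum_inv_sqr_bounded (2 * a / (d * e * e)).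
  by rewrite divr_ge0 ?mulr_ge0// ?mulr_ge0 ltW.
pose h0 := Num.min (Num.min (d / 2) (e / 2)) (1 / (2 * S)).
exists h0, (2 * S ^+ 2 + S'); split.
- by rewrite !lt_min !divr_gt0 ?mulr_gt0.
- by rewrite addr_gt0// mulr_gt0 ?exprn_gt0.
move=> h; rewrite !le_min => /andP[/andP[hd he] hS2].
have k1 (k : nat) : 1 <= k.+1%:R :> R by rewrite ler1n.
have H := lower_linear_perturb.
have bk0 (b : R) (k : nat) : 0 < b -> 0 < b * k.+1%:R by move=> b0; rewrite mulr_gt0.
have sph : nonpole (s + h%:C).
  move=> k; rewrite -normc_gt0; apply: lt_le_trans (H s d h k d0 (dP k) hd).
  by rewrite bk0// divr_gt0.
have tph : nonpole (t + h%:C).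
  move=> k; rewrite -normc_gt0; apply: lt_le_trans (H t e h k e0 (eP k) he).
  by rewrite bk0// divr_gt0.
split => //.
pose c (k : nat) : C := (t - s) / ((s + k%:R) * (t + h%:C + k%:R)).
have cn (k : nat) : normc (h%:C * c k) <= `|h| * (2 * a / (d * e) / k.+1%:R ^+ 2).
  rewrite normcM normc_real ler_wpM2l// /c normcM normcV normcM -/a.
  rewrite (_ : 2 * a / (d * e) / k.+1%:R ^+ 2 = a * ((d * k.+1%:R) * (e / 2 * k.+1%:R))^-1); last first.
    by field; rewrite !gt_eqF.
  rewrite ler_wpM2l// lef_pV2 ?posrE ?mulr_gt0 ?normc_gt0 ?bk0 ?divr_gt0//.
  have e2 : 0 < e / 2 by rewrite divr_gt0.
  by apply: ler_pM; [exact/ltW/bk0|exact/ltW/bk0|exact: dP|exact: H].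
have cn' (k : nat) : normc (h%:C * c k - h%:C * ((t - s) * inv_term s t k))
    <= `|h| ^+ 2 * (2 * a / (d * e * e) / k.+1%:R ^+ 2).
  rewrite (_ : _ - _ = h%:C * h%:C * ((t - s) * - ((s + k%:R) * (t + k%:R) * (t + h%:C + k%:R))^-1)); last first.
    rewrite /c /inv_term; have := sp k; have := tp k; have := tph k.
    move: (k%:R : C) => x h1 h2 h3; field.
    by rewrite ?h1 ?h2 ?h3.
  rewrite normcM -real_cM normc_real normrM -expr2 ler_wpM2l ?exprn_ge0//.
  rewrite normcM normcN normcV !normcM -/a.
  apply: (@le_trans _ _ (a * ((d * k.+1%:R) * (e * k.+1%:R) * (e / 2 * k.+1%:R))^-1)).
    rewrite ler_wpM2l// lef_pV2 ?posrE ?mulr_gt0 ?normc_gt0 ?bk0 ?divr_gt0//.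
    have e2 : 0 < e / 2 by rewrite divr_gt0.
    apply: ler_pM; [by rewrite ltW ?mulr_gt0 ?bk0|exact/ltW/bk0| |exact: H].
    by apply: ler_pM; [exact/ltW/bk0|exact/ltW/bk0|exact: dP|exact: eP].
  rewrite (_ : a * _ = 2 * a / (d * e * e) / k.+1%:R ^+ 2 / k.+1%:R); last first.
    by field; rewrite !gt_eqF.
  rewrite ler_pdivrMr// ler_peMr//.
  by rewrite !divr_ge0 ?mulr_ge0 ?exprn_ge0// ltW.
pose Q n := gauss s n * gauss (t + h%:C) n / (gauss (s + h%:C) n * gauss t n).
have QE n : Q n = \prod_(0 <= k < n.+1) (1 + h%:C * c k).
  rewrite big_mkord (eq_bigr (fun k : 'I_n.+1 => ((s + h%:C + k%:R) * (t + k%:R)) *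
      ((s + k%:R) * (t + h%:C + k%:R))^-1)); last first.
    move=> k _; rewrite /c; have := sp k; have := tph k.
    by move: (k%:R : C) => x h1 h2; field; rewrite ?h1 ?h2.
  rewrite !big_split /= prodfV big_split /= /Q /gauss !mulrDl !cexpD.
  have := prod_nonpole n.+1 sp; have := prod_nonpole n.+1 tph.
  have := prod_nonpole n.+1 sph; have := prod_nonpole n.+1 tp.
  have := cexp_neq0 (s * (ln n%:R)%:C); have := cexp_neq0 (t * (ln n%:R)%:C).
  have := cexp_neq0 (h%:C * (ln n%:R)%:C); have := @fact_neq0 R n.
  move: (cexp _) (cexp _) (cexp _) => e1 e2 e3.
  move: (\prod_(k < n.+1) _) (\prod_(k < n.+1) _) (\prod_(k < n.+1) _) (\prod_(k < n.+1) _).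
  move=> p1 p2 p3 p4; move: (n`!%:R : C) => f h1 h2 h3 h4 h5 h6 h7 h8.
  by field; rewrite ?h1 ?h2 ?h3 ?h4 ?h5 ?h6 ?h7 ?h8.
have [gs gs0] := cgamma_tends sp; have [gt gt0] := cgamma_tends tp.
have [gsh gsh0] := cgamma_tends sph; have [gth gth0] := cgamma_tends tph.
have Qt : tends \oo Q (gamma_quot s t h).
  apply: tendsM; first by apply: tendsM.
  by apply: tendsV; [rewrite mulf_neq0|apply: tendsM].
have hl' : tends \oo (fun n => \sum_(0 <= k < n.+1) inv_term s t k) l.
  by rewrite /tends (cvg_shiftS (fun n => normc (\sum_(0 <= k < n) inv_term s t k - l))).
have Et : tends \oo (fun n => Q n - 1 - h%:C * ((t - s) * \sum_(0 <= k < n.+1) inv_term s t k))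
    (gamma_quot s t h - 1 - h%:C * ((t - s) * l)).
  apply: tendsB; first by apply: tendsB => //; exact: tends_cst.
  by apply: tendsM; [exact: tends_cst|apply: tendsM => //; exact: tends_cst].
have En : (fun n => normc (Q n - 1 - h%:C * ((t - s) * \sum_(0 <= k < n.+1) inv_term s t k))) @ \oo
   --> normc (gamma_quot s t h - 1 - h%:C * ((t - s) * l)) by exact: (tends_normc Et).
rewrite -(cvg_lim _ En)//; apply: limr_le; first exact: (cvgP _ En).
apply: nearW => n; rewrite QE.
rewrite (_ : _ - _ = (\prod_(0 <= k < n.+1) (1 + h%:C * c k) - 1 - \sum_(0 <= k < n.+1) h%:C * c k)
  + \sum_(0 <= k < n.+1) (h%:C * c k - h%:C * ((t - s) * inv_term s t k))); last first.
  by rewrite sumrB -!big_distrr/=; ring.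
rewrite mulrDl; apply: (le_trans (ler_normcD _ _)); apply: lerD.
  have T : \sum_(0 <= k < n.+1) normc (h%:C * c k) <= `|h| * S.
    apply: (@le_trans _ _ (\sum_(0 <= k < n.+1) `|h| * (2 * a / (d * e) / k.+1%:R ^+ 2))).
      by apply: ler_sum => k _; exact: cn.
    by rewrite -big_distrr/= ler_wpM2l.
  apply: (le_trans (prod_expansion T _)).
    apply: (le_trans (ler_wpM2r (ltW S0) hS2)).
    by rewrite le_eqVlt; apply/orP; left; apply/eqP; field; rewrite gt_eqF.
  by rewrite exprMn real_normK ?num_real// -[leRHS]mulrA [S ^+ 2 * _]mulrC.
apply: (le_trans (ler_normc_sum _ _)).
apply: (@le_trans _ _ (\sum_(0 <= k < n.+1) `|h| ^+ 2 * (2 * a / (d * e * e) / k.+1%:R ^+ 2))).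
  by apply: ler_sum => k _; exact: cn'.
by rewrite -big_distrr/= real_normK ?num_real// mulrC ler_wpM2r ?sqr_ge0.
Qed.

Lemma near_dist (x0 e : R) : 0 < e -> \forall t \near x0^', `|t - x0| <= e /\ t != x0.
Proof.
move=> e0; rewrite near_withinE; have := nbhsx_ballx x0 e e0.
apply: filterS => t; rewrite /ball/= distrC => te tx; split => //; exact: ltW.
Qed.

Lemma dist_cvg0 (x0 : R) : (fun t : R => `|t - x0|) @ x0^' --> (0 : R).
Proof.
apply/cvgrPdist_le => e e0; apply: filterS (near_dist x0 e0) => t [h _].
by rewrite sub0r normrN normr_id.
Qed.

Lemma nonpole1 : nonpole (1 : C).
Proof. exact: (nonpole_pos ltr01). Qed.

Lemma gamma_quot_tends s t (l : C) (x0 : R) : nonpole s -> nonpole t ->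
  tends \oo (fun n => \sum_(0 <= k < n) inv_term s t k) l ->
  tends x0^' (fun u => gamma_quot s t (u - x0)) 1 /\
  tends x0^' (fun u => (gamma_quot s t (u - x0) - 1) / (u - x0)%:C) ((t - s) * l).
Proof.
move=> sp tp hl; have [h0 [K [h00 K0 hK]]] := gamma_quot_expansion sp tp hl.
have d0 := dist_cvg0 x0; pose D := (t - s) * l.
have dK (B : R) : (fun u : R => B * `|u - x0|) @ x0^' --> (0 : R).
  by rewrite -[0](mulr0 B); apply: cvgMr.
split.
  apply: (tends_squeeze _ (dK (normc D + K * h0))).
  apply: filterS (near_dist x0 h00) => u [u1 u2]; have [_ _ hu] := hK _ u1.
  rewrite -[X in normc X](subrK ((u - x0)%:C * D)).
  apply: (le_trans (ler_normcD _ _)); rewrite normcM normc_real.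
  have : K * (u - x0) ^+ 2 <= K * h0 * `|u - x0|.
    by rewrite -mulrA ler_pM2l// -[_ ^+ 2]real_normK ?num_real// expr2 ler_wpM2r.
  by move: hu; rewrite /D; move: (normc _) (normc _) => a b; lra.
apply: (tends_squeeze _ (dK K)).
apply: filterS (near_dist x0 h00) => u [u1 u2]; have [_ _ hu] := hK _ u1.
have h0' : (u - x0)%:C != 0 by rewrite -normc_gt0 normc_real normr_gt0 subr_eq0.
rewrite (_ : _ - _ = (gamma_quot s t (u - x0) - 1 - (u - x0)%:C * D) / (u - x0)%:C); last first.
  by rewrite /D; move: (_ * l) (gamma_quot _ _ _) h0' => D' g; move: (_%:C) => h h'; field.
rewrite normcM normcV normc_real ler_pdivrMr ?normr_gt0 ?subr_eq0//.
by rewrite -mulrA -expr2 real_normK ?num_real.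
Unshelve. all: by end_near. Qed.

Lemma sqrtC_sqr_real (a : R) : 0 <= a -> sqrtC ((a%:C) ^+ 2 : C) = a%:C.
Proof. by move=> a0; apply: sqrCK; rewrite ler0c. Qed.

(** The Gamma-kernel on the diagonal, up to its constant factor. Comparison of
    the shifted Gamma values with Gamma(1 + h) > 0 makes the number under the
    root the square of A * (Gamma(1 + h) / Gamma(1)) / w, where w^2 is the
    product of gamma_quot s 1 h and gamma_quot t 1 h, which tend to 1; the
    difference in the numerator is the derivative of gamma_quot s t. *)
Lemma gamma_diag_limit s t (l : C) (x0 A : R) : nonpole s -> nonpole t ->
  tends \oo (fun n => \sum_(0 <= k < n) inv_term s t k) l ->
  0 < A -> cgamma s * cgamma t = A%:C ->
  (forall h, nonpole (s + h%:C) -> nonpole (t + h%:C) -> nonpole (1 + h%:C) ->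
    exists v : R, gamma_quot s 1 h * gamma_quot t 1 h = v%:C) ->
  tends x0^' (fun u => (sqrtC (cgamma s * cgamma t * cgamma (s + (u - x0)%:C) * cgamma (t + (u - x0)%:C)))^-1
     * ((cgamma s * cgamma (t + (u - x0)%:C) - cgamma t * cgamma (s + (u - x0)%:C)) / (x0 - u)%:C))
   ((s - t) * l).
Proof.
move=> sp tp hl A0 hA hv; have [ls hls] := inv_term_tends sp nonpole1.
have [lt hlt] := inv_term_tends tp nonpole1.
have [h1 [K1 [h10 _ hK1]]] := gamma_quot_expansion sp tp hl.
have [L1 _] := gamma_quot_tends x0 sp nonpole1 hls.
have [L2 _] := gamma_quot_tends x0 tp nonpole1 hlt.
have [_ L3] := gamma_quot_tends x0 sp tp hl.
(* The product of the two quotients is real for small h, and positive since it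
   tends to 1. *)
pose v h : R := complex.Re (gamma_quot s 1 h * gamma_quot t 1 h).
have v1 : (fun u => v (u - x0)) @ x0^' --> (1 : R).
  have := tends_Re (tendsM L1 L2); rewrite mulr1 /=; apply.
have sv1 : (fun u => Num.sqrt (v (u - x0))) @ x0^' --> (1 : R).
  by rewrite -[X in _ --> X]sqrtr1; apply: (continuous_cvg _ _ v1); exact: sqrt_continuous.
have T : tends x0^' (fun u => (Num.sqrt (v (u - x0)))%:C * (gamma_quot s 1 (u - x0))^-1 *
     - ((gamma_quot s t (u - x0) - 1) / (u - x0)%:C)) ((1%:C * 1^-1) * - ((t - s) * l)).
  apply: tendsM; last exact: tendsN.
  apply: tendsM; first exact: tends_real.
  by apply: tendsV => //; exact: oner_neq0.
rewrite (_ : (s - t) * l = (1%:C * 1^-1) * - ((t - s) * l)); last by rewrite invr1 !mul1r; ring.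
apply: (tends_ext _ T).
have vpos : \forall u \near x0^', 0 < v (u - x0).
  have /cvgrPdist_lt/(_ 1 ltr01) := v1; apply: filterS => u.
  by rewrite ltr_norml => /andP[_]; lra.
near=> u.
have [hh1 hu] : `|u - x0| <= Num.min h1 (1 / 2) /\ u != x0.
  by near: u; apply: near_dist; rewrite lt_min h10 divr_gt0.
have vh : 0 < v (u - x0) by near: u.
set h := u - x0 in hh1 vh *.
move: hh1; rewrite le_min => /andP[hh1 hh2].
have [sph tph _] := hK1 _ hh1.
have [g1 g10 g1E] := cgamma_pos (@ltr01 R).
have h1p : 0 < 1 + h by move: hh2; rewrite ler_norml => /andP[]; lra.
have hC1 : 1 + h%:C = (1 + h)%:C by rewrite -[1]/((1 : R)%:C) -real_cD.
have [gh gh0 ghE] : exists2 g : R, 0 < g & cgamma (1 + h%:C) = g%:C.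
  by rewrite hC1; exact: cgamma_pos.
have vE : gamma_quot s 1 h * gamma_quot t 1 h = (v h)%:C.
  rewrite /v; have [|w ->//] := hv h sph tph; rewrite hC1; exact: nonpole_pos.
have [_ gs0] := cgamma_tends sp; have [_ gt0] := cgamma_tends tp.
have [_ gsh0] := cgamma_tends sph; have [_ gth0] := cgamma_tends tph.
have E1 : gamma_quot s 1 h = cgamma s * gh%:C / (cgamma (s + h%:C) * g1%:C).
  by rewrite /gamma_quot ghE g1E.
have E2 : gamma_quot t 1 h = cgamma t * gh%:C / (cgamma (t + h%:C) * g1%:C).
  by rewrite /gamma_quot ghE g1E.
have ghC : gh%:C != 0 :> C by rewrite -normc_gt0 normc_real normr_gt0 gt_eqF.
have g1C : g1%:C != 0 :> C by rewrite -normc_gt0 normc_real normr_gt0 gt_eqF.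
have hC : h%:C != 0 :> C by rewrite -normc_gt0 normc_real normr_gt0 subr_eq0.
pose w := Num.sqrt (v h); have w0 : 0 < w by rewrite sqrtr_gt0.
have wC : w%:C != 0 :> C by rewrite -normc_gt0 normc_real normr_gt0 gt_eqF.
have w2 : w%:C ^+ 2 = gamma_quot s 1 h * gamma_quot t 1 h.
  by rewrite -real_cX sqr_sqrtr ?vE// ltW.
have AC : A%:C != 0 :> C by rewrite -normc_gt0 normc_real normr_gt0 gt_eqF.
have -> : cgamma s * cgamma t * cgamma (s + h%:C) * cgamma (t + h%:C) =
    ((A * (gh / g1) / w)%:C) ^+ 2.
  have -> : (A * (gh / g1) / w)%:C = A%:C * (gh%:C / g1%:C) / w%:C :> C.
    by rewrite (real_cM (A * _)) (real_cM A) (real_cM gh) !real_cV.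
  rewrite -hA expr_div_n w2 E1 E2.
  by field; rewrite ?gs0 ?gt0 ?gsh0 ?gth0 ?ghC ?g1C.
rewrite sqrtC_sqr_real; last by rewrite ltW// !mulr_gt0 ?invr_gt0.
rewrite -/w !real_cM !real_cV -hA E1 /gamma_quot (_ : (x0 - u)%:C = - h%:C); last first.
  by rewrite -real_cN opprB.
by field; rewrite ?gs0 ?gt0 ?gsh0 ?gth0 ?ghC ?g1C ?hC ?wC.
Unshelve. all: by end_near. Qed.

End gamma_ratio.

(** * Sums of inverse products *)

Section inverse_sums.
Variable R : realType.
Local Notation C := (R[i]).
Implicit Types s t : C.

Definition invsum s t : C :=
  lim ((fun n => \sum_(0 <= k < n) inv_term s t k : R[i]^o) @ \oo).

Lemma invsum_tends s t : nonpole s -> nonpole t ->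
  tends \oo (fun n => \sum_(0 <= k < n) inv_term s t k) (invsum s t).
Proof.
move=> sp tp; have [l hl] := inv_term_tends sp tp.
by rewrite /invsum (tends_lim hl).
Qed.

Lemma tendsS (f : nat -> C) l : tends \oo (fun n => f n.+1) l -> tends \oo f l.
Proof. by rewrite /tends -(cvg_shiftS (fun n => normc (f n - l))). Qed.

Lemma tends_shiftS (f : nat -> C) l : tends \oo f l -> tends \oo (fun n => f n.+1) l.
Proof. by rewrite /tends (cvg_shiftS (fun n => normc (f n - l))). Qed.

Lemma invsum_step s t : nonpole s -> nonpole t ->
  invsum s t = (s * t)^-1 + invsum (s + 1) (t + 1).
Proof.
move=> sp tp; have h := invsum_tends (nonpole_shift sp) (nonpole_shift tp).
apply: (tends_uniq (tends_shiftS (invsum_tends sp tp))).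
apply: (tends_ext _ (tendsD (tends_cst (s * t)^-1) h)).
apply: nearW => n; rewrite big_nat_recl// {2}/inv_term !addr0; congr (_ + _).
by apply: eq_bigr => k _; rewrite /inv_term -!addrA nat1r.
Qed.

Lemma tends_normc_le (f : nat -> C) l (B : R) : tends \oo f l ->
  (forall n, normc (f n) <= B) -> normc l <= B.
Proof.
move=> /tends_normc fl fB; rewrite -(cvg_lim _ fl)//; apply: limr_le; first exact: (cvgP _ fl).
exact: nearW.
Qed.

Lemma sum_inv_sqr_tail (n N : nat) : (0 < n)%N ->
  \sum_(0 <= k < N) ((n + k).+1%:R ^+ 2)^-1 <= n%:R^-1 :> R.
Proof.
move=> n0; suff : \sum_(0 <= k < N) ((n + k).+1%:R ^+ 2)^-1 <= n%:R^-1 - (n + N)%:R^-1 :> R.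
  by move=> h; apply: (le_trans h); rewrite gerBl invr_ge0.
elim: N => [|N IH]; first by rewrite big_geq// addn0 subrr.
rewrite big_nat_recr//= addnS; apply: (le_trans (lerD IH (lexx _))).
have x0 : 0 < (n + N)%:R :> R by rewrite ltr0n addn_gt0 n0.
rewrite -(natr1 (n + N)); move: (_%:R) x0 => x x0.
rewrite -subr_ge0.
rewrite (_ : _ - _ = (x * (x + 1) ^+ 2)^-1).
  by rewrite invr_ge0 mulr_ge0 ?exprn_ge0//; lra.
have nn : 0 < n%:R :> R by rewrite ltr0n.
have x1 : 0 < x + 1 by rewrite addr_gt0.
by field; rewrite !gt_eqF.
Qed.

Lemma invsum_bound s t : nonpole s -> nonpole t -> exists2 D, 0 < D &
  forall n : nat, (0 < n)%N -> normc (invsum (s + n%:R) (t + n%:R)) <= D / n%:R.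
Proof.
move=> sp tp; have [d d0 dP] := lower_linear sp; have [e e0 eP] := lower_linear tp.
exists (d * e)^-1 => [|n n0]; first by rewrite invr_gt0 mulr_gt0.
have spn (u : C) : nonpole u -> nonpole (u + n%:R) by move=> up k; rewrite -addrA -natrD.
apply: (tends_normc_le (invsum_tends (spn _ sp) (spn _ tp))) => N.
apply: (le_trans (ler_normc_sum _ _)).
apply: (@le_trans _ _ (\sum_(0 <= k < N) (d * e)^-1 * ((n + k).+1%:R ^+ 2)^-1)).
  apply: ler_sum => k _; rewrite (_ : inv_term _ _ _ = inv_term s t (n + k)).
    exact: inv_term_le.
  by rewrite /inv_term -!addrA -natrD.
by rewrite -big_distrr/= ler_wpM2l ?sum_inv_sqr_tail// invr_ge0 mulr_ge0 ?ltW.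
Qed.

Lemma invsum_lipschitz s : nonpole s -> exists h0 K : R, [/\ 0 < h0, 0 < K & forall h,
  `|h| <= h0 -> nonpole (s + h%:C) /\
    normc (invsum s (s + h%:C) - invsum s s) <= K * `|h|].
Proof.
move=> sp; have [d d0 dP] := lower_linear sp.
have [|S S0 hS] := @sum_inv_sqr_bounded R (2 / (d * d * d)).
  by rewrite divr_ge0// !mulr_ge0// ltW.
exists (d / 2), S; split => //; first by rewrite divr_gt0.
move=> h hd; have H k := lower_linear_perturb d0 (dP k) hd.
have d2 : 0 < d / 2 by rewrite divr_gt0.
have sph : nonpole (s + h%:C).
  by move=> k; rewrite -normc_gt0; apply: lt_le_trans (H k); rewrite mulr_gt0.
split=> //.
apply: (tends_normc_le (tendsB (invsum_tends sp sph) (invsum_tends sp sp))) => N.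
rewrite -sumrB; apply: (le_trans (ler_normc_sum _ _)).
apply: (@le_trans _ _ (\sum_(0 <= k < N) `|h| * (2 / (d * d * d) / k.+1%:R ^+ 2))); last first.
  by rewrite -big_distrr/= mulrC ler_wpM2r.
apply: ler_sum => k _.
rewrite (_ : _ - _ = - h%:C * (inv_term s (s + h%:C) k * (s + k%:R)^-1)); last first.
  rewrite /inv_term; have := sp k; have := sph k; rewrite addrAC.
  by move: (s + _) => x h1 h2; field; rewrite ?h1 ?h2.
rewrite normcM normcN normc_real ler_wpM2l// normcM normcV.
apply: (@le_trans _ _ ((d * (d / 2))^-1 / k.+1%:R ^+ 2 * (d * k.+1%:R)^-1)).
  apply: ler_pM; rewrite ?normc_ge0 ?invr_ge0 ?normc_ge0//; first exact: inv_term_le.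
  rewrite lef_pV2 ?posrE ?normc_gt0// ?mulr_gt0//.
rewrite (_ : _ * _ = 2 / (d * d * d) / k.+1%:R ^+ 2 / k.+1%:R); last first.
  by field; rewrite ?gt_eqF.
rewrite ler_pdivrMr// ler_peMr ?ler1n// !divr_ge0 ?mulr_ge0// ?ltW//.
Qed.

Lemma invsum_tends_shift s (e : R) (x0 : R) : `|e| = 1 -> nonpole s ->
  tends x0^' (fun t : R => invsum s (s + (e * (t - x0))%:C)) (invsum s s).
Proof.
move=> e1 sp; have [h0 [K [h00 K0 hK]]] := invsum_lipschitz sp.
apply: (@tends_squeeze _ _ _ _ _ (fun t : R => K * `|t - x0|)).
  apply: filterS (near_dist x0 h00) => t [t1 _].
  by rewrite -[X in K * X]mul1r -e1 -normrM; apply: (hK _ _).2; rewrite normrM e1 mul1r.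
rewrite -[0](mulr0 K); apply: cvgMr; exact: dist_cvg0.
Qed.

(** Partial fractions. *)
Lemma invsum_diff s t : nonpole s -> nonpole t ->
  tends \oo (fun n => \sum_(0 <= k < n) ((s + k%:R)^-1 - (t + k%:R)^-1)) ((t - s) * invsum s t).
Proof.
move=> sp tp; apply: (tends_ext _ (tendsM (tends_cst (t - s)) (invsum_tends sp tp))); apply: nearW => n; rewrite big_distrr; apply: eq_bigr => k _ /=.
rewrite /inv_term (_ : t - s = (t + k%:R) - (s + k%:R)); last by ring.
by have := sp k; have := tp k; move: (s + _) (t + _) => x y x0 y0; field; rewrite ?x0 ?y0.
Qed.

Lemma invsum_sym s t : invsum s t = invsum t s.
Proof.
rewrite /invsum; have -> : inv_term s t = inv_term t s by apply/funext => k; rewrite /inv_term mulrC.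
by [].
Qed.

Lemma invsum_real s t (f : nat -> R) : nonpole s -> nonpole t ->
  (forall k, (s + k%:R) * (t + k%:R) = (f k)%:C) ->
  invsum s t = (complex.Re (invsum s t))%:C /\
  (fun n => \sum_(0 <= k < n) (f k)^-1) @ \oo --> complex.Re (invsum s t).
Proof.
move=> sp tp hf; have h := invsum_tends sp tp.
have fE n : \sum_(0 <= k < n) inv_term s t k = (\sum_(0 <= k < n) (f k)^-1)%:C.
  elim: n => [|n IH]; first by rewrite !big_geq.
  by rewrite !big_nat_recr//= real_cD IH /inv_term hf real_cV.
have h2 : (fun n => \sum_(0 <= k < n) (f k)^-1) @ \oo --> complex.Re (invsum s t).
  rewrite (_ : (fun n => _) = fun n => complex.Re (\sum_(0 <= k < n) inv_term s t k)).
    exact: tends_Re h.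
  by apply/funext => n; rewrite fE.
split => //; apply: (tends_uniq h).
by apply: (tends_ext _ (tends_real h2)); apply: nearW => n; rewrite fE.
Qed.

End inverse_sums.

(** * The Gamma-kernel on and off the diagonal *)

Lemma int_shift_ind (Q : int -> Prop) : Q 0 -> (forall n, Q n -> Q (n + 1)) ->
  (forall n, Q (n + 1) -> Q n) -> forall n, Q n.
Proof.
move=> Q0 Qup Qdown; elim/int_rec => // n IH; first by rewrite -addn1 PoszD; exact: Qup.
by apply: Qdown; rewrite -addn1 PoszD opprD addrNK.
Qed.

Section kernel_values.
Variable R : realType.
Local Notation C := (R[i]).
Implicit Types (s t u v z : C) (n m x y : int).

Lemma intC n : n%:~R = (n%:~R)%:C :> C.
Proof. by case: n => k; rewrite ?NegzE ?intrN ?real_cN -!pmulrn -natC. Qed.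

(** No integer translate of u is a pole of Gamma. *)
Definition nonint u := forall n : int, n%:~R + u != 0.

Lemma nonint_pole u n : nonint u -> nonpole (n%:~R + u).
Proof.
by move=> h k; rewrite addrAC -[k%:R]/(k%:Z%:~R) -intrD; exact: h.
Qed.

Lemma nonint_pole' u n : nonint u -> nonpole (1 - (n%:~R + u)).
Proof.
move=> h k; have := h (n - 1 - k%:Z); rewrite -oppr_eq0 !intrD !intrN.
by apply: contra_neq => <-; rewrite -[1%:~R]/1 -[k%:~R]/(k%:R); ring.
Qed.

(** Common ground of the two series: in the principal series u and v are
    conjugate, in the complementary series both are real. *)
Definition conj_stable u v := u^*%C = v \/ u^*%C = u /\ v^*%C = v.

Lemma conj_real u : u^*%C = u -> u = (complex.Re u)%:C.
Proof. by case: u => a b [] h; congr (_ +i* _); lra. Qed.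

Lemma gamma_quot_conj s t (h : R) : nonpole s -> nonpole t -> nonpole (s + h%:C) ->
  nonpole (t + h%:C) -> (gamma_quot s t h)^*%C = gamma_quot s^*%C t^*%C h.
Proof.
move=> sp tp sph tph; rewrite /gamma_quot.
have cD (a : C) : (a + h%:C)^*%C = a^*%C + h%:C by rewrite rmorphD; congr (_ + _); exact: conjc_real.
have cM (a b : C) : (a * b)^*%C = a^*%C * b^*%C by exact: rmorphM.
by rewrite !cM conjc_inv cM -!cD !cgamma_conj.
Qed.

Definition sine_factor z z' : C := csin ((pi : R)%:C * z) * csin ((pi : R)%:C * z')
    / ((pi : R)%:C * csin ((pi : R)%:C * (z - z'))).

Lemma gamma_arg (x : halfint) (w : C) : (hval R x)%:C + w + 2^-1 = (x + 1)%:~R + w.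
Proof.
have -> : (hval R x)%:C = x%:~R + 2^-1 :> C.
  by rewrite /hval real_cD real_cV -natC -intC.
by rewrite intrD; field.
Qed.

(** Rigidity only involves the product K x y * K y x, in which the square root
    disappears. *)
Lemma kernel_off z z' (x y : halfint) (A B : R) : x != y ->
  let sx := (x + 1)%:~R + z in let tx := (x + 1)%:~R + z' in
  let sy := (y + 1)%:~R + z in let ty := (y + 1)%:~R + z' in
  0 < A -> cgamma sx * cgamma tx = A%:C -> 0 < B -> cgamma sy * cgamma ty = B%:C ->
  let rho := (cgamma sx / cgamma tx) / (cgamma sy / cgamma ty) in
  gamma_kernel_neq z z' x y * gamma_kernel_neq z z' y x =
  sine_factor z z' ^+ 2 * (rho + rho^-1 - 2) / ((x - y)%:~R) ^+ 2.
Proof.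
move=> xy sx tx sy ty A0 hA B0 hB rho.
rewrite /gamma_kernel_neq (negbTE xy) eq_sym (negbTE xy) /gamma_expr -/(sine_factor z z') !gamma_arg.
rewrite -/sx -/tx -/sy -/ty.
have -> : cgamma sy * cgamma ty * cgamma sx * cgamma tx =
   cgamma sx * cgamma tx * cgamma sy * cgamma ty by ring.
have AC : A%:C != 0 :> C by rewrite -normc_gt0 normc_real normr_gt0 gt_eqF.
have BC : B%:C != 0 :> C by rewrite -normc_gt0 normc_real normr_gt0 gt_eqF.
move: (AC) (BC); rewrite -hA -hB !mulf_eq0 !negb_or => /andP[h1 h2] /andP[h3 h4].
set W := sqrtC _.
have W2 : W ^+ 2 = cgamma sx * cgamma tx * cgamma sy * cgamma ty by rewrite sqrtCK.
have W0 : W != 0 by rewrite -sqrf_eq0 W2 !mulf_eq0 !negb_or h1 h2 h3 h4.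
have D (a b : halfint) : (hval R a - hval R b)%:C = (a - b)%:~R :> C.
  by rewrite /hval opprD addrACA subrr addr0 -intrB -intC.
rewrite !D; have -> : (y - x)%:~R = - (x - y)%:~R :> C by rewrite -intrN opprB.
have D0 : (x - y)%:~R != 0 :> C by rewrite intr_eq0 subr_eq0.
move: (x - y)%:~R D0 => d D0.
transitivity (sine_factor z z' ^+ 2 * (W ^+ 2)^-1 *
   ((cgamma sx * cgamma ty - cgamma tx * cgamma sy) / d) ^+ 2).
  by field; rewrite ?W0 ?D0.
rewrite W2 /rho; field.
by rewrite ?h1 ?h2 ?h3 ?h4 ?D0.
Qed.

Lemma kernel_diag z z' (x : halfint) (A : R) :
  let s := (x + 1)%:~R + z in let t := (x + 1)%:~R + z' in
  nonpole s -> nonpole t -> conj_stable s t -> 0 < A -> cgamma s * cgamma t = A%:C ->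
  gamma_kernel_neq z z' x x = sine_factor z z' * ((z - z') * invsum s t).
Proof.
move=> s t sp tp sc A0 hA; rewrite /gamma_kernel_neq eqxx.
have hv h : nonpole (s + h%:C) -> nonpole (t + h%:C) -> nonpole (1 + h%:C) ->
    exists v : R, gamma_quot s 1 h * gamma_quot t 1 h = v%:C.
  move=> sh th h1; exists (complex.Re (gamma_quot s 1 h * gamma_quot t 1 h)).
  apply: conj_real; rewrite rmorphM/= !gamma_quot_conj ?conjc1//; try exact: nonpole1.
  case: sc => [st|[-> ->]//]; have ts : t^*%C = s by rewrite -st conjcK.
  by rewrite st ts mulrC.
have L := gamma_diag_limit (hval R x) sp tp (invsum_tends sp tp) A0 hA hv.
have -> : z - z' = s - t by rewrite /s /t; ring.
suff T : tends (hval R x)^' (gamma_expr z z' (hval R x)) (sine_factor z z' * ((s - t) * invsum s t)).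
  exact: (tends_lim T).
apply: (tends_ext _ (tendsM (tends_cst (sine_factor z z')) L)); apply: nearW => u.
rewrite /gamma_expr -/(sine_factor z z') !gamma_arg -/s -/t.
have E w : u%:C + w + 2^-1 = (x + 1)%:~R + w + (u - hval R x)%:C.
  by rewrite -gamma_arg real_cB; ring.
rewrite !E -[RHS]mulrA; reflexivity.
Qed.

End kernel_values.

(** * The partial fractions of the cotangent *)

Section cexp_bounds.
Variable R : realType.
Local Notation C := (R[i]).
Local Notation pi := (@pi R).
Implicit Types (s t u v z w X Y : C).

Lemma sin_ge_quarter (w : R) : 0 <= w <= pi / 2 -> w / 4 <= sin w.
Proof.
move=> /andP[w0 wp]; have p2 := @pihalf_lt2 R; have [c /andP[c0 cw] sE] := sin_mvt w0.
have s0 : 0 <= sin w.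
  by apply: sin_ge0_pi; rewrite w0 (le_trans wp)// ler_pdivrMr// ler_peMr ?pi_ge0// ler1n.
have wpi : w <= pi by rewrite (le_trans wp)// ler_pdivrMr// ler_peMr ?pi_ge0// ler1n.
have cc : cos w <= cos c.
  move: cw; rewrite le_eqVlt => /orP[/eqP -> //|cw].
  by rewrite ltW// ltr_cos// in_itv/= ?c0 ?w0//= (le_trans (ltW cw)).
have [h|h] := leP (1 / 4) (cos w).
  by rewrite sE ler_wpM2l//; move: h cc; move: (cos w) (cos c) => a b; lra.
have cw0 : 0 <= cos w.
  by apply: cos_ge0_pihalf; rewrite wp andbT (le_trans _ w0)// oppr_le0 divr_ge0// pi_ge0.
have := cos2Dsin2 w; move: (cos w) (sin w) cw0 s0 h => a b cw0 s0 h e; nra.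
Qed.

Lemma one_sub_cos_ge (x : R) : `|x| <= pi -> x ^+ 2 / 32 <= 1 - cos x.
Proof.
wlog x0 : x / 0 <= x.
  move=> h; have [/h//|/ltW x0] := leP 0 x.
  by have := h (- x); rewrite oppr_ge0 normrN sqrrN cosN; apply.
rewrite ger0_norm// => xp; rewrite one_sub_cos.
have := @sin_ge_quarter (x / 2); rewrite divr_ge0// ler_pM2r ?invr_gt0// xp => /(_ isT).
by move: (sin _) => s h; nra.
Qed.

Lemma expR_sub1_ge (a A : R) : `|a| <= A -> a ^+ 2 * expR (- A) ^+ 2 <= (expR a - 1) ^+ 2.
Proof.
move=> aA; have e0 := expR_gt0 (- A).
have e1 : expR (- A) <= 1 by rewrite -expR0 ler_expR oppr_le0 (le_trans _ aA).
have [a0|a0] := leP 0 a.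
  have := expR_ge1Dx a; move: (expR a) (expR (- A)) e0 e1 => u v e0 e1 h.
  apply: (@le_trans _ _ (a ^+ 2)); first by rewrite ler_piMr ?sqr_ge0// exprn_ile1// ltW.
  by rewrite ler_pXn2r ?nnegrE//; move: a0 h; lra.
have h := expR_ge1Dx (- a).
have h2 : expR a * expR (- a) = 1 by rewrite -expRD subrr expR0.
have h3 : expR (- A) <= expR a by rewrite ler_expR; move: aA; rewrite ler_norml => /andP[].
have ea := expR_gt0 a; have a1 : expR a < 1 by rewrite -expR0 ltr_expR.
have L : - a * expR (- A) <= 1 - expR a.
  apply: (@le_trans _ _ (- a * expR a)); first by rewrite ler_wpM2l// oppr_ge0 ltW.
  have -> : 1 - expR a = expR a * (expR (- a) - 1) by rewrite mulrBr mulr1 h2.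
  rewrite mulrC; apply: ler_wpM2l; first exact: ltW.
  by move: h; lra.
rewrite (_ : _ * _ = (- a * expR (- A)) ^+ 2); last by ring.
rewrite (_ : (expR a - 1) ^+ 2 = (1 - expR a) ^+ 2); last by ring.
have L0 : 0 <= - a * expR (- A) by rewrite mulr_ge0 ?oppr_ge0// ltW.
by rewrite ler_pXn2r ?nnegrE// subr_ge0 ltW.
Qed.

Lemma normc_sqr X : normc X ^+ 2 = complex.Re X ^+ 2 + complex.Im X ^+ 2.
Proof. by case: X => a b; rewrite /normc sqr_sqrtr// addr_ge0// sqr_ge0. Qed.

(** For X = a + ib, |1 - exp X|^2 = (exp a - 1)^2 + 2 exp a (1 - cos b), and 1
    - cos b is comparable to b^2 as long as |b| <= pi. *)
Lemma cexp_sub1_ge (A : R) : exists2 c, 0 < c & forall X, `|complex.Re X| <= A ->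
  `|complex.Im X| <= pi -> c * normc X <= normc (1 - cexp X).
Proof.
have e0 := expR_gt0 (- A); pose c := expR (- A) / 16.
exists (Num.min (expR (- A)) c) => [|[a b] aA bp].
  by rewrite lt_min e0 divr_gt0.
have A0 : 0 <= A by exact: le_trans (normr_ge0 _) aA.
have e1 : expR (- A) <= 1 by rewrite -expR0 ler_expR oppr_le0.
have hm : Num.min (expR (- A)) c <= c by rewrite ge_min lexx orbT.
have m0 : 0 <= Num.min (expR (- A)) c by rewrite le_min !ltW ?divr_gt0.
apply: (@le_trans _ _ (c * normc (a +i* b))); first by rewrite ler_wpM2r ?normc_ge0.
have c0 : 0 <= c by rewrite divr_ge0// ltW.
rewrite -(@ler_pXn2r _ 2) ?nnegrE ?normc_ge0// ?mulr_ge0 ?normc_ge0//.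
have RE : complex.Re (1 - cexp (a +i* b)) = 1 - expR a * cos b.
  by rewrite /cexp /=; ring.
have IE : complex.Im (1 - cexp (a +i* b)) = - (expR a * sin b).
  by rewrite /cexp /=; ring.
rewrite /= in aA bp; rewrite exprMn !normc_sqr RE IE /=.
have h1 := expR_sub1_ge aA; have h2 := one_sub_cos_ge bp.
have h3 : expR (- A) <= expR a by rewrite ler_expR; move: aA; rewrite ler_norml => /andP[].
have h4 := cos2Dsin2 b.
rewrite (_ : (1 - _) ^+ 2 + _ = (expR a - 1) ^+ 2 + 2 * expR a * (1 - cos b)); last first.
  apply/eqP; rewrite -subr_eq0; apply/eqP.
  transitivity (expR a ^+ 2 * (cos b ^+ 2 + sin b ^+ 2 - 1)); first by ring.
  by rewrite h4 subrr mulr0.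
move: h1 h2 h3 e0 e1; rewrite /c; move: (expR (- A)) (expR a) (cos b) => u v k h1 h2 h3 e0 e1.
have : a ^+ 2 * u ^+ 2 / 256 <= a ^+ 2 * u ^+ 2.
  have : 0 <= a ^+ 2 * u ^+ 2 by rewrite mulr_ge0 ?sqr_ge0.
  by lra.
have : b ^+ 2 * (u ^+ 2 / 256) <= 2 * v * (1 - k).
  apply: (@le_trans _ _ (2 * v * (b ^+ 2 / 32))); last first.
    by rewrite ler_wpM2l// mulr_ge0// (le_trans (ltW e0)).
  rewrite (_ : 2 * v * _ = b ^+ 2 * (v / 16)); last by field.
  by rewrite ler_wpM2l ?sqr_ge0//; nra.
by rewrite expr_div_n; nra.
Qed.

Lemma cexp_diff_le (A : R) : exists2 c, 0 < c & forall X Y, `|complex.Re Y| <= A ->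
  normc (X - Y) <= 1 / 2 -> normc (cexp X - cexp Y) <= c * normc (X - Y).
Proof.
exists (7 * expR A) => [|X Y YA XY]; first by rewrite mulr_gt0 ?expR_gt0.
have -> : cexp X - cexp Y = cexp Y * ((cexp (X - Y) - 1 - (X - Y)) + (X - Y)).
  by rewrite (subrK (X - Y)) mulrBr mulr1 -cexpD [Y + _]addrC (subrK Y).
rewrite normcM normc_cexp (mulrC 7) -mulrA.
apply: ler_pM; rewrite ?expR_ge0 ?normc_ge0//.
  by rewrite ler_expR; move: YA; rewrite ler_norml => /andP[].
apply: (le_trans (ler_normcD _ _)); have := cexp_sub_le XY.
by have := normc_ge0 (X - Y); move: XY; move: (normc (X - Y)) (normc (_ - _)) => x y; nra.
Qed.

(** Dominated convergence for sums of growing length whose value does not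
    change. *)
Lemma tannery (F : nat -> nat -> C) (G : nat -> C) (K : C) (B : R) (n0 : nat) : 0 <= B ->
  (forall n, (n0 <= n)%N -> \sum_(0 <= i < 2 ^ n) F n i = K) ->
  (forall n i, (n0 <= n)%N -> (i < 2 ^ n)%N -> normc (F n i) <= B / i.+1%:R ^+ 2) ->
  (forall i, tends \oo (F ^~ i) (G i)) ->
  tends \oo (fun m => \sum_(0 <= i < m) G i) K.
Proof.
move=> B0 hK hB hG.
have P m : (0 < m)%N -> normc (\sum_(0 <= i < m) G i - K) <= B / m%:R.
  move=> m0.
  have T : tends \oo (fun n => \sum_(0 <= i < m) F n i - K) (\sum_(0 <= i < m) G i - K).
    apply: tendsB; last exact: tends_cst.
    elim: m {m0} => [|m IH].
      rewrite big_geq//; apply: (tends_ext _ (tends_cst 0)).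
      by apply: nearW => n; rewrite big_geq.
    rewrite big_nat_recr//=; apply: (tends_ext _ (tendsD IH (hG m))).
    by apply: nearW => n; rewrite big_nat_recr.
  have T' : (fun n => normc (\sum_(0 <= i < m) F n i - K)) @ \oo --> normc (\sum_(0 <= i < m) G i - K).
    exact: (tends_normc T).
  rewrite -(cvg_lim _ T')//; apply: limr_le; first exact: (cvgP _ T').
  exists (maxn n0 m) => // n /=; rewrite geq_max => /andP[nn mn].
  have m2 : (m <= 2 ^ n)%N by rewrite (leq_trans mn)// ltnW// ltn_expl.
  rewrite -(hK n nn) normcB_sym (big_cat_nat (n := m))//= addrAC subrr add0r.
  apply: (le_trans (ler_normc_sum _ _)).
  rewrite -{1}(add0n m) big_addn.
  apply: (@le_trans _ _ (\sum_(0 <= i < 2 ^ n - m) B * ((m + i).+1%:R ^+ 2)^-1)).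
    apply: ler_sum_nat => i /andP[_ i2]; rewrite addnC; apply: hB => //.
    by move: i2; rewrite ltn_subRL.
  by rewrite -big_distrr/= ler_wpM2l// sum_inv_sqr_tail.
apply: tendsS; apply: (@tends_squeeze _ _ _ _ _ (fun m => B * m.+1%:R^-1)).
  by apply: nearW => m; exact: P.
by rewrite -[0](mulr0 B); apply: cvgMr; exact: cvg_harmonic.
Qed.

Lemma tends_resolvent (h : nat -> C) s : s != 0 -> tends \oo h 0 -> (forall n, h n != 0) ->
  tends \oo (fun n => h n / (1 - cexp (h n * s))) (- s^-1).
Proof.
move=> s0 h0 hn.
have T : tends \oo (fun n => (1 - cexp (h n * s)) / h n) (- s).
  have hs : tends \oo (fun n => h n * s) 0.
    by rewrite -[0](mul0r s); exact: (tendsM h0 (tends_cst s)).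
  have nh : normc (h n) @[n --> \oo] --> 0.
    by have := h0; rewrite /tends; under eq_fun do rewrite subr0.
  have nhs : normc (h n * s) @[n --> \oo] --> 0.
    by have := hs; rewrite /tends; under eq_fun do rewrite subr0.
  apply: (@tends_squeeze _ _ _ _ _ (fun n => 12 * normc s ^+ 2 * normc (h n))).
    have /cvgrPdist_le/(_ (1 / 2)) := nhs; rewrite divr_gt0// => /(_ isT).
    apply: filterS => n; rewrite sub0r normrN ger0_norm ?normc_ge0// => hs2.
    have := cexp_sub_le hs2.
    rewrite (_ : _ / _ - _ = - (cexp (h n * s) - 1 - h n * s) / h n); last first.
      by have := hn n; move: (cexp _) => e hn0; field.
    rewrite [normc (- _ / _)]normcM normcV normcN ler_pdivrMr ?normc_gt0//; move/le_trans; apply.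
    rewrite normcM; have := normc_ge0 (h n); have := normc_ge0 s.
    by move: (normc _) (normc _) => x y x0 y0; rewrite le_eqVlt; apply/orP; left; apply/eqP; ring.
  rewrite -[0](mulr0 (12 * normc s ^+ 2)); exact: cvgMr.
rewrite -invrN; apply: (tends_ext _ (tendsV _ T)); last by rewrite oppr_eq0.
by apply: nearW => n; rewrite invf_div.
Qed.

End cexp_bounds.

Section cotangent.
Variable R : realType.
Local Notation C := (R[i]).
Local Notation pi := (@pi R).
Implicit Types (s t u v z w X Y : C).

(** The period 2 pi i of the exponential. *)
Definition tau : C := (2 * pi)%:C * 'i%C.

Lemma tauM s : tau * s = (- (2 * pi * complex.Im s)) +i* (2 * pi * complex.Re s).
Proof.
case: s => a b; apply/eqP; rewrite eq_complex /tau /=; apply/andP; split; apply/eqP; ring.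
Qed.

Lemma cexp_tau : cexp tau = 1.
Proof.
have -> : tau = 0 +i* (pi *+ 2).
  by apply/eqP; rewrite eq_complex /tau /= mulr2n; apply/andP; split; apply/eqP; ring.
by rewrite /cexp /= expR0 cos2pi sin2pi mul1r.
Qed.

Lemma cexp_tau_nat (m : nat) : cexp (tau * m%:R) = 1.
Proof.
elim: m => [|m IH]; first by rewrite mulr0 cexp0.
by rewrite -natr1 mulrDr cexpD IH mulr1 cexp_tau mul1r.
Qed.

Lemma cexp_tau_int (m : int) : cexp (tau * m%:~R) = 1.
Proof.
case: m => m; first exact: cexp_tau_nat.
by rewrite NegzE intrN mulrN cexpN cexp_tau_nat invr1.
Qed.

Lemma cexp_half_tau : cexp (tau / 2) = -1.
Proof.
have -> : tau / 2 = 0 +i* pi.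
  suff -> : tau = (0 +i* pi) * 2 by rewrite mulfK// pnatr_eq0.
  by apply/eqP; rewrite eq_complex /tau natC /=; apply/andP; split; apply/eqP; ring.
by rewrite /cexp /= expR0 cospi sinpi mul1r; apply/eqP; rewrite eq_complex /= oppr0 !eqxx.
Qed.

Lemma cexp_tau_neq1 z : 0 <= complex.Re z < 1 -> z != 0 -> cexp (tau * z) != 1.
Proof.
case: z => a b /= /andP[a0 a1] z0; apply/eqP => h.
have h1 : expR (- (2 * pi * b)) = 1.
  have := congr1 (@normc R) h; rewrite normc_cexp tauM (_ : 1 = 1%:C)// normc_real normr1.
  exact.
have b0 : b = 0.
  have : - (2 * pi * b) = 0 by apply: (@expR_inj R); rewrite h1 expR0.
  by move/eqP; rewrite oppr_eq0 mulf_eq0 mulf_eq0 (gt_eqF (pi_gt0 R)) pnatr_eq0/= => /eqP.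
have := congr1 (@complex.Re R) h; rewrite tauM /cexp /= b0 mulr0 oppr0 expR0 mul1r mul0r subr0 => c1.
have := one_sub_cos (2 * pi * a); rewrite c1 subrr => /esym/eqP.
rewrite mulf_eq0 pnatr_eq0/= expf_eq0/= => /eqP s0.
have [a00|a00] := eqVneq a 0; first by move: z0; rewrite a00 b0 eqxx.
have : 0 < sin (pi * a).
  apply: sin_gt0_pi; apply/andP; split; first by rewrite mulr_gt0 ?pi_gt0// lt_neqAle eq_sym a00.
  by rewrite -[ltRHS]mulr1 ltr_pM2l ?pi_gt0.
by rewrite (_ : pi * a = 2 * pi * a / 2) ?s0 ?ltxx//; field.
Qed.

Definition mesh (n : nat) : C := tau / (2 ^ n)%:R.

Lemma pow2_neq0 n : (2 ^ n)%:R != 0 :> C.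
Proof. by rewrite pnatr_eq0 expn_eq0. Qed.

(** Since 1/(1 - w) + 1/(1 + w) = 2/(1 - w^2), passing from 2^n to 2^(n+1)
    roots of unity doubles the sum. *)
Lemma resolvent_sum n z : cexp (tau * z) != 1 ->
  \sum_(0 <= k < 2 ^ n) (1 - cexp (mesh n * (z + k%:R)))^-1 = (2 ^ n)%:R / (1 - cexp (tau * z)).
Proof.
move=> z1; elim: n => [|n IH].
  by rewrite big_nat1 /mesh divr1 addr0 mul1r.
have wE (k : nat) : mesh n.+1 * (z + k%:R + (2 ^ n)%:R) = mesh n.+1 * (z + k%:R) + tau / 2.
  by rewrite /mesh expnS natrM; have := pow2_neq0 n; move: (_%:R : C) => p p0; field.
rewrite [in LHS]expnS mul2n -addnn (big_cat_nat (n := 2 ^ n)) ?leq_addr//=.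
rewrite -{2}(add0n (2 ^ n)%N) big_addn addnK -big_split/=.
have -> : (2 ^ n.+1)%:R / (1 - cexp (tau * z)) = 2 * ((2 ^ n)%:R / (1 - cexp (tau * z))).
  by rewrite expnS natrM mulrA.
rewrite -IH big_distrr; apply: eq_bigr => k _ /=.
rewrite natrD addrA wE cexpD cexp_half_tau mulrN1 opprK.
have -> : mesh n * (z + k%:R) = mesh n.+1 * (z + k%:R) + mesh n.+1 * (z + k%:R).
  by rewrite /mesh expnS natrM; have := pow2_neq0 n; move: (_%:R : C) => p p0; field.
have h : cexp (mesh n.+1 * (z + k%:R) + mesh n.+1 * (z + k%:R)) != 1.
  apply: contra_neq z1 => h.
  have P (m : nat) w : cexp w = 1 -> cexp (w * m%:R) = 1.
    move=> w1; elim: m => [|m IHm]; first by rewrite mulr0 cexp0.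
    by rewrite -natr1 mulrDr mulr1 cexpD IHm w1 mulr1.
  have := P (2 ^ n)%N _ h.
  rewrite (_ : _ * _ = tau * z + tau * k%:R).
    by rewrite cexpD cexp_tau_nat mulr1.
  by rewrite /mesh expnS natrM; have := pow2_neq0 n; move: (_%:R : C) => p p0; field.
rewrite cexpD in h *; move: (cexp _) h => w h.
have h1 : 1 - w != 0 by apply: contra_neq h => /eqP; rewrite subr_eq0 => /eqP <-; rewrite mulr1.
have h2 : 1 + w != 0.
  by apply: contra_neq h => /eqP; rewrite addrC addr_eq0 => /eqP ->; rewrite mulrNN mulr1.
have h3 : 1 - w * w != 0 by rewrite subr_eq0 eq_sym.
by field; rewrite ?h1 ?h2 ?h3.
Qed.

Lemma resolvent_sum_sym n z : cexp (tau * z) != 1 ->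
  \sum_(0 <= i < 2 ^ n) ((1 - cexp (mesh n.+1 * (z + i%:R)))^-1 +
    (1 - cexp (mesh n.+1 * (z - 1 - i%:R)))^-1) = (2 ^ n.+1)%:R / (1 - cexp (tau * z)).
Proof.
move=> z1; have E : cexp (tau * (z - (2 ^ n)%:R)) = cexp (tau * z).
  by rewrite mulrBr cexpD cexpN cexp_tau_nat invr1 mulr1.
rewrite -E -resolvent_sum ?E//.
have -> : (2 ^ n.+1 = 2 ^ n + 2 ^ n)%N by rewrite expnS mul2n addnn.
rewrite [RHS](big_cat_nat (n := 2 ^ n)) ?leq_addr//=.
rewrite -[X in _ = _ + \sum_(X <= _ < _) _](add0n (2 ^ n)%N) big_addn addnK big_split/= addrC.
congr (_ + _).
  rewrite [RHS]big_nat_rev; apply: eq_big_nat => i /andP[_ i2].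
  congr (1 - cexp (_ * _))^-1; have -> : (2 ^ n)%:R = (2 ^ n - i.+1)%:R + i.+1%:R :> C.
    by rewrite -natrD subnK.
  by rewrite add0n -[i.+1%:R]natr1; ring.
by apply: eq_bigr => i _; rewrite natrD; congr (1 - cexp (_ * _))^-1; ring.
Qed.

Let eta (n : nat) : R := 2 * pi / (2 ^ n)%:R.

Lemma eta_gt0 n : 0 < eta n.
Proof. by rewrite divr_gt0 ?mulr_gt0 ?pi_gt0// ltr0n expn_gt0. Qed.

Lemma meshM n s : mesh n * s = (- (eta n * complex.Im s)) +i* (eta n * complex.Re s).
Proof.
rewrite /mesh natC -real_cV /eta; case: s => a b.
by apply/eqP; rewrite eq_complex /tau /=; apply/andP; split; apply/eqP; ring.
Qed.

Lemma normc_mesh n : normc (mesh n) = eta n.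
Proof.
rewrite -[mesh n]mulr1 meshM /= mulr0 oppr0 mulr1 expr0n/= add0r sqrtr_sqr ger0_norm//.
exact/ltW/eta_gt0.
Qed.

(** A difference of two resolvents gains a factor |exp X - exp Y|, of the
    order of the mesh, and its denominators are at least a multiple of the
    mesh times the moduli of s and s'. *)
Lemma resolvent_diff_bound z z' (A d e : R) : 0 < d -> 0 < e -> exists2 B, 0 <= B &
  exists n0, forall n s s' (i : nat), (n0 <= n)%N -> s - s' = z - z' ->
    `|complex.Im s| <= A -> `|complex.Im s'| <= A ->
    `|complex.Re s| <= (2 ^ n)%:R -> `|complex.Re s'| <= (2 ^ n)%:R ->
    d * i.+1%:R <= normc s -> e * i.+1%:R <= normc s' ->
    normc (mesh n.+1 * ((1 - cexp (mesh n.+1 * s))^-1 - (1 - cexp (mesh n.+1 * s'))^-1))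
      <= B / i.+1%:R ^+ 2.
Proof.
move=> d0 e0.
have [c1 c10 H1] := cexp_sub1_ge (2 * pi * A).
have [c2 c20 H2] := cexp_diff_le (2 * pi * A).
pose D := normc (z - z'); have D0 : 0 <= D by exact: normc_ge0.
exists (c2 * D / (c1 ^+ 2 * d * e)).
  by rewrite divr_ge0 ?mulr_ge0// ?exprn_ge0// ltW.
exists (Num.trunc (4 * pi * D)).+1 => n s s' i n0 ss' A1 A2 R1 R2 hd he.
have h0 := eta_gt0 n.+1; have p0 := pi_gt0 R.
have h1 : eta n.+1 <= 2 * pi.
  have : 1 <= (2 ^ n.+1)%:R :> R by rewrite ler1n expn_gt0.
  by rewrite ler_pdivrMr ?ltr0n ?expn_gt0//; move: (_%:R) => p p1; nra.
have hpi : eta n.+1 * (2 ^ n)%:R = pi.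
  rewrite /eta expnS natrM; have : (2 ^ n)%:R != 0 :> R by rewrite pnatr_eq0 expn_eq0.
  by move: (_%:R) => p pn; field.
have hD : eta n.+1 * D <= 1 / 2.
  rewrite /eta mulrAC ler_pdivrMr ?ltr0n ?expn_gt0// expnS natrM.
  have : 4 * pi * D <= (2 ^ n)%:R.
    apply: (le_trans (ltW (truncnS_gt _))); rewrite ler_nat.
    by rewrite (leq_trans n0)// ltnW// ltn_expl.
  by have := mulr_ge0 (ltW p0) D0; move: ((2 ^ n)%:R : R) => p; lra.
have LB u b : 0 < b -> `|complex.Im u| <= A -> `|complex.Re u| <= (2 ^ n)%:R -> b * i.+1%:R <= normc u ->
    c1 * (eta n.+1 * (b * i.+1%:R)) <= normc (1 - cexp (mesh n.+1 * u)).
  move=> b0 uA uR ub; apply: le_trans (H1 _ _ _).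
  - by rewrite normcM normc_mesh ler_pM2l// ler_pM2l.
  - by rewrite meshM /= normrN normrM gtr0_norm// ler_pM// ltW.
  - by rewrite meshM /= normrM gtr0_norm// -hpi ler_pM2l.
have UB : normc (cexp (mesh n.+1 * s) - cexp (mesh n.+1 * s')) <= c2 * (eta n.+1 * D).
  have E : normc (mesh n.+1 * s - mesh n.+1 * s') = eta n.+1 * D.
    by rewrite -mulrBr normcM normc_mesh ss'.
  rewrite -E; apply: H2; last by rewrite E.
  by rewrite meshM /= normrN normrM gtr0_norm// ler_pM// ltW.
have := LB s d d0 A1 R1 hd; have := LB s' e e0 A2 R2 he.
move: UB; move: (cexp _) (cexp _) => E' E UB L2 L1.
have P b : 0 < b -> 0 < c1 * (eta n.+1 * (b * i.+1%:R)) by move=> b0; rewrite !mulr_gt0.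
have E1 : 1 - E != 0 by rewrite -normc_gt0 (lt_le_trans _ L1)// P.
have E2 : 1 - E' != 0 by rewrite -normc_gt0 (lt_le_trans _ L2)// P.
rewrite (_ : _ - _ = (E - E') / ((1 - E) * (1 - E'))); last by field; rewrite E1 E2.
rewrite normcM normc_mesh normcM normcV normcM.
apply: (@le_trans _ _ (eta n.+1 * (c2 * (eta n.+1 * D) *
   ((c1 * (eta n.+1 * (d * i.+1%:R))) * (c1 * (eta n.+1 * (e * i.+1%:R))))^-1))).
  rewrite ler_pM2l//; apply: ler_pM; rewrite ?normc_ge0 ?invr_ge0 ?mulr_ge0 ?normc_ge0//.
  by rewrite lef_pV2 ?posrE ?mulr_gt0 ?normc_gt0// ?P//; apply: ler_pM => //; apply/ltW/P.
rewrite le_eqVlt; apply/orP; left; apply/eqP; field.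
by rewrite !gt_eqF.
Qed.

Lemma Re_addn z (k : nat) : complex.Re (z + k%:R) = complex.Re z + k%:R.
Proof. by rewrite natC; case: z. Qed.

Lemma Im_addn z (k : nat) : complex.Im (z + k%:R) = complex.Im z.
Proof. by rewrite natC; case: z => a b /=; rewrite addr0. Qed.

Lemma Re_subn z (k : nat) : complex.Re (z - k%:R) = complex.Re z - k%:R.
Proof. by rewrite natC; case: z. Qed.

Lemma Im_subn z (k : nat) : complex.Im (z - k%:R) = complex.Im z.
Proof. by rewrite natC; case: z => a b /=; rewrite oppr0 addr0. Qed.

(** Mesh times resolvent at z + j tends to - 1 / (z + j) as the mesh tends to
    0; the difference at two points is summable in j uniformly in the mesh, so
    the exact value of the sum over roots of unity passes to the limit. *)
Lemma cotangent_series z z' : nonint z -> nonint z' -> 0 <= complex.Re z < 1 ->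
  0 <= complex.Re z' < 1 ->
  (z - z') * (invsum z z' + invsum (1 - z) (1 - z')) =
  tau * ((1 - cexp (tau * z))^-1 - (1 - cexp (tau * z'))^-1).
Proof.
move=> zi zi' z01 z01'; pose A := `|complex.Im z| + `|complex.Im z'|.
have np u : nonint u -> nonpole u by move=> ui; rewrite -[u]add0r; exact: (nonint_pole 0).
have np' u : nonint u -> nonpole (1 - u).
  by move=> ui; rewrite -[u]add0r; exact: (nonint_pole' 0).
have n0 u : nonint u -> u != 0 by move=> /(_ 0); rewrite add0r.
have [d1 d10 D1] := lower_linear (np _ zi); have [e1 e10 E1] := lower_linear (np _ zi').
have [d2 d20 D2] := lower_linear (np' _ zi); have [e2 e20 E2] := lower_linear (np' _ zi').
have [B1 B10 [n1 H1]] := @resolvent_diff_bound z z' A d1 e1 d10 e10.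
have [B2 B20 [n2 H2]] := @resolvent_diff_bound z z' A d2 e2 d20 e20.
pose f n s := (1 - cexp (mesh n.+1 * s))^-1.
(* The indices i and - (i + 1) are summed together; this keeps the arguments
   within the strip where the resolvent is bounded. *)
pose F n (i : nat) := mesh n.+1 * (f n (z + i%:R) - f n (z' + i%:R)) +
   mesh n.+1 * (f n (z - i.+1%:R) - f n (z' - i.+1%:R)).
pose G (i : nat) := (z - z') * inv_term z z' i + (z - z') * inv_term (1 - z) (1 - z') i.
have refl u (i : nat) : 1 - u + i%:R = - (u - i.+1%:R) by rewrite -natr1; ring.
have T : tends \oo (fun m => \sum_(0 <= i < m) G i)
    (tau * ((1 - cexp (tau * z))^-1 - (1 - cexp (tau * z'))^-1)).
  apply: (@tannery _ F G _ (B1 + B2) (maxn n1 n2)); first by rewrite addr_ge0.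
  - move=> n _; rewrite /F.
    have S u (u01 : 0 <= complex.Re u < 1) (ui : nonint u) :=
      resolvent_sum_sym n (cexp_tau_neq1 u01 (n0 _ ui)).
    have Sz := S z z01 zi; have Sz' := S z' z01' zi'.
    transitivity (mesh n.+1 * ((2 ^ n.+1)%:R / (1 - cexp (tau * z)) - (2 ^ n.+1)%:R / (1 - cexp (tau * z')))).
      rewrite -Sz -Sz' -sumrB big_distrr; apply: eq_bigr => i _ /=.
      have Ei u : u - i.+1%:R = u - 1 - i%:R by rewrite -natr1; ring.
      by rewrite /f !Ei; ring.
    by rewrite -mulrBr mulrA /mesh divfK// pow2_neq0.
  - move=> n i; rewrite geq_max => /andP[nn1 nn2] i2.
    have i2' : i.+1%:R <= (2 ^ n)%:R :> R by rewrite ler_nat.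
    have zA : `|complex.Im z| <= A by rewrite lerDl.
    have zA' : `|complex.Im z'| <= A by rewrite lerDr.
    have Rb u : 0 <= complex.Re u < 1 -> `|complex.Re u + i%:R| <= (2 ^ n)%:R /\
        `|complex.Re u - i.+1%:R| <= (2 ^ n)%:R.
      have i0 : 0 <= i%:R :> R by [].
      move=> /andP[u0 u1]; move: i2'; rewrite -(natr1 i) => i2'.
      by split; rewrite ler_norml; apply/andP; split; lra.
    have [Ra Rb1] := Rb _ z01; have [Ra' Rb1'] := Rb _ z01'.
    rewrite /F mulrDl; apply: (le_trans (ler_normcD _ _)); apply: lerD.
      by apply: H1; rewrite ?Re_addn ?Im_addn//; ring.
    apply: H2; rewrite ?Re_subn ?Im_subn//; first by ring.
      by rewrite -normcN -refl.
    by rewrite -normcN -refl.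
  - move=> i; have st0 : tends \oo (fun n => mesh n.+1) 0.
      apply: (@tends_squeeze _ _ _ _ _ (fun n => 2 * pi * n.+1%:R^-1)).
        apply: nearW => n; rewrite subr0 normc_mesh /eta ler_pM2l ?mulr_gt0 ?pi_gt0//.
        by rewrite lef_pV2 ?posrE ?ltr0n ?expn_gt0// ler_nat ltnW// ltn_expl.
      by rewrite -[0](mulr0 (2 * pi)); apply: cvgMr; exact: cvg_harmonic.
    have stn n : mesh n.+1 != 0 by rewrite -normc_gt0 normc_mesh eta_gt0.
    have L s : s != 0 -> tends \oo (fun n => mesh n.+1 * f n s) (- s^-1).
      by move=> s0; exact: (tends_resolvent s0 st0 stn).
    have za u : nonint u -> u + i%:R != 0 by move=> ui; have := ui i%:Z; rewrite addrC.
    have zb u : nonint u -> u - i.+1%:R != 0.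
      by move=> ui; have := ui (- i.+1%:Z); rewrite intrN addrC.
    have -> : G i = (- (z + i%:R)^-1 - - (z' + i%:R)^-1) + (- (z - i.+1%:R)^-1 - - (z' - i.+1%:R)^-1).
      rewrite /G /inv_term !refl mulrNN.
      have := za _ zi; have := za _ zi'; have := zb _ zi; have := zb _ zi'.
      have -> : z - z' = (z + i%:R) - (z' + i%:R) by ring.
      rewrite {2}(_ : z + i%:R - (z' + i%:R) = (z - i.+1%:R) - (z' - i.+1%:R)); last by ring.
      move: (z + _) (z' + _) (z - _) (z' - _) => a b c d h1 h2 h3 h4.
      by field; rewrite h1 h2 h3 h4.
    apply: (tends_ext _ (tendsD (tendsB (L _ (za _ zi)) (L _ (za _ zi')))
      (tendsB (L _ (zb _ zi)) (L _ (zb _ zi'))))).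
    by apply: nearW => n; rewrite /F !mulrBr.
have T2 : tends \oo (fun m => \sum_(0 <= i < m) G i)
    ((z - z') * invsum z z' + (z - z') * invsum (1 - z) (1 - z')).
  apply: (tends_ext _ (tendsD
    (tendsM (tends_cst (z - z')) (invsum_tends (np _ zi) (np _ zi')))
    (tendsM (tends_cst (z - z')) (invsum_tends (np' _ zi) (np' _ zi'))))).
  by apply: nearW => m; rewrite big_split/= !big_distrr.
by rewrite mulrDr; exact: (tends_uniq T2 T).
Qed.

End cotangent.

Arguments tau {R}.

(** * The sine factor *)

Section total_mass.
Variable R : realType.
Local Notation C := (R[i]).
Local Notation pi := (@pi R).
Implicit Types (u v z : C).

(** The sum of 1 / ((n + u)(n + v)) over all integers n, cut between -1 and 0.
    *)
Definition total u v : C := invsum u v + invsum (1 - u) (1 - v).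

Lemma csin_half z : csin (pi%:C * z) = (cexp (tau * z / 2) - (cexp (tau * z / 2))^-1) / (2 * 'i%C).
Proof.
rewrite /csin cexpN (_ : 'i%C * (pi%:C * z) = tau * z / 2)//.
by rewrite /tau real_cM -natC; field.
Qed.

(** With U = exp(2 pi i z) and V = exp(2 pi i z'), the factor is (U - 1)(V -
    1) / (2 pi i (U - V)). *)
Lemma sine_factorE z z' : cexp (tau * z) != 1 -> cexp (tau * z') != 1 -> cexp (tau * z) != cexp (tau * z') ->
  sine_factor z z' * (tau * ((1 - cexp (tau * z))^-1 - (1 - cexp (tau * z'))^-1)) = 1.
Proof.
have hh w : cexp (tau * w) = cexp (tau * w / 2) * cexp (tau * w / 2).
  by rewrite -cexpD; congr cexp; field.
rewrite /sine_factor !csin_half.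
have -> : cexp (tau * (z - z') / 2) = cexp (tau * z / 2) / cexp (tau * z' / 2).
  by rewrite -cexpN -cexpD; congr cexp; field.
rewrite !hh; have := cexp_neq0 (tau * z / 2); have := cexp_neq0 (tau * z' / 2).
move: (cexp _) (cexp _) => a b b0 a0 h1 h2 h3.
have i0 : 'i%C != 0 :> C by rewrite eq_complex /= oner_eq0 andbF.
have p0 : pi%:C != 0 :> C by rewrite -normc_gt0 normc_real normr_gt0 gt_eqF// pi_gt0.
have d1 : 1 - a * a != 0 by rewrite subr_eq0 eq_sym.
have d2 : 1 - b * b != 0 by rewrite subr_eq0 eq_sym.
have d3 : a * a - b * b != 0 by rewrite subr_eq0.
have d3' : a * a + - b * b != 0 by rewrite mulNr.
rewrite /tau real_cM -natC; move: (pi%:C) p0 => p p0.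
by field; rewrite ?i0 ?p0 ?d1 ?d2 ?d3' ?a0 ?b0.
Qed.

(** A shift of both parameters by m does not change exp(2 pi i z). The
    statement means that the density of particles tends to 1 at minus
    infinity. *)
Lemma sine_factor_total u v (m : int) : nonint u -> nonint v -> 0 <= complex.Re u < 1 ->
  0 <= complex.Re v < 1 -> u != v -> total u v != 0 ->
  sine_factor (m%:~R + u) (m%:~R + v) * ((u - v) * total u v) = 1.
Proof.
move=> ui vi u01 v01 uv t0; have E (w : C) : cexp (tau * (m%:~R + w)) = cexp (tau * w).
  by rewrite mulrDr cexpD cexp_tau_int mul1r.
have n0 (w : C) : nonint w -> w != 0 by move=> /(_ 0); rewrite add0r.
have h := cotangent_series ui vi u01 v01.
have U1 := cexp_tau_neq1 u01 (n0 _ ui); have V1 := cexp_tau_neq1 v01 (n0 _ vi).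
have UV : cexp (tau * u) != cexp (tau * v).
  apply/eqP => UV; have := h; rewrite UV subrr mulr0 => /eqP.
  by rewrite mulf_eq0 subr_eq0 (negbTE uv) (negbTE t0).
rewrite h -(E u) -(E v); apply: sine_factorE; by rewrite !E.
Qed.

End total_mass.

(** * From the values of the kernel to rigidity *)

Section assembly.
Variable R : realType.
Variables (P : probability (borel_conf R) R) (K : halfint -> halfint -> R[i]).
Hypothesis hP : determinantal P K.
Variables (m : int) (J : int -> int -> R) (k : int -> R).
Hypothesis Kxx : forall x : halfint, K x x = (k (x + 1 + m))%:C.
Hypothesis Kxy : forall x y : halfint, x != y ->
  K x y * K y x = (J (x + 1 + m) (y + 1 + m))%:C.
Hypothesis Jxx : forall x, J x x = 0.

Let idx (x : halfint) : int := x + 1 + m.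
Let site (n : int) : halfint := n - m - 1.

Lemma siteK n : idx (site n) = n.
Proof. by rewrite /idx /site !addrNK. Qed.

Lemma idxK x : site (idx x) = x.
Proof. by rewrite /idx /site !addrK. Qed.

Lemma mean_vacant_k x : mean P (vacant x) = 1 - k (idx x).
Proof. by have [_] := mean_vacant hP x; rewrite Kxx => /(congr1 (@complex.Re R)). Qed.

Lemma mean_vacant2_J x y : x != y -> mean P (fun X => vacant x X * vacant y X) =
  (1 - k (idx x)) * (1 - k (idx y)) - J (idx x) (idx y).
Proof.
by move=> xy; have [_] := mean_vacant2 hP xy; rewrite !Kxx Kxy// => /(congr1 (@complex.Re R)) /= ->; rewrite /idx; ring.
Qed.

Lemma mean_ge0 (f : borel_conf R -> R) : (forall X, 0 <= f X) -> 0 <= mean P f.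
Proof. by move=> f0; apply: Rintegral_ge0 => x _; exact: f0. Qed.

Lemma vacant_ge0 x X : 0 <= vacant x X :> R.
Proof. by rewrite ler0n. Qed.

(** For distinct sites, the right-hand side minus J x y is the probability
    that both sites are empty. *)
Lemma J_le_holes x y : J x y <= (1 - k x) * (1 - k y).
Proof.
rewrite -[x]siteK -[y]siteK; have [->|xy] := eqVneq (site x) (site y).
  by rewrite Jxx -expr2 sqr_ge0.
rewrite -subr_ge0 -mean_vacant2_J//; apply: mean_ge0 => X.
by rewrite mulr_ge0 ?vacant_ge0.
Qed.

Lemma diag_in01 x : 0 <= k x <= 1.
Proof.
rewrite -[x]siteK; have h := mean_vacant_k (site x).
have h0 : 0 <= mean P (vacant (site x)) by apply: mean_ge0 => X; exact: vacant_ge0.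
have h1 : 0 <= mean P ((fun=> 1) \- vacant (site x)).
  by apply: mean_ge0 => X /=; rewrite subr_ge0 /vacant; case: (X _ == _).
have [i1 _] := mean_vacant hP (site x); have [i2 m2] := mean_cst P 1.
have [_ E] := meanB i2 i1; move: h1 h0; rewrite E m2 h.
by move=> h1 h0; apply/andP; split; lra.
Qed.

(** For distinct sites, the right-hand side minus J x y is the mean of the
    product of 1 - vacant at the two sites. *)
Lemma J_le_particles x y : J x y <= k x * k y.
Proof.
rewrite -[x]siteK -[y]siteK; have [->|xy] := eqVneq (site x) (site y).
  by rewrite Jxx -expr2 sqr_ge0.
have [i1 _] := mean_vacant hP (site x); have [i2 _] := mean_vacant hP (site y).
have [i0 m0] := mean_cst P 1; have i12 := integrable_vacant2 hP (site x) (site y).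
have [i3 E1] := meanB i0 i1; have [i4 E2] := meanB i3 i2; have [i5 E3] := meanD i4 i12.
have : 0 <= mean P ((((fun=> 1) \- vacant (site x)) \- vacant (site y)) \+ (fun X => vacant (site x) X * vacant (site y) X)).
  apply: mean_ge0 => X /=; rewrite (_ : _ + _ = (1 - vacant (site x) X) * (1 - vacant (site y) X)).
    by rewrite mulr_ge0// subr_ge0 /vacant; case: (X _ == _).
  by ring.
rewrite E3 E2 E1 m0 !mean_vacant_k mean_vacant2_J//.
by move: (k _) (k _) (J _ _) => a b c; lra.
Qed.

Lemma cov_J x y : cov P x y = (x == y)%:R * (k (idx x) - k (idx x) ^+ 2) - J (idx x) (idx y).
Proof.
rewrite /cov !mean_vacant_k; have [<-|xy] := eqVneq x y; last by rewrite mean_vacant2_J// mul0r; ring.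
have -> : (fun X => vacant x X * vacant x X) = vacant x :> (borel_conf R -> R).
  by apply/funext => X; rewrite vacant_idem.
by rewrite mean_vacant_k Jxx mulr1n; ring.
Qed.

Definition sites (L : nat) : seq halfint :=
  [seq site i%:Z | i <- index_iota 0 L] ++ [seq site (Negz i) | i <- index_iota 0 L].

Lemma sum_sites (F : halfint -> R) L : \sum_(x <- sites L) F x = bsum (fun n => F (site n)) L.
Proof. by rewrite big_cat !big_map /bsum big_split. Qed.

Lemma mem_sites L x : (lev (idx x) < L)%N -> x \in sites L.
Proof.
move=> h; rewrite -(idxK x); move: (idx x) h => n; rewrite mem_cat => nL; apply/orP.
by case: n nL => i /= iL; [left|right]; apply/mapP; exists i; rewrite ?mem_index_iota.
Qed.

Lemma uniq_sites L : uniq (sites L).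
Proof.
have sI : injective site by exact: can_inj siteK.
rewrite cat_uniq !map_inj_in_uniq ?iota_uniq//=; last 2 first.
- by move=> i j _ _ /sI [].
- by move=> i j _ _ /sI [].
rewrite andbT; apply/hasPn => _ /mapP[i _ ->]; apply/negP => /mapP[j _].
by move/sI.
Qed.

(** The quadratic form of the previous part is the variance, once the diagonal
    of the covariance is written as a row sum. The bounds on J and k that the
    row sum identity needs come from the positivity of probabilities, hence
    the form of the last hypothesis. *)
Lemma rigid_from_data (w : nat -> nat -> R) (C : R) : 0 < C -> tame w ->
  (forall x y, J x y = J y x) -> (forall x y, 0 <= J x y) ->
  (forall x y, (x - y)%:~R ^+ 2 * J x y <= C * w (lev x) (lev y)) ->
  ((forall x y, J x y <= k x * k y) -> (forall x y, J x y <= (1 - k x) * (1 - k y)) ->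
   (forall x, 0 <= k x <= 1) -> forall x, row_sum J x = k x - k x ^+ 2) ->
  rigid P.
Proof.
move=> C0 tw Jsym J0 JD /(_ J_le_particles J_le_holes diag_in01) row_sumE.
apply: (rigid_of_small_variance hP) => B e e0.
pose L0 := (\max_(x <- B) lev (idx x)).+1.
have [L [f [f1 f0 Vf]]] := qform_small C0 tw Jsym J0 JD L0 e0.
exists (sites L), (fun x => f (idx x)); split; first exact: uniq_sites.
  move=> x xB; have [h ->] : (lev (idx x) < L)%N /\ f (idx x) = 1.
    by apply: f1; rewrite ltnS; exact: (leq_bigmax_seq _ xB).
  by split => //; exact: mem_sites.
apply: le_lt_trans Vf; rewrite sum_sites /qform le_eqVlt; apply/orP; left; apply/eqP.
apply: eq_bsum => x xL; rewrite sum_sites siteK.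
under eq_bsum => y _ do rewrite siteK cov_J !siteK.
transitivity (bsum (fun y => (site x == site y)%:R * (f x * f y * (k x - k x ^+ 2))) L
  - f x * bsum (fun y => f y * J x y) L).
  by rewrite -bsumZ -bsumB; apply: eq_bsum => y _; ring.
rewrite (bsum_single xL) ?row_sumE ?eqxx/=; first by ring.
move=> y yx; rewrite (_ : _ == _ = false) ?mul0r//; apply/eqP => /(congr1 idx).
by rewrite !siteK => xy; rewrite xy eqxx in yx.
Qed.

End assembly.

(** * Particle and hole densities *)

Section density.
Variable R : realType.
Local Notation C := (R[i]).
Variables (u v : C) (q : int -> R).
Hypotheses (ui : nonint u) (vi : nonint v).
Hypothesis q0 : forall n, 0 < q n.
Hypothesis qE : forall n : int, (n%:~R + u) * (n%:~R + v) = (q n)%:C.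

Definition tail (n : int) : R := complex.Re (invsum (n%:~R + u) (n%:~R + v)).
Definition hole (n : int) : R := complex.Re (invsum (1 - (n%:~R + u)) (1 - (n%:~R + v))).
Definition mass : R := complex.Re (total u v).
(** The value of the Gamma-kernel on the diagonal. *)
Definition density (n : int) : R := tail n / mass.

Lemma tail_series n : invsum (n%:~R + u) (n%:~R + v) = (tail n)%:C /\
  (fun N => \sum_(0 <= k < N) (q (n + k%:Z))^-1) @ \oo --> tail n.
Proof.
apply: invsum_real; [exact: nonint_pole|exact: nonint_pole|move=> k].
by rewrite -qE intrD ![_ + k%:~R + _]addrAC.
Qed.

Lemma hole_series n : invsum (1 - (n%:~R + u)) (1 - (n%:~R + v)) = (hole n)%:C /\
  (fun N => \sum_(0 <= k < N) (q (n - 1 - k%:Z))^-1) @ \oo --> hole n.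
Proof.
apply: invsum_real; [exact: nonint_pole'|exact: nonint_pole'|move=> k].
by rewrite -qE !intrD !intrN; rewrite -[1%:~R]/(1 : C) -[k%:~R]/(k%:R : C); ring.
Qed.

Lemma series_ge0 (f : nat -> R) l : (forall k, 0 <= f k) ->
  (fun N => \sum_(0 <= k < N) f k) @ \oo --> l -> 0 <= l.
Proof.
move=> f0 fl; rewrite -(cvg_lim _ fl)//; apply: limr_ge; first exact: (cvgP _ fl).
by apply: nearW => n; exact: sumr_ge0.
Qed.

Lemma tail_ge0 n : 0 <= tail n.
Proof.
by apply: (series_ge0 _ (tail_series n).2) => k; rewrite invr_ge0 ltW.
Qed.

Lemma hole_ge0 n : 0 <= hole n.
Proof.
by apply: (series_ge0 _ (hole_series n).2) => k; rewrite invr_ge0 ltW.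
Qed.

Lemma tail_step n : tail n = (q n)^-1 + tail (n + 1).
Proof.
have h := invsum_step (nonint_pole n ui) (nonint_pole n vi).
have E w : n%:~R + w + 1 = (n + 1)%:~R + w :> C by rewrite intrD addrAC.
move: h; rewrite qE !E (tail_series n).1 (tail_series (n + 1)).1 -real_cV -real_cD.
by case.
Qed.

Lemma hole_step n : hole (n + 1) = (q n)^-1 + hole n.
Proof.
have h := invsum_step (nonint_pole' (n + 1) ui) (nonint_pole' (n + 1) vi).
have E w : 1 - ((n + 1)%:~R + w) + 1 = 1 - (n%:~R + w) :> C by rewrite intrD; ring.
have E2 w : 1 - ((n + 1)%:~R + w) = - (n%:~R + w) :> C by rewrite intrD; ring.
have Eq : (1 - ((n + 1)%:~R + u)) * (1 - ((n + 1)%:~R + v)) = (q n)%:C.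
  by rewrite !E2 mulrNN.
move: h; rewrite (hole_series (n + 1)).1 !E (hole_series n).1 Eq -real_cV -real_cD.
by case.
Qed.

Lemma tail_hole n : tail n + hole n = mass.
Proof.
have E0 : tail 0 + hole 0 = mass.
  rewrite /mass /total; have := (tail_series 0).1; have := (hole_series 0).1.
  by rewrite !add0r => -> ->; rewrite -real_cD.
by move: n; apply: int_shift_ind => // n <-; rewrite (tail_step n) hole_step; ring.
Qed.

Lemma total_real : total u v = mass%:C.
Proof.
rewrite -(tail_hole 0) real_cD -(tail_series 0).1 -(hole_series 0).1.
by rewrite /total !add0r.
Qed.

Lemma mass_gt0 : 0 < mass.
Proof.
rewrite -(tail_hole 0) tail_step -addrA ltr_wpDr ?invr_gt0//.
by apply: addr_ge0; [exact: tail_ge0|exact: hole_ge0].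
Qed.

Lemma density_step n : density (n + 1) = density n - mass^-1 / q n.
Proof. by rewrite /density (tail_step n); ring. Qed.

Lemma density_hole n : 1 - density n = hole n / mass.
Proof.
by rewrite /density -(tail_hole n); have := mass_gt0; rewrite -(tail_hole n) => h; field; rewrite gt_eqF.
Qed.

Lemma density_decay : exists2 D, 0 < D & forall n : nat, (0 < n)%N ->
  density n%:Z <= D / n%:R /\ 1 - density (Negz n) <= D / n%:R.
Proof.
have u0 : nonpole u by rewrite -[u]add0r; exact: (nonint_pole 0).
have v0 : nonpole v by rewrite -[v]add0r; exact: (nonint_pole 0).
have u1 : nonpole (1 - u) by rewrite -[u]add0r; exact: (nonint_pole' 0).
have v1 : nonpole (1 - v) by rewrite -[v]add0r; exact: (nonint_pole' 0).
have [D1 D10 H1] := invsum_bound u0 v0; have [D2 D20 H2] := invsum_bound u1 v1.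
have m0 := mass_gt0.
exists ((D1 + D2) / mass) => [|n n0]; first by rewrite divr_gt0 ?addr_gt0.
have n0' : 0 < n%:R :> R by rewrite ltr0n.
have h1 : tail n%:Z <= D1 / n%:R.
  apply: le_trans (H1 n n0); rewrite /tail ![n%:~R + _]addrC.
  exact: le_trans (ler_norm _) (normc_Re _).
have h2 : hole (Negz n) <= D2 / n%:R.
  apply: (@le_trans _ _ (D2 / n.+1%:R)); last first.
    by rewrite ler_pM2l// lef_pV2 ?posrE// ler_nat.
  apply: le_trans (H2 n.+1 _) => //.
  have E w : 1 - w + n.+1%:R = 1 - ((Negz n)%:~R + w) :> C.
    by rewrite NegzE intrN -[n.+1%:~R]/(n.+1%:R : C); ring.
  by rewrite !E; apply: le_trans (normc_Re _); exact: ler_norm.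
split.
  rewrite /density mulrAC ler_pM2r ?invr_gt0// (le_trans h1)// ler_pM2r ?invr_gt0//.
  by rewrite lerDl ltW.
rewrite density_hole mulrAC ler_pM2r ?invr_gt0// (le_trans h2)// ler_pM2r ?invr_gt0//.
by rewrite lerDr ltW.
Qed.

Variables (P : probability (borel_conf R) R) (K : halfint -> halfint -> R[i]).
Hypothesis hP : determinantal P K.
Variables (m : int) (J : int -> int -> R).
Hypothesis Kxx : forall x : halfint, K x x = (density (x + 1 + m))%:C.
Hypothesis Kxy : forall x y : halfint, x != y ->
  K x y * K y x = (J (x + 1 + m) (y + 1 + m))%:C.
Hypothesis Jxx : forall x, J x x = 0.
Hypothesis Jsym : forall x y, J x y = J y x.
Hypothesis J0 : forall x y, 0 <= J x y.

Lemma rigid_of_identities (w : nat -> nat -> R) (A : R) (M H : int -> int -> R) :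
  tame w -> (forall x y, (x - y)%:~R ^+ 2 * J x y <= A * w (lev x) (lev y)) ->
  (forall x, M x x = 0) ->
  (forall x n, J (x + 1) (n + 1) - J x n = 2 * mass^-1 ^+ 2 * M x n / q x) ->
  (forall x n, n != x -> M (x + 1) (n + 1) - M x n = H x (n + 1) - H x n) ->
  (forall x, H x x = - (2 * q x)^-1) -> (forall x, H x (x + 1) = (2 * q (x + 1))^-1) ->
  ((forall x, J x n%:Z @[n --> \oo] --> 0 /\ J x (- n%:Z) @[n --> \oo] --> 0) -> forall x,
     H x n%:Z @[n --> \oo] --> 0 /\ H x (- n%:Z) @[n --> \oo] --> 0) ->
  rigid P.
Proof.
move=> tw JD Mxx JM MH Hx0 Hx1 Hlim; have [D D0 hD] := density_decay.
have [_ [_ w0 _ _ _]] := tw; pose C := `|A| + D.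
have C0 : 0 < C by rewrite ltr_wpDl.
have JD' x y : (x - y)%:~R ^+ 2 * J x y <= C * w (lev x) (lev y).
  apply: (le_trans (JD x y)); rewrite ler_wpM2r// (le_trans (ler_norm _))// lerDl ltW//.
have hC n : D / n%:R <= C / n%:R by rewrite ler_wpM2r ?invr_ge0// lerDr.
apply: (rigid_from_data hP Kxx Kxy Jxx C0 tw Jsym J0 JD') => Jk Jk1 k01.
have Jlim x : J x n%:Z @[n --> \oo] --> 0 /\ J x (- n%:Z) @[n --> \oo] --> 0.
  have [h1 h2] := J_cvg0 C0 tw J0 JD' x; split => //; exact: cvg_pos_neg.
apply: (row_sum_reproducing C0 tw J0 JD' Jk Jk1 k01 _ _ _ _ density_step Mxx JM MH Hx0 Hx1).
- by move=> n n0; exact: le_trans (hD n n0).1 (hC n).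
- by move=> n n0; exact: le_trans (hD n n0).2 (hC n).
- by move=> x; rewrite gt_eqF.
- by rewrite invr_eq0 gt_eqF// mass_gt0.
- by move=> x; exact: (Hlim Jlim x).1.
- by move=> x; exact: (Hlim Jlim x).2.
Qed.

End density.

(** * Real ratios of Gamma type *)

Section ratio_weights.
Variable R : realType.

Lemma cvg0_le (f g : nat -> R) : (forall n, `|f n| <= g n) -> g @ \oo --> (0 : R) ->
  f @ \oo --> (0 : R).
Proof.
move=> fg /cvgrPdist_le g0; apply/cvgrPdist_le => e /g0; apply: filterS => n.
rewrite !sub0r !normrN; apply: le_trans; exact: le_trans (fg n) (ler_norm _).
Qed.

(** The recurrence of n |-> Gamma(n + a) / Gamma(n + a'), which for positive r
    is all that the growth estimates use. *)
Definition gamma_like (a a' : R) (r : int -> R) := (forall n, 0 < r n) /\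
  forall n : int, r (n + 1) * (n%:~R + a') = r n * (n%:~R + a).

Lemma gamma_like_inv a a' r : gamma_like a a' r -> gamma_like a' a (fun n => (r n)^-1).
Proof.
move=> [r0 rE]; split => n; first by rewrite invr_gt0.
have := rE n; have := r0 n; have := r0 (n + 1); move: (r n) (r (n + 1)) (_ + a) (_ + a').
move=> x y p q y0 x0 e; apply: (@mulfI _ (x * y)); first by rewrite mulf_neq0// gt_eqF.
transitivity (x * p); first by field; rewrite gt_eqF.
by rewrite -e; field; rewrite gt_eqF.
Qed.

Lemma gamma_like_pos a a' r (i : nat) : gamma_like a a' r ->
  r i.+1%:Z * (i%:R + a') = r i%:Z * (i%:R + a).
Proof. by move=> [_ rE]; have := rE i%:Z; rewrite -addn1 PoszD. Qed.

Lemma gamma_like_neg a a' r (i : nat) : gamma_like a a' r ->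
  r (Negz i.+1) * (i%:R + 2 - a) = r (Negz i) * (i%:R + 2 - a').
Proof.
move=> [_ rE]; have := rE (Negz i.+1).
have -> : Negz i.+1 + 1 = Negz i by rewrite !NegzE -addn1 PoszD opprD addrNK.
have -> : (Negz i.+1)%:~R = - (i%:R + 2) :> R.
  by rewrite NegzE intrN -[i.+2%:~R]/(i.+2%:R : R) -addn2 natrD.
move: (r _) (r _) (i%:R) => x y I e; apply/eqP; rewrite -subr_eq0; apply/eqP.
by transitivity (y * (- (I + 2) + a') - x * (- (I + 2) + a)); [ring|rewrite e subrr].
Qed.

(** The quotient of r at - (n + 1) and at n changes from n to n + 1 by a
    factor 1 + O(1/n^2), since the numerator and denominator of this factor
    have the same terms of degree 2 and 1 in n. *)
Lemma gamma_like_refl a a' r : 0 < a < 1 -> 0 < a' < 1 -> gamma_like a a' r ->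
  exists2 A, 0 < A & forall i : nat, r (Negz i) <= A * r i%:Z.
Proof.
move=> /andP[a0 a1] /andP[a'0 a'1] hr; have [r0 _] := hr.
(* K bounds (n + 1)^2 / ((n + a)(n + 2 - a)) = (n + 1)^2 / ((n + 1)^2 - (1 -
   a)^2). *)
pose K := (a * (2 - a))^-1; have K0 : 0 < K by rewrite invr_gt0 mulr_gt0//; lra.
have [B B0 hB] := sum_inv_sqr_bounded (ltW K0).
pose g0 := r (Negz 0) / r 0%:Z; have g00 : 0 < g0 by rewrite divr_gt0.
exists (g0 * expR B) => [|n]; first by rewrite mulr_gt0// expR_gt0.
suff : r (Negz n) <= g0 * (\prod_(0 <= k < n) (1 + K / k.+1%:R ^+ 2)) * r n%:Z.
  move/le_trans; apply; apply: ler_wpM2r; first exact: ltW.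
  apply: ler_wpM2l; first exact: ltW.
  apply: prod_le_expR => [k|]; first by rewrite divr_ge0// ?exprn_ge0// ltW.
  exact: hB.
elim: n => [|n IH]; first by rewrite big_geq// mulr1 /g0 divfK// gt_eqF.
rewrite big_nat_recr//=.
have h1 := gamma_like_pos n hr; have h2 := gamma_like_neg n hr.
move: IH; set T := \prod_(0 <= k < n) _.
have T0 : 0 <= T.
  by apply: prodr_ge0 => k _; rewrite addr_ge0// divr_ge0// ?exprn_ge0// ltW.
have n0 : 0 <= n%:R :> R by [].
have p1 : 0 < n%:R + 2 - a by lra.
have p2 : 0 < n%:R + a' by lra.
have p3 : 0 < n%:R + a by lra.
have -> : r (Negz n.+1) = r (Negz n) * ((n%:R + 2 - a') / (n%:R + 2 - a)).
  by rewrite mulrA -h2 mulfK// gt_eqF.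
have -> : r n.+1%:Z = r n%:Z * ((n%:R + a) / (n%:R + a')).
  by rewrite mulrA -h1 mulfK// gt_eqF.
move=> IH; have q1 : 0 <= (n%:R + 2 - a') / (n%:R + 2 - a) by rewrite divr_ge0//; lra.
apply: (le_trans (ler_wpM2r q1 IH)).
rewrite -subr_ge0 (_ : _ - _ = g0 * T * r n%:Z * ((1 + K / n.+1%:R ^+ 2) * ((n%:R + a) / (n%:R + a')) -
  (n%:R + 2 - a') / (n%:R + 2 - a))); last by ring.
apply: mulr_ge0; first by apply: mulr_ge0; [apply: mulr_ge0 => //; exact: ltW|exact: ltW].
rewrite subr_ge0 /K -(natr1 n).
rewrite ler_pdivrMr// mulrAC mulrA ler_pdivlMr//.
move: (n%:R : R) n0 p1 p2 p3 => N N0 p1 p2 p3.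
have D0 : 0 < a * (2 - a) * (N + 1) ^+ 2 by rewrite !mulr_gt0//; lra.
have -> : 1 + (a * (2 - a))^-1 / (N + 1) ^+ 2 = 1 + (a * (2 - a) * (N + 1) ^+ 2)^-1.
  by rewrite [X in _ = 1 + X]invfM.
have e : (a * (2 - a) * (N + 1) ^+ 2)^-1 * (a * (2 - a) * (N + 1) ^+ 2) = 1 by rewrite mulVf// gt_eqF.
have i0 : 0 < (a * (2 - a) * (N + 1) ^+ 2)^-1 by rewrite invr_gt0.
have hD : a * (2 - a) * (N + 1) ^+ 2 <= (N + a) * (N + 2 - a).
  have : 0 <= (1 - a) ^+ 2 * (N ^+ 2 + 2 * N) by rewrite mulr_ge0 ?sqr_ge0//; nra.
  by nra.
have : 1 <= (a * (2 - a) * (N + 1) ^+ 2)^-1 * ((N + a) * (N + 2 - a)).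
  by rewrite -{1}e ler_pM2l.
move: (_^-1) => Z hZ.
nra.
Qed.

Lemma gamma_like_balanced a a' r : 0 < a < 1 -> 0 < a' < 1 -> gamma_like a a' r ->
  balanced (fun i : nat => r i%:Z).
Proof.
move=> /andP[a0 a1] /andP[a'0 a'1] hr; apply: (@balanced_rec _ _ a a') => //.
- by apply/andP; split; lra.
- by move=> n; exact: hr.1.
- by move=> n; exact: gamma_like_pos.
Qed.

Definition ratio_weight (r : int -> R) (i j : nat) : R := r i%:Z / r j%:Z + r j%:Z / r i%:Z.

Lemma tame_ratio_weight a a' r : 0 < a < 1 -> 0 < a' < 1 -> gamma_like a a' r ->
  tame (ratio_weight r).
Proof.
move=> ha ha' hr; apply: tame_sym_ratio; first by move=> n; exact: hr.1.
  exact: gamma_like_balanced hr.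
exact: gamma_like_balanced (gamma_like_inv hr).
Qed.

Lemma ratio_weight_bound a a' r : 0 < a < 1 -> 0 < a' < 1 -> gamma_like a a' r ->
  exists2 A, 0 < A & forall x n : int, r n / r x + r x / r n <= A * ratio_weight r (lev x) (lev n).
Proof.
move=> ha ha' hr; have [r0 _] := hr.
have [A1 A10 h1] := gamma_like_refl ha ha' hr.
have [A2 A20 h2] := gamma_like_refl ha' ha (gamma_like_inv hr).
pose A := 1 + A1 + A2; have A0 : 0 < A by rewrite /A; lra.
have up x : r x <= A * r (lev x)%:Z.
  case: x => i /=; first by rewrite ler_peMl ?ltW// /A; lra.
  by apply: (le_trans (h1 i)); rewrite ler_pM2r// /A; lra.
have lo x : (r x)^-1 <= A * (r (lev x)%:Z)^-1.
  case: x => i /=; first by rewrite ler_peMl ?invr_ge0 ?ltW// /A; lra.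
  by apply: (le_trans (h2 i)); rewrite ler_pM2r ?invr_gt0// /A; lra.
have one x n : r n / r x <= A ^+ 2 * (r (lev n)%:Z / r (lev x)%:Z).
  rewrite expr2 mulrACA; apply: ler_pM => //; first exact: ltW.
  by rewrite invr_ge0 ltW.
exists (A ^+ 2) => [|x n]; first by rewrite exprn_gt0.
by rewrite /ratio_weight mulrDr addrC lerD.
Qed.

(** The quotient g n = r n / (n + a') decreases by a multiple of g n / n at
    each step. If its limit were positive, the harmonic series would converge.
    *)
Lemma gamma_like_sublinear a a' r : 0 < a < 1 -> 0 < a' < 1 -> gamma_like a a' r ->
  (fun n : nat => r n%:Z / (n%:R + a')) @ \oo --> (0 : R).
Proof.
move=> /andP[a0 a1] /andP[a'0 a'1] hr; have [r0 _] := hr.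
pose g (n : nat) := r n%:Z / (n%:R + a').
have p (n : nat) (b : R) : 0 < b -> 0 < n%:R + b by move=> b0; rewrite ltr_wpDl.
have g0 n : 0 <= g n by rewrite divr_ge0 ?ltW// p.
have gS n : g n - g n.+1 = g n * (1 + a' - a) / (n.+1%:R + a').
  have h := gamma_like_pos n hr; rewrite /g.
  have -> : r n.+1%:Z = r n%:Z * (n%:R + a) / (n%:R + a') by rewrite -h mulfK// gt_eqF ?p.
  have := p n.+1 a' a'0; rewrite -natr1; have := p n a' a'0; move: (n%:R) => N h1 h2.
  by field; rewrite !gt_eqF.
have d0 : 0 < 1 + a' - a by lra.
have gni : nonincreasing_seq g.
  apply/nonincreasing_seqP => n; rewrite -subr_ge0 gS; apply: divr_ge0; first by apply: mulr_ge0 => //; exact: ltW.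
  exact/ltW/p.
have gc : cvgn g by apply: nonincreasing_is_cvgn => //; exists 0 => _ [n _ <-].
have L0 : 0 <= limn g by apply: limr_ge => //; exact: nearW.
have Lg n : limn g <= g n by exact: nonincreasing_cvgn_ge.
suff -> : (0 : R) = limn g by [].
apply/eqP; rewrite eq_le L0 /= leNgt; apply/negP => Lpos.
apply: (@dvg_harmonic R); apply: nondecreasing_is_cvgn.
  by apply/nondecreasing_seqP => n; rewrite /series/= big_nat_recr//= lerDl harmonic_ge0.
exists (2 * g 0 / (limn g * (1 + a' - a))) => _ [n _ <-].
rewrite ler_pdivlMr ?mulr_gt0//.
suff : \sum_(0 <= k < n) harmonic k * (limn g * (1 + a' - a)) <= 2 * (g 0 - g n).
  by rewrite /series/= big_distrl/= => /le_trans; apply; rewrite ler_pM2l// gerBl.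
elim: n => [|n IH]; first by rewrite big_geq// subrr mulr0.
rewrite big_nat_recr//= (_ : 2 * (g 0 - g n.+1) = 2 * (g 0 - g n) + 2 * (g n - g n.+1)); last by ring.
apply: lerD => //; rewrite gS /harmonic/=.
have := p n.+1 a' a'0; have := Lg n; have : 1 <= n.+1%:R :> R by rewrite ler1n.
move: (n.+1%:R) (g n) (limn g) Lpos => N G L L1 h1 h2 h3.
rewrite mulrC ler_pdivrMr; last by lra.
rewrite -!mulrA [_ * N]mulrC !mulrA ler_pdivlMr//.
rewrite (_ : 2 * G * _ * N = G * (1 + a' - a) * (2 * N)); last by ring.
apply: ler_pM; [by rewrite mulr_ge0// ltW|exact: ltW|by rewrite ler_pM2r|lra].
Qed.

Lemma gamma_like_vanish a a' r (e : int) : 0 < a < 1 -> 0 < a' < 1 -> gamma_like a a' r ->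
  `|e|%N = 1%N -> (fun n : nat => r (e * n%:Z) / `|(e * n%:Z)%:~R + a'|) @ \oo --> (0 : R).
Proof.
move=> ha ha' hr; have h := gamma_like_sublinear ha ha' hr.
have [r0 _] := hr; have /andP[a'0 a'1] := ha'.
case: e => [[|[|e]]|[|e]] //= _.
  apply: cvg_trans h; apply: near_eq_cvg; apply: nearW => n /=.
  by rewrite mul1r ger0_norm// addr_ge0// ltW.
have -> : (fun n : nat => r (Negz 0 * n%:Z) / `|(Negz 0 * n%:Z)%:~R + a'|) =
  (fun n : nat => (fun x : int => r x / `|x%:~R + a'|) (- n%:Z)).
  by apply/funext => n; rewrite NegzE mulN1r.
apply: (@cvg_pos_neg _ (fun x : int => r x / `|x%:~R + a'|)).
have [A A0 hA] := gamma_like_refl ha ha' hr.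
have h' : (fun n : nat => A / (1 - a') * (r n%:Z / (n%:R + a'))) @ \oo --> (0 : R).
  by rewrite -[0](mulr0 (A / (1 - a'))); exact: cvgMr.
apply: (cvg0_le _ h') => n; have n0 : 0 <= n%:R :> R by [].
have -> : (Negz n)%:~R + a' = - (n%:R + 1 - a').
  by rewrite NegzE intrN -[n.+1%:~R]/(n.+1%:R : R) -natr1; ring.
have p1 : 0 < n%:R + 1 - a' by lra.
have p2 : 0 < n%:R + a' by lra.
have p3 : 0 < 1 - a' by lra.
rewrite normrN (gtr0_norm p1) ger0_norm; last by rewrite divr_ge0// ltW.
rewrite ler_pdivrMr//; apply: (le_trans (hA n)).
rewrite (_ : A / _ * _ * _ = A * r n%:Z * ((n%:R + 1 - a') / ((1 - a') * (n%:R + a')))); last first.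
  by field; rewrite !gt_eqF.
apply: ler_peMr; first by apply: mulr_ge0; exact: ltW.
rewrite ler_pdivlMr ?mulr_gt0// mul1r.
by move: (n%:R : R) n0 p1 p2 p3 => N; nra.
Qed.

End ratio_weights.

(** * Distinct parameters *)

Section distinct_parameters.
Variable R : realType.
Local Notation C := (R[i]).
Variables (u v : C) (q : int -> R).
Hypotheses (ui : nonint u) (vi : nonint v).
Hypothesis q0 : forall n, 0 < q n.
Hypothesis qE : forall n : int, (n%:~R + u) * (n%:~R + v) = (q n)%:C.
Hypothesis uv : u != v.
Variable r : int -> C.
Hypothesis r0 : forall n, r n != 0.
Hypothesis rE : forall n : int, r (n + 1) * (n%:~R + v) = r n * (n%:~R + u).

Let b : R := (mass u v)^-1.

(** K x n * K n x for distinct x and n, when the parameters are distinct; r n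
    stands for Gamma(n + u) / Gamma(n + v). *)
Definition pair_corr (x n : int) : C :=
  (b%:C / (u - v)) ^+ 2 * (r n / r x + r x / r n - 2) / ((n - x)%:~R) ^+ 2.

(** The function M of the abstract scheme: the diagonal difference of
    pair_corr without its factor depending on x. *)
Definition pair_step (x n : int) : C := - (2 * (u - v))^-1 *
  (r n / r x * (x%:~R + v) / ((n - x)%:~R * (n%:~R + v))
   - r x / r n * (x%:~R + u) / ((n - x)%:~R * (n%:~R + u))).

(** The function H of the abstract scheme, of which the diagonal difference of
    M is the difference in n. *)
Definition pair_flux (x n : int) : C := (2 * (u - v))^-1 *
  (r n / (r (x + 1) * (n%:~R + v)) - r (x + 1) / (r n * (n%:~R + u))).

Let duv : u - v != 0. Proof. by rewrite subr_eq0. Qed.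

Let rS n : r (n + 1) = r n * (n%:~R + u) / (n%:~R + v).
Proof. by rewrite -rE mulfK. Qed.

Lemma pair_corr_step x n : n != x -> pair_corr (x + 1) (n + 1) - pair_corr x n =
  (2 * b ^+ 2 / q x)%:C * pair_step x n.
Proof.
move=> nx; have nx0 : (n - x)%:~R != 0 :> C by rewrite intr_eq0 subr_eq0.
rewrite real_cM real_cM real_cV -qE real_cX -natC /pair_corr /pair_step !rS.
have -> : n + 1 - (x + 1) = n - x by ring.
move: nx0 (r0 n) (r0 x) (ui n) (vi n) (ui x) (vi x); rewrite intrB.
move: duv; move: (n%:~R) (x%:~R) (r n) (r x) b%:C => N X a c B h1 h2 h3 h4 h5 h6 h7 h8.
by field; rewrite ?h1 ?h2 ?h3 ?h4 ?h5 ?h6 ?h7 ?h8.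
Qed.

Lemma pair_step_flux x n : n != x -> pair_step (x + 1) (n + 1) - pair_step x n =
  pair_flux x (n + 1) - pair_flux x n.
Proof.
move=> nx; have nx0 : (n - x)%:~R != 0 :> C by rewrite intr_eq0 subr_eq0.
rewrite /pair_step /pair_flux.
have -> : n + 1 - (x + 1) = n - x by ring.
have := r0 (n + 1); have := r0 (x + 1); rewrite !rS.
move: nx0 (r0 n) (r0 x) (ui n) (vi n) (ui x) (vi x) (ui (n + 1)) (vi (n + 1)).
move: (ui (x + 1)) (vi (x + 1)); rewrite intrB !intrD.
move: duv; move: (n%:~R) (x%:~R) (r n) (r x) => N X a c h1 h2 h3 h4 h5 h6 h7 h8 h9 h10 h11 h12 h13 h14.
by field; rewrite ?h1 ?h2 ?h3 ?h4 ?h5 ?h6 ?h7 ?h8 ?h9 ?h10 ?h11 ?h12.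
Qed.

Lemma pair_flux_diag x : pair_flux x x = (- (2 * q x)^-1)%:C.
Proof.
rewrite /pair_flux rS real_cN real_cV real_cM -qE -natC.
move: (r0 x) (ui x) (vi x) duv; move: (x%:~R) (r x) => X c h1 h2 h3 h4.
by field; rewrite ?h1 ?h2 ?h3 ?h4.
Qed.

Lemma pair_flux_next x : pair_flux x (x + 1) = ((2 * q (x + 1))^-1)%:C.
Proof.
rewrite /pair_flux real_cV real_cM -qE -natC.
move: (r0 (x + 1)) (ui (x + 1)) (vi (x + 1)) duv; move: ((x + 1)%:~R) (r (x + 1)) => X c h1 h2 h3 h4.
by field; rewrite ?h1 ?h2 ?h3 ?h4.
Qed.

Lemma pair_corr_sym x n : pair_corr x n = pair_corr n x.
Proof.
rewrite /pair_corr (addrC (r n / r x)); congr (_ / _).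
by rewrite -[x - n]opprB intrN sqrrN.
Qed.

Let J x n : R := if n == x then 0 else complex.Re (pair_corr x n).
Let M x n : R := if n == x then 0 else complex.Re (pair_step x n).
Let H x n : R := complex.Re (pair_flux x n).

Lemma ReB (a c : C) : complex.Re (a - c) = complex.Re a - complex.Re c.
Proof. by case: a c => ? ? []. Qed.

Lemma Re_realM (a : R) (c : C) : complex.Re (a%:C * c) = a * complex.Re c.
Proof. by case: c => c d; rewrite /= mul0r subr0. Qed.

Variables (P : probability (borel_conf R) R) (K : halfint -> halfint -> R[i]).
Hypothesis hP : determinantal P K.
Variables (m : int).
Hypothesis Kxx : forall x : halfint, K x x = (density u v (x + 1 + m))%:C.
Hypothesis Kxy : forall x y : halfint, x != y ->
  K x y * K y x = pair_corr (x + 1 + m) (y + 1 + m).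
Hypothesis pair_corr_ge0 : forall x n, n != x ->
  exists2 a, 0 <= a & pair_corr x n = a%:C.

Lemma rigid_distinct (w : nat -> nat -> R) (A : R) : tame w ->
  (forall x n, normc (r n / r x) + normc (r x / r n) <= A * w (lev x) (lev n)) ->
  (forall e : int, `|e|%N = 1%N ->
    normc (r (e * n%:Z)) / normc ((e * n%:Z)%:~R + v) @[n --> \oo] --> (0 : R) /\
    normc (r (e * n%:Z))^-1 / normc ((e * n%:Z)%:~R + u) @[n --> \oo] --> (0 : R)) ->
  rigid P.
Proof.
move=> tw rw rlim.
have JE x n : n != x -> (J x n)%:C = pair_corr x n.
  by move=> nx; rewrite /J (negbTE nx); have [a _ ->] := pair_corr_ge0 nx.
apply: (@rigid_of_identities _ u v q ui vi q0 qE P K hP m J Kxx _ _ _ _ w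
  (normc (b%:C / (u - v)) ^+ 2 * (2 * A)) M H tw).
- move=> x y xy; rewrite JE ?Kxy//; apply: contra_neq xy => /addIr/addIr ->//.
- by move=> x; rewrite /J eqxx.
- by move=> x y; rewrite /J eq_sym pair_corr_sym.
- move=> x y; rewrite /J; case: ifPn => // yx; have [a a0 ->//] := pair_corr_ge0 yx.
- move=> x y; rewrite /J; case: ifPn => [/eqP->|yx].
    have [_ [_ w0 _ _ _]] := tw; have := rw x x; rewrite !divff// (normc_real 1) normr1 => h.
    by rewrite mulr0 -mulrA mulr_ge0 ?sqr_ge0// -mulrA mulr_ge0//; lra.
  have d0 : 0 < (x - y)%:~R ^+ 2 :> R.
    by rewrite lt_neqAle sqr_ge0 andbT eq_sym sqrf_eq0 intr_eq0 subr_eq0 eq_sym.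
  have dn : normc ((y - x)%:~R : C) ^+ 2 = (x - y)%:~R ^+ 2.
    by rewrite intC normc_real real_normK ?num_real// -sqrrN -intrN opprB.
  have hre : complex.Re (pair_corr x y) <= normc (pair_corr x y).
    by apply: le_trans (normc_Re _); exact: ler_norm.
  apply: (@le_trans _ _ ((x - y)%:~R ^+ 2 * normc (pair_corr x y))); first by rewrite ler_pM2l.
  pose S := r y / r x + r x / r y - 2.
  have nS : normc S <= 2 * (A * w (lev x) (lev y)).
    apply: (@le_trans _ _ (2 * (normc (r y / r x) + normc (r x / r y)))); last by rewrite ler_pM2l.
    apply: (le_trans (ler_normcB _ _)); rewrite normc_nat.
    have := ler_normcD (r y / r x) (r x / r y).
    have s0 : 0 < normc (r y / r x) by rewrite normc_gt0 mulf_neq0// invr_neq0.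
    have -> : normc (r x / r y) = (normc (r y / r x))^-1 by rewrite -normcV invf_div.
    have := divff (lt0r_neq0 s0); have : 0 < (normc (r y / r x))^-1 by rewrite invr_gt0.
    move: (normc (r y / r x)) s0 => s s0; move: (s^-1) (normc (_ + _)) => t z t0 st zs.
    have := mulr_ge0 (ltW t0) (sqr_ge0 (s - 1)).
    have -> : t * (s - 1) ^+ 2 = s * (s * t) - 2 * (s * t) + t by ring.
    by rewrite st; lra.
  have -> : normc (pair_corr x y) = normc (b%:C / (u - v)) ^+ 2 * normc S / (x - y)%:~R ^+ 2.
    rewrite -dn -!normcX -normcV -normcM -normcM //.
  rewrite [leLHS]mulrC divfK; last by rewrite gt_eqF.
  rewrite (_ : _ * (2 * A) * _ = normc (b%:C / (u - v)) ^+ 2 * (2 * (A * w (lev x) (lev y)))); last by ring.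
  by apply: ler_wpM2l; first exact: sqr_ge0.
- by move=> x; rewrite /M eqxx.
- move=> x n; rewrite /J /M (inj_eq (addIr 1)); case: ifPn => [_|nx]; first by rewrite subr0 mulr0 mul0r.
  by rewrite -ReB pair_corr_step// Re_realM mulrAC.
- move=> x n nx; rewrite /M (inj_eq (addIr 1)) (negbTE nx) /H -!ReB.
  by rewrite pair_step_flux.
- by move=> x; rewrite /H pair_flux_diag.
- by move=> x; rewrite /H pair_flux_next.
- move=> _ x.
  have L (e : int) : `|e|%N = 1%N -> H x (e * n%:Z) @[n --> \oo] --> (0 : R).
    move=> e1; have [h1 h2] := rlim e e1.
    pose c1 := normc (2 * (u - v))^-1 / normc (r (x + 1)).
    pose c2 := normc (2 * (u - v))^-1 * normc (r (x + 1)).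
    have h : (fun n : nat => c1 * (normc (r (e * n%:Z)) / normc ((e * n%:Z)%:~R + v)) +
        c2 * (normc (r (e * n%:Z))^-1 / normc ((e * n%:Z)%:~R + u))) @ \oo --> (0 : R).
      rewrite -[0](addr0 0); apply: cvgD.
        by rewrite -[0](mulr0 c1); exact: cvgMr.
      by rewrite -[0](mulr0 c2); exact: cvgMr.
    apply: (cvg0_le _ h) => n; apply: (le_trans (normc_Re _)).
    rewrite /pair_flux normcM /c1 /c2 -!mulrA -mulrDr ler_wpM2l ?normc_ge0//.
    apply: (le_trans (ler_normcB _ _)); apply: lerD.
      by rewrite normcM normcV normcM invfM mulrCA.
    by rewrite normcM normcV normcM invfM normcV.
  split; first by have := L 1 erefl; under eq_fun do rewrite mul1r.
  by have := L (-1) erefl; under eq_fun do rewrite mulN1r.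
Qed.

End distinct_parameters.

(** * Equal parameters *)

Section gamma_ratios.
Variable R : realType.

(** The solution of the recurrence of Gamma ratios with value 1 at 0. *)
Definition gratio (a a' : R) (n : int) : R :=
  match n with
  | Posz i => \prod_(0 <= k < i) ((k%:R + a) / (k%:R + a'))
  | Negz i => \prod_(0 <= k < i.+1) ((k.+1%:R - a') / (k.+1%:R - a))
  end.

Lemma gratio_gamma_like a a' : 0 < a < 1 -> 0 < a' < 1 -> gamma_like a a' (gratio a a').
Proof.
move=> /andP[a0 a1] /andP[a'0 a'1].
have p (k : nat) (b : R) : 0 < b -> 0 < k%:R + b by move=> b0; rewrite ltr_wpDl.
have pn (k : nat) (b : R) : b < 1 -> 0 < k.+1%:R - b.
  by move=> b1; rewrite subr_gt0 (lt_le_trans b1)// ler1n.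
split=> [[i|i]|[i|i]] /=.
- by apply: prodr_gt0 => k _; rewrite divr_gt0// p.
- by apply: prodr_gt0 => k _; rewrite divr_gt0// pn.
- rewrite addn1 big_nat_recr//= -mulrA divfK// gt_eqF// p//.
- have -> : Negz i + 1 = - i%:Z by rewrite NegzE -addn1 PoszD opprD addrNK.
  have -> : (Negz i)%:~R = - i.+1%:R :> R by rewrite NegzE intrN.
  have -> : gratio a a' (- i%:Z) = \prod_(0 <= k < i) ((k.+1%:R - a') / (k.+1%:R - a)).
    case: i => [|i] //.
    by rewrite /= !big_geq.
  rewrite big_nat_recr//=; have := pn i a a1.
  by move: (\prod_(_ <= _ < _) _) (i.+1%:R) => p0 N N0; field; rewrite gt_eqF.
Qed.

End gamma_ratios.

Section digamma.
Variable R : realType.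
Variables (a : R) (psi : int -> R).
Hypothesis a01 : 0 < a < 1.
Hypothesis psiE : forall n : int, psi (n + 1) = psi n + (n%:~R + a)^-1.

Lemma int_add_neq0 (n : int) : n%:~R + a != 0.
Proof.
move: a01 => /andP[a0 a1]; case: n => n; first by rewrite gt_eqF// ltr_wpDl// ler0z.
rewrite NegzE intrN lt_eqF// addrC subr_lt0 (lt_le_trans a1)// -[n.+1%:~R]/(n.+1%:R : R).
by rewrite ler1n.
Qed.

(** exp y <= 1 / (1 - y), for y = e / (n + a): the right-hand side is the
    ratio of two consecutive values of r. *)
Lemma psi_growth (e : R) r : gamma_like a (a - e) r -> forall x (k : nat),
  expR (e * (psi (x + k%:Z) - psi x)) <= r (x + k%:Z) / r x.
Proof.
move=> [r0 rE] x; elim=> [|k IH]; first by rewrite addr0 subrr mulr0 expR0 divff// gt_eqF.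
rewrite -addn1 PoszD addrA psiE; move: (x + k%:Z) IH => n IH.
have n0 := int_add_neq0 n; have e0 := expR_gt0 (e / (n%:~R + a)).
have h : expR (e / (n%:~R + a)) <= r (n + 1) / r n.
  have s0 : 0 < r (n + 1) / r n by rewrite divr_gt0.
  have sE : (r (n + 1) / r n)^-1 = 1 - e / (n%:~R + a).
    rewrite invf_div; apply: (@mulfI _ (r (n + 1) * (n%:~R + a))).
      by rewrite mulf_neq0// gt_eqF.
    transitivity (r n * (n%:~R + a)); first by field; rewrite gt_eqF.
    rewrite -mulrA; have -> : (n%:~R + a) * (1 - e / (n%:~R + a)) = n%:~R + (a - e) by field.
    by rewrite rE.
  have := expR_ge1Dx (- (e / (n%:~R + a))); rewrite -sE => h1.
  have h2 : expR (e / (n%:~R + a)) * expR (- (e / (n%:~R + a))) = 1 by rewrite -expRD subrr expR0.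
  have s1 : 0 < (r (n + 1) / r n)^-1 by rewrite invr_gt0.
  rewrite -[leRHS]mul1r -ler_pdivrMr//.
  by apply: (@le_trans _ _ (expR (e / (n%:~R + a)) * expR (- (e / (n%:~R + a))))); rewrite ?ler_pM2l ?h2.
rewrite (_ : e * _ = e * (psi n - psi x) + e / (n%:~R + a)); last by ring.
rewrite expRD (_ : r (n + 1) / r x = r n / r x * (r (n + 1) / r n)); last first.
  by field; rewrite !gt_eqF.
by apply: ler_pM => //; exact: ltW (expR_gt0 _).
Qed.

(** D^2 <= 4 (exp D + exp (- D)), and the exponentials of multiples of digamma
    differences are bounded by Gamma ratios with nearby parameters. *)
Lemma psi_bound (e A1 A2 : R) r1 r2 w1 w2 : 0 < e ->
  gamma_like a (a - e) r1 -> gamma_like a (a + e) r2 ->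
  (forall x n : int, r1 n / r1 x + r1 x / r1 n <= A1 * w1 (lev x) (lev n)) ->
  (forall x n : int, r2 n / r2 x + r2 x / r2 n <= A2 * w2 (lev x) (lev n)) ->
  forall x n, (psi n - psi x) ^+ 2 <= 4 / e ^+ 2 * (A1 * w1 (lev x) (lev n) + A2 * w2 (lev x) (lev n)).
Proof.
move=> e0 h1 h2 hw1 hw2 x n.
have sq (D : R) : D ^+ 2 / 4 <= expR D + expR (- D).
  have p1 := expR_gt0 D; have p2 := expR_gt0 (- D).
  have h (y : R) : 0 <= y -> y ^+ 2 / 4 <= expR y.
    move=> y0; have := expR_ge1Dx (y / 2); have -> : expR y = expR (y / 2) ^+ 2.
      by rewrite expr2 -expRD; congr expR; field.
    by move: (expR _) => E hE; nra.
  have [D0|D0] := leP 0 D; first by have := h D D0; lra.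
  by have := h (- D); rewrite sqrrN => /(_ _); lra.
have key x0 (k : nat) : (psi (x0 + k%:Z) - psi x0) ^+ 2 <=
    4 / e ^+ 2 * (r1 (x0 + k%:Z) / r1 x0 + r2 (x0 + k%:Z) / r2 x0).
  have g1 := psi_growth h1 x0 k.
  have h2' : gamma_like a (a - - e) r2 by rewrite opprK.
  have g2 := psi_growth h2' x0 k; rewrite mulNr in g2.
  have := sq (e * (psi (x0 + k%:Z) - psi x0)).
  move: g1 g2; move: (psi _ - psi _) (expR _) (expR _) (_ / r1 x0) (_ / r2 x0) => D E1 E2 X1 X2 g1 g2 h.
  rewrite -(@ler_pM2l _ (e ^+ 2 / 4)) ?divr_gt0 ?exprn_gt0//.
  rewrite (_ : e ^+ 2 / 4 * (4 / e ^+ 2 * _) = X1 + X2); last by field; rewrite gt_eqF.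
  rewrite (_ : e ^+ 2 / 4 * D ^+ 2 = (e * D) ^+ 2 / 4); last by ring.
  by apply: (le_trans h); exact: lerD.
have c0 : 0 < 4 / e ^+ 2 by rewrite divr_gt0// exprn_gt0.
have p1 y z : 0 < r1 y / r1 z by rewrite divr_gt0// h1.1.
have p2 y z : 0 < r2 y / r2 z by rewrite divr_gt0// h2.1.
have := hw1 x n; have := hw2 x n => hh2 hh1.
have [xn|nx] := leP x n.
  have [k nE] : exists k : nat, n = x + k%:Z by exists `|n - x|%N; lia.
  have := key x k; rewrite -nE => /le_trans; apply; rewrite ler_pM2l//.
  by have := p1 x n; have := p2 x n; lra.
have [k nE] : exists k : nat, x = n + k%:Z by exists `|x - n|%N; lia.
rewrite -sqrrN opprB.
have := key n k; rewrite -nE => /le_trans; apply; rewrite ler_pM2l//.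
by have := p1 n x; have := p2 n x; lra.
Qed.

Variables (q : int -> R).
Hypothesis qE : forall n : int, q n = (n%:~R + a) ^+ 2.
Let u : R[i] := a%:C.
Hypothesis ui : nonint u.

Let b : R := (mass u u)^-1.
Let T x n : R := (psi n - psi x) / (n - x)%:~R.
Let J x n : R := b ^+ 2 * T x n ^+ 2.
Let M x n : R := if n == x then 0 else
  - T x n * (x%:~R + a) / (n%:~R + a) + (2 * (n%:~R + a) ^+ 2)^-1.
Let H x n : R := (psi n - psi (x + 1)) / (n%:~R + a) + (2 * (n%:~R + a) ^+ 2)^-1.

Lemma digamma_diffE x n : psi n - psi x = T x n * (n - x)%:~R.
Proof.
rewrite /T; have [->|nx] := eqVneq n x; first by rewrite !subrr mulr0.
by rewrite divfK// intr_eq0 subr_eq0.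
Qed.

Lemma sqr_cvg0 (f : nat -> R) : (fun n => f n ^+ 2) @ \oo --> (0 : R) -> f @ \oo --> (0 : R).
Proof.
move=> f2; have h : (fun n => Num.sqrt (f n ^+ 2)) @ \oo --> (0 : R).
  by rewrite -[X in _ --> X]sqrtr0; apply: (continuous_cvg _ _ f2); exact: sqrt_continuous.
by apply: (cvg0_le _ h) => n; rewrite sqrtr_sqr.
Qed.

Variables (P : probability (borel_conf R) R) (K : halfint -> halfint -> R[i]).
Hypothesis hP : determinantal P K.
Variables (m : int).
Hypothesis Kxx : forall x : halfint, K x x = (density u u (x + 1 + m))%:C.
Hypothesis Kxy : forall x y : halfint, x != y ->
  K x y * K y x = (J (x + 1 + m) (y + 1 + m))%:C.

(** The data are those of distinct parameters after division by the vanishing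
    difference of the parameters: T x n is the difference quotient of psi, and
    the square of b T replaces pair_corr. *)
Lemma rigid_equal : rigid P.
Proof.
(* Small enough for a - e and a + e to be parameters in the interval from 0 to
   1. *)
have /andP[a0 a1] := a01; pose e := Num.min a (1 - a) / 2.
have e0 : 0 < e by rewrite divr_gt0// lt_min a0 subr_gt0.
have ea : e <= a / 2 by rewrite ler_pM2r// ge_min lexx.
have ea1 : e <= (1 - a) / 2 by rewrite ler_pM2r// ge_min lexx orbT.
have m01 : 0 < a - e < 1 by apply/andP; split; lra.
have p01 : 0 < a + e < 1 by apply/andP; split; lra.
have r1 := gratio_gamma_like a01 m01; have r2 := gratio_gamma_like a01 p01.
have [A1 A10 hw1] := ratio_weight_bound a01 m01 r1.
have [A2 A20 hw2] := ratio_weight_bound a01 p01 r2.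
have tw := tame_add (tame_ratio_weight a01 m01 r1) (tame_ratio_weight a01 p01 r2).
have [_ [_ w10 _ _ _]] := tame_ratio_weight a01 m01 r1.
have [_ [_ w20 _ _ _]] := tame_ratio_weight a01 p01 r2.
have hpsi := psi_bound e0 r1 r2 hw1 hw2.
have q0 n : 0 < q n by rewrite qE lt_neqAle sqr_ge0 eq_sym sqrf_eq0 int_add_neq0.
have qC n : (n%:~R + u) * (n%:~R + u) = (q n)%:C.
  by rewrite /u intC -real_cD -real_cM qE.
have n0 := int_add_neq0.
apply: (@rigid_of_identities _ u u q ui ui q0 qC P K hP m J Kxx Kxy _ _ _ _
   (b ^+ 2 * (4 / e ^+ 2 * (A1 + A2))) M H tw).
- by move=> x; rewrite /J /T subrr mul0r expr0n mulr0.
- by move=> x y; rewrite /J /T -(opprB (psi x)) -(opprB x) intrN invrN mulrNN.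
- by move=> x y; rewrite mulr_ge0 ?sqr_ge0.
- move=> x y; have -> : (x - y)%:~R ^+ 2 * J x y = b ^+ 2 * (psi y - psi x) ^+ 2.
    by rewrite (digamma_diffE x y) -(opprB y x) intrN /J; ring.
  rewrite -mulrA; apply: ler_wpM2l; first exact: sqr_ge0.
  apply: (le_trans (hpsi x y)); rewrite -[leRHS]mulrA ler_pM2l; last by rewrite divr_gt0// exprn_gt0.
  have := mulr_ge0 (ltW A10) (w20 (lev x) (lev y)); have := mulr_ge0 (ltW A20) (w10 (lev x) (lev y)).
  rewrite mulrDl !mulrDr; lra.
- by move=> x; rewrite /M eqxx.
- move=> x n; rewrite /J /M /T (_ : n + 1 - (x + 1) = n - x); last by ring.
  case: ifPn => [/eqP->|nx]; first by rewrite !(subrr, mul0r, mulr0, expr0n).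
  have nx0 : (n - x)%:~R != 0 :> R by rewrite intr_eq0 subr_eq0.
  rewrite !psiE qE -/b; move: nx0 (n0 n) (n0 x); rewrite intrB.
  move: (n%:~R) (x%:~R) => N X h1 h2 h3.
  by field; rewrite h1 h2 h3.
- move=> x n nx; rewrite /M /H (inj_eq (addIr 1)) (negbTE nx) /T.
  rewrite (_ : n + 1 - (x + 1) = n - x); last by ring.
  have nx0 : (n - x)%:~R != 0 :> R by rewrite intr_eq0 subr_eq0.
  rewrite !psiE; move: nx0 (n0 n) (n0 x) (n0 (n + 1)); rewrite intrB !intrD.
  move: (n%:~R) (x%:~R) => N X h1 h2 h3 h4.
  by field; rewrite h1 h2 h3 h4.
- by move=> x; rewrite /H qE psiE; move: (n0 x) => h; field.
- by move=> x; rewrite /H qE subrr mul0r add0r.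
- move=> Jlim x.
  have L (s : int) : `|s|%N = 1%N -> J (x + 1) (s * n%:Z) @[n --> \oo] --> (0 : R) ->
      H x (s * n%:Z) @[n --> \oo] --> (0 : R).
    move=> s1 Js; pose I (n : nat) : R := ((s * n%:Z)%:~R + a)^-1.
    have I0 : I @ \oo --> (0 : R).
      have one : gamma_like a a (fun=> 1) by split.
      by apply: (cvg0_le _ (gamma_like_vanish a01 a01 one s1)) => n; rewrite div1r normrV ?unitfE.
    have T0 : (fun n : nat => T (x + 1) (s * n%:Z)) @ \oo --> (0 : R).
      apply: sqr_cvg0; have b0 : b != 0 by rewrite invr_eq0 gt_eqF// (mass_gt0 ui ui q0 qC).
      rewrite (_ : (fun n => _) = fun n : nat => (b ^+ 2)^-1 * J (x + 1) (s * n%:Z)).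
        by rewrite -[0](mulr0 (b ^+ 2)^-1); exact: cvgMr.
      by apply/funext => n; rewrite /J mulKf// sqrf_eq0.
    rewrite (_ : (fun n : nat => H x (s * n%:Z)) = (fun n : nat => T (x + 1) (s * n%:Z)
       + - ((x + 1)%:~R + a) * (T (x + 1) (s * n%:Z) * I n) + 2^-1 * (I n * I n))).
      have z : (0 : R) = 0 + - ((x + 1)%:~R + a) * (0 * 0) + 2^-1 * (0 * 0) by rewrite !mulr0 !addr0.
      rewrite [X in _ --> X]z; apply: cvgD.
        by apply: cvgD => //; apply: cvgMr; exact: cvgM.
      by apply: cvgMr; exact: cvgM.
    apply/funext => n; rewrite /H digamma_diffE /I intrB.
    by move: (n0 (s * n%:Z)) (T _ _); move: (_%:~R) (_%:~R) => N X h t; field.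
  have [h1 h2] := Jlim (x + 1).
  split.
    have := L 1 erefl; under eq_fun do rewrite mul1r; under [X in _ -> X @ _ --> _ ]eq_fun do rewrite mul1r.
    by apply.
  have := L (-1) erefl; under eq_fun do rewrite mulN1r; under [X in _ -> X @ _ --> _ ]eq_fun do rewrite mulN1r.
  by apply.
Qed.

End digamma.

(** * Principal and complementary series *)

Section shifted_kernel.
Variable R : realType.
Local Notation C := (R[i]).
Variables (u v : C) (q : int -> R) (m : int).
Hypotheses (ui : nonint u) (vi : nonint v).
Hypothesis q0 : forall n, 0 < q n.
Hypothesis qE : forall n : int, (n%:~R + u) * (n%:~R + v) = (q n)%:C.
Hypothesis uv_conj : conj_stable u v.
Hypothesis gamma0 : exists2 A : R, 0 < A & cgamma u * cgamma v = A%:C.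

Lemma cgamma_int_step w n : nonint w ->
  cgamma ((n + 1)%:~R + w) = (n%:~R + w) * cgamma (n%:~R + w) :> C.
Proof. by move=> wi; rewrite intrD addrAC cgammaS//; exact: nonint_pole. Qed.

Lemma cgamma_int_neq0 w n : nonint w -> cgamma (n%:~R + w) != 0 :> C.
Proof. by move=> wi; have [] := cgamma_tends (nonint_pole n wi). Qed.

Lemma gamma_prod_pos n : exists2 A : R, 0 < A & cgamma (n%:~R + u) * cgamma (n%:~R + v) = A%:C.
Proof.
have qC k : (q k)%:C != 0 :> C by rewrite -normc_gt0 normc_real normr_gt0 gt_eqF.
move: n; apply: int_shift_ind => [|n [A A0 hA]|n [A A0 hA]]; first by rewrite !add0r.
- exists (q n * A); first by rewrite mulr_gt0.
  by rewrite !cgamma_int_step// mulrACA qE hA real_cM.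
- exists (A / q n); first by rewrite divr_gt0.
  move: hA; rewrite !cgamma_int_step// mulrACA qE => hA.
  by rewrite real_cM real_cV -hA mulrAC divff// mul1r.
Qed.

Definition cgamma_ratio (n : int) : C := cgamma (n%:~R + u) / cgamma (n%:~R + v).

Lemma cgamma_ratio_neq0 n : cgamma_ratio n != 0.
Proof. by rewrite mulf_neq0 ?invr_neq0 ?cgamma_int_neq0. Qed.

Lemma cgamma_ratio_step n : cgamma_ratio (n + 1) * (n%:~R + v) = cgamma_ratio n * (n%:~R + u).
Proof.
rewrite /cgamma_ratio !cgamma_int_step//; have := cgamma_int_neq0 n vi; have := vi n.
by move: (n%:~R + v) (cgamma _) (cgamma _) => V g h V0 h0; field; rewrite V0 h0.
Qed.

Lemma conj_stable_shift n : conj_stable (n%:~R + u) (n%:~R + v).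
Proof.
have E w : (n%:~R + w)^*%C = n%:~R + w^*%C :> C.
  by rewrite intC rmorphD; congr (_ + _); exact: conjc_real.
by rewrite /conj_stable !E; case: uv_conj => [->|[-> ->]]; [left|right].
Qed.

Hypotheses (u01 : 0 <= complex.Re u < 1) (v01 : 0 <= complex.Re v < 1) (uv : u != v).

Lemma sine_factor_mass : sine_factor (m%:~R + u) (m%:~R + v) = ((mass u v)^-1)%:C / (u - v).
Proof.
have m0 := mass_gt0 ui vi q0 qE; have tE := total_real ui vi qE.
have mC : (mass u v)%:C != 0 :> C by rewrite -normc_gt0 normc_real normr_gt0 gt_eqF.
have duv : u - v != 0 by rewrite subr_eq0.
have := sine_factor_total m ui vi u01 v01 uv; rewrite tE => /(_ mC) h.
rewrite real_cV; apply: (@mulIf _ ((u - v) * (mass u v)%:C)); first by rewrite mulf_neq0.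
by rewrite h; field; rewrite duv mC.
Qed.

Lemma idx_shift (x : halfint) w : (x + 1)%:~R + (m%:~R + w) = (x + 1 + m)%:~R + w :> C.
Proof. by rewrite [(x + 1 + m)%:~R]intrD addrA. Qed.

Lemma kernel_neq_diag (x : halfint) :
  gamma_kernel_neq (m%:~R + u) (m%:~R + v) x x = (density u v (x + 1 + m))%:C.
Proof.
have [A A0 hA] := gamma_prod_pos (x + 1 + m).
have := @kernel_diag R (m%:~R + u) (m%:~R + v) x A; rewrite /= !idx_shift => ->//.
- rewrite (tail_series ui vi qE _).1 sine_factor_mass /density real_cM.
  have duv : u - v != 0 by rewrite subr_eq0.
  have -> : m%:~R + u - (m%:~R + v) = u - v by ring.
  by rewrite mulrA divfK// mulrC.
- exact: nonint_pole.
- exact: nonint_pole.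
- exact: conj_stable_shift.
Qed.

Lemma kernel_neq_off (x y : halfint) : x != y ->
  gamma_kernel_neq (m%:~R + u) (m%:~R + v) x y * gamma_kernel_neq (m%:~R + u) (m%:~R + v) y x =
  pair_corr u v cgamma_ratio (x + 1 + m) (y + 1 + m).
Proof.
move=> xy; have [A A0 hA] := gamma_prod_pos (x + 1 + m).
have [B B0 hB] := gamma_prod_pos (y + 1 + m).
have := @kernel_off R (m%:~R + u) (m%:~R + v) x y A B xy; rewrite /= !idx_shift => ->//.
rewrite -/(cgamma_ratio _) -/(cgamma_ratio (y + 1 + m)) sine_factor_mass /pair_corr.
move: (cgamma_ratio (x + 1 + m)) (cgamma_ratio (y + 1 + m)) => a c.
rewrite invf_div [c / a + _]addrC; congr (_ / _).
rewrite (_ : y + 1 + m - (x + 1 + m) = - (x - y :> int)); last by ring.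
by rewrite intrN sqrrN.
Qed.

End shifted_kernel.

Section vanishing.
Variable R : realType.
Local Notation C := (R[i]).

Lemma nonpole_inv_cvg0 (s : C) : nonpole s ->
  (fun n : nat => (normc (s + n%:R : C))^-1) @ \oo --> (0 : R).
Proof.
move=> sp; have [d d0 dP] := lower_linear sp.
  have h : (fun n : nat => d^-1 * n.+1%:R^-1) @ \oo --> (0 : R).
    by rewrite -[0](mulr0 d^-1); apply: cvgMr; exact: cvg_harmonic.
  apply: (cvg0_le _ h) => n; rewrite ger0_norm ?invr_ge0 ?normc_ge0// -invfM.
  by rewrite lef_pV2 ?posrE ?mulr_gt0// (lt_le_trans _ (dP n))// mulr_gt0.
Qed.

Lemma inv_shift_vanish (w : C) (e : int) : nonint w -> `|e|%N = 1%N ->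
  (fun n : nat => (normc ((e * n%:Z)%:~R + w))^-1) @ \oo --> (0 : R).
Proof.
move=> wi e1.
have w0 : nonpole w by rewrite -[w]add0r; exact: (nonint_pole 0).
have w1 : nonpole (1 - w) by rewrite -[w]add0r; exact: (nonint_pole' 0).
case: e e1 => [[|[|e]]|[|e]] //= _.
  by have := nonpole_inv_cvg0 w0; under eq_fun do rewrite addrC; under [X in _ -> X @ _ --> _]eq_fun do rewrite mul1r.
rewrite (_ : (fun n : nat => _) =
  (fun n : nat => (fun x : int => (normc (x%:~R + w))^-1) (- n%:Z))); last first.
  by apply/funext => n; rewrite NegzE mulN1r.
apply: (@cvg_pos_neg _ (fun x : int => (normc (x%:~R + w : C))^-1)).
rewrite (_ : (fun n : nat => _) = (fun n : nat => (normc (1 - w + n%:R))^-1)); first exact: nonpole_inv_cvg0.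
apply/funext => n; rewrite NegzE intrN -normcN -[n.+1%:~R]/(n.+1%:R : C) -natr1.
by congr (normc _)^-1; ring.
Qed.

End vanishing.

Section principal.
Variable R : realType.
Local Notation C := (R[i]).
Variables (z : C) (P : probability (borel_conf R) R).

(** For conjugate u and v the ratio has modulus 1, so that a constant weight
    suffices, and pair_corr is nonnegative as a quotient of two nonpositive
    numbers: (u - v)^2 and rho + 1/rho - 2. *)
Lemma rigid_principal : complex.Im z != 0 -> determinantal P (gamma_kernel z z^*%C) -> rigid P.
Proof.
(* The integer shift which brings the parameters into the strip where the
   cotangent series has been summed. *)
move=> Iz hP; pose m := Num.floor (complex.Re z); pose u := z - m%:~R; pose v := u^*%C.
have Ru : complex.Re u = complex.Re z - m%:~R by rewrite /u intC; case: (z).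
have Iu : complex.Im u = complex.Im z by rewrite /u intC; case: (z) => a b /=; rewrite oppr0 addr0.
have u01 : 0 <= complex.Re u < 1.
  have /andP[h1 h2] := floor_itv (complex.Re z).
  by rewrite Ru subr_ge0 h1/= ltrBlDr addrC -(intrD _ m 1).
have v01 : 0 <= complex.Re v < 1 by move: u01; rewrite /v; case: (u).
have ui : nonint u.
  move=> n; apply: contra_neq Iz => /(congr1 (@complex.Im R)).
  by rewrite intC -Iu; case: (u) => a b /=; rewrite add0r.
have nuv n : n%:~R + v = (n%:~R + u)^*%C.
  by rewrite intC rmorphD; congr (_ + _); rewrite -[LHS]conjc_real.
have vi : nonint v.
  by move=> n; rewrite nuv conjc_eq0.
pose q n : R := normc (n%:~R + u) ^+ 2.
have q0 n : 0 < q n by rewrite exprn_gt0// normc_gt0.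
have qE n : (n%:~R + u) * (n%:~R + v) = (q n)%:C by rewrite nuv -sqr_normcE.
have sc : conj_stable u v by left.
have un : nonpole u by rewrite -[u]add0r; exact: (nonint_pole 0).
have g0 : exists2 A : R, 0 < A & cgamma u * cgamma v = A%:C.
  exists (normc (cgamma u) ^+ 2); last by rewrite sqr_normcE -cgamma_conj.
  by rewrite exprn_gt0// normc_gt0; have [] := cgamma_tends un.
have uv : u != v.
  apply: contra_neq Iz; rewrite -Iu /v; case: (u) => a b [] h.
  by move: h => /= h; lra.
have zE : z = m%:~R + u by rewrite /u addrC subrK.
have zE' : z^*%C = m%:~R + v by rewrite nuv -zE.
have zz : (z == z^*%C) = false.
  by apply/negbTE; rewrite zE' {1}zE; apply: contra_neq uv => /addrI.
have rn n : normc (cgamma_ratio u v n) = 1.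
  rewrite /cgamma_ratio normcM normcV nuv cgamma_conj; last exact: nonint_pole.
  by rewrite normc_conj divff// gt_eqF// normc_gt0 cgamma_int_neq0.
have GE x y : gamma_kernel z z^*%C x y = gamma_kernel_neq (m%:~R + u) (m%:~R + v) x y.
  by rewrite /gamma_kernel zz zE' {1}zE.
apply: (@rigid_distinct R u v q ui vi q0 qE uv (cgamma_ratio u v) (cgamma_ratio_neq0 ui vi)
  (cgamma_ratio_step ui vi) P _ hP m _ _ _ (ratio_weight (fun=> 1)) 1).
- move=> x; rewrite !GE; exact: (kernel_neq_diag _ _ _ q0 qE).
- move=> x y xy; rewrite !GE; exact: (kernel_neq_off _ _ _ q0 qE).
- move=> x n nx; have d0 : (n - x)%:~R != 0 :> R by rewrite intr_eq0 subr_eq0.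
  set rho := cgamma_ratio u v n / cgamma_ratio u v x.
  have rho1 : normc rho = 1 by rewrite normcM normcV !rn divr1.
  have rhoV : cgamma_ratio u v x / cgamma_ratio u v n = rho^*%C.
    rewrite -[LHS]invf_div -/rho; have : rho != 0 by rewrite -normc_gt0 rho1.
    move=> rho0; apply: (mulfI rho0); rewrite divff// -sqr_normcE rho1 expr1n//.
  exists (((mass u v)^-1 / (2 * complex.Im u)) ^+ 2 * (2 - 2 * complex.Re rho) / (n - x)%:~R ^+ 2).
    rewrite divr_ge0 ?sqr_ge0// mulr_ge0 ?sqr_ge0//.
    have := normc_Re rho; rewrite rho1 ler_norml => /andP[_]; lra.
  rewrite /pair_corr rhoV -/rho intC.
  have -> : u - v = (2 * complex.Im u)%:C * 'i%C.
    rewrite /v; case: (u) => a b; apply/eqP; rewrite eq_complex /=; apply/andP; split; apply/eqP; ring.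
  have -> : rho + rho^*%C - 2 = - (2 - 2 * complex.Re rho)%:C.
    case: (rho) => a b; rewrite natC; apply/eqP; rewrite eq_complex /=; apply/andP; split; apply/eqP; ring.
  have i2 : 'i%C ^+ 2 = -1 :> C by exact: sqr_i.
  have i2V : 'i%C^-1 ^+ 2 = -1 :> C by rewrite exprVn i2 invrN1.
  move: (mass u v)^-1 (2 * complex.Im u) (2 - _) (_%:~R) => B I S D.
  have -> : (B%:C / (I%:C * 'i%C)) ^+ 2 = (B%:C / I%:C) ^+ 2 * 'i%C^-1 ^+ 2 :> C.
    by rewrite invfM mulrA exprMn.
  by rewrite i2V !(real_cM, real_cV, real_cX); ring.
- pose h := 1 / 2 : R; have h12 : 0 < h < 1 by apply/andP; split; rewrite /h; lra.
  by apply: (tame_ratio_weight h12 h12); split.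
- have N x n : normc (cgamma_ratio u v n / cgamma_ratio u v x) = 1.
    by rewrite normcM normcV !rn divr1.
  by move=> x n; rewrite !N /ratio_weight divr1 mul1r.
- move=> e e1; split.
    rewrite (_ : (fun n : nat => _) = (fun n : nat => (normc ((e * n%:Z)%:~R + v))^-1)).
      exact: inv_shift_vanish.
    by apply/funext => n; rewrite rn mul1r.
  rewrite (_ : (fun n : nat => _) = (fun n : nat => (normc ((e * n%:Z)%:~R + u))^-1)).
    exact: inv_shift_vanish.
  by apply/funext => n; rewrite normcV rn invr1 mul1r.
Qed.

End principal.

Section complementary.
Variable R : realType.
Local Notation C := (R[i]).
Implicit Types a : R.

Lemma nonint_real a : 0 < a < 1 -> nonint (a%:C : C).
Proof.
move=> a01 n; rewrite intC -real_cD -normc_gt0 normc_real normr_gt0.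
exact: int_add_neq0.
Qed.

Lemma int_add_prod_gt0 a a' (n : int) : 0 < a < 1 -> 0 < a' < 1 ->
  0 < (n%:~R + a) * (n%:~R + a').
Proof.
move=> /andP[a0 a1] /andP[a'0 a'1]; case: n => n.
  by rewrite -[n%:~R]/(n%:R : R) mulr_gt0// ltr_wpDl.
have h : 1 <= n.+1%:R :> R by rewrite ler1n.
rewrite NegzE intrN -mulrNN mulr_gt0// opprD opprK -[n.+1%:~R]/(n.+1%:R : R) subr_gt0.
  exact: lt_le_trans a1 h.
exact: lt_le_trans a'1 h.
Qed.

Lemma cgamma_real_prod_pos a a' : 0 < a -> 0 < a' ->
  exists2 A : R, 0 < A & cgamma (a%:C) * cgamma (a'%:C) = A%:C :> C.
Proof.
move=> a0 a'0; have [g g0 ->] := cgamma_pos a0; have [g' g'0 ->] := cgamma_pos a'0.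
by exists (g * g'); [exact: mulr_gt0|rewrite real_cM].
Qed.

Lemma conj_stable_real a a' : conj_stable (a%:C : C) a'%:C.
Proof. by right; split; exact: conjc_real. Qed.

(** Both sides satisfy the same recurrence. *)
Lemma cgamma_ratio_real a a' : 0 < a < 1 -> 0 < a' < 1 ->
  exists2 c : R, 0 < c & forall n, cgamma_ratio a%:C a'%:C n = (c * gratio a a' n)%:C.
Proof.
move=> a01 a'01; have ai := nonint_real a01; have a'i := nonint_real a'01.
have [r0 rE] := gratio_gamma_like a01 a'01.
have /andP[a0 _] := a01; have /andP[a'0 _] := a'01.
have [g g0 gE] := cgamma_pos a0; have [g' g'0 g'E] := cgamma_pos a'0.
exists (g / g'); first exact: divr_gt0.
have st := cgamma_ratio_step ai a'i.
have E (n : int) b : n%:~R + b%:C = (n%:~R + b)%:C :> C by rewrite intC real_cD.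
apply: int_shift_ind => [|n IH|n IH].
- by rewrite /cgamma_ratio !add0r gE g'E (_ : gratio a a' 0 = 1) ?mulr1 ?real_cM ?real_cV//= big_geq.
- apply: (mulIf (a'i n)); rewrite st IH !E -!real_cM; congr (_%:C).
  by rewrite -!mulrA rE.
- apply: (mulIf (ai n)); rewrite -st IH !E -!real_cM; congr (_%:C).
  by rewrite -!mulrA rE.
Qed.

Variables (P : probability (borel_conf R) R).

(** Real ratios are positive, and s + 1/s >= 2. *)
Lemma rigid_complementary_neq a a' (m : int) : 0 < a < 1 -> 0 < a' < 1 -> a != a' ->
  determinantal P (gamma_kernel (m%:~R + a%:C) (m%:~R + a'%:C)) -> rigid P.
Proof.
move=> a01 a'01 aa hP.
pose u : C := a%:C; pose v : C := a'%:C.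
have ui : nonint u by exact: nonint_real.
have vi : nonint v by exact: nonint_real.
pose q (n : int) : R := (n%:~R + a) * (n%:~R + a').
have q0 n : 0 < q n by exact: int_add_prod_gt0.
have qE (n : int) : (n%:~R + u) * (n%:~R + v) = (q n)%:C.
  by rewrite intC -!real_cD -real_cM.
have /andP[a0 a1] := a01; have /andP[a'0 a'1] := a'01.
have u01 : 0 <= complex.Re u < 1 by rewrite /= ltW.
have v01 : 0 <= complex.Re v < 1 by rewrite /= ltW.
have g0 := cgamma_real_prod_pos a0 a'0.
have sc : conj_stable u v by exact: conj_stable_real.
have uv : u != v by apply: contra_neq aa => - [].
have zz : (m%:~R + u == m%:~R + v) = false.
  by apply/negbTE; apply: contra_neq uv => /addrI.
have [c c0 cE] := cgamma_ratio_real a01 a'01.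
have GL := gratio_gamma_like a01 a'01; have [r0 _] := GL.
have [A A0 hA] := ratio_weight_bound a01 a'01 GL.
have rho x n : cgamma_ratio u v n / cgamma_ratio u v x = (gratio a a' n / gratio a a' x)%:C.
  rewrite !cE -real_cV -real_cM; congr (_%:C); field.
  by rewrite !gt_eqF.
have GE x y : gamma_kernel (m%:~R + u) (m%:~R + v) x y = gamma_kernel_neq (m%:~R + u) (m%:~R + v) x y.
  by rewrite /gamma_kernel zz.
have rhoN x n : normc (cgamma_ratio u v n / cgamma_ratio u v x) = gratio a a' n / gratio a a' x.
  by rewrite rho normc_real ger0_norm// divr_ge0 ?ltW.
apply: (@rigid_distinct R u v q ui vi q0 qE uv (cgamma_ratio u v) (cgamma_ratio_neq0 ui vi)
  (cgamma_ratio_step ui vi) P _ hP m _ _ _ (ratio_weight (gratio a a')) A).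
- move=> x; rewrite !GE; exact: (kernel_neq_diag _ _ _ q0 qE).
- move=> x y xy; rewrite !GE; exact: (kernel_neq_off _ _ _ q0 qE).
- move=> x n nx; rewrite /pair_corr !rho.
  have s0 : 0 < gratio a a' n / gratio a a' x by rewrite divr_gt0.
  rewrite -[gratio a a' x / _]invf_div; move: (_ / _) s0 => s s0.
  exists (((mass u v)^-1 / (a - a')) ^+ 2 * (s + s^-1 - 2) / (n - x)%:~R ^+ 2).
    rewrite divr_ge0 ?sqr_ge0// mulr_ge0 ?sqr_ge0//.
    have -> : s + s^-1 - 2 = (s - 1) ^+ 2 / s by field; rewrite gt_eqF.
    by rewrite divr_ge0 ?sqr_ge0// ltW.
  rewrite intC natC /u /v -real_cB.
  by rewrite !(real_cM, real_cV, real_cX, real_cB, real_cD).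
- exact: tame_ratio_weight GL.
- by move=> x n; rewrite !rhoN.
- move=> e e1.
  have N (n : int) b : normc (n%:~R + b%:C : C) = `|n%:~R + b| by rewrite intC -real_cD normc_real.
  have h1 := gamma_like_vanish a01 a'01 GL e1.
  have h2 := gamma_like_vanish a'01 a01 (gamma_like_inv GL) e1.
  split.
    rewrite (_ : (fun n : nat => _) = (fun n : nat => c * (gratio a a' (e * n%:Z) / `|(e * n%:Z)%:~R + a'|))).
      by rewrite -[0](mulr0 c); exact: cvgMr.
    apply/funext => n; rewrite cE N normc_real gtr0_norm ?mulr_gt0// mulrA //.
  rewrite (_ : (fun n : nat => _) = (fun n : nat => c^-1 * ((gratio a a' (e * n%:Z))^-1 / `|(e * n%:Z)%:~R + a|))).
    by rewrite -[0](mulr0 c^-1); exact: cvgMr.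
  by apply/funext => n; rewrite normcV cE N normc_real gtr0_norm ?mulr_gt0// invfM mulrA.
Qed.

End complementary.

(** * The limit of equal parameters *)

Section equal_parameters.
Variable R : realType.
Local Notation C := (R[i]).
Variables (a : R) (m : int).
Hypothesis a01 : 0 < a < 1.
Let u : C := a%:C.
Let z0 : R := m%:~R + a.
Let z : C := m%:~R + u.
Let shifted (t : R) : R := t - m%:~R.

Let ui : nonint u. Proof. exact: nonint_real. Qed.

Lemma intr_realC (n : int) (b : R) : n%:~R + b%:C = (n%:~R + b)%:C :> C.
Proof. by rewrite intC real_cD. Qed.

Lemma z_realE : z = z0%:C. Proof. exact: intr_realC. Qed.

Lemma shiftedE (t : R) : (shifted t)%:C = u + (t - z0)%:C.
Proof. by rewrite /u -real_cD; congr (_%:C); rewrite /shifted /z0; ring. Qed.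

Lemma shift_backE (t : R) : t%:C = m%:~R + (shifted t)%:C.
Proof. by rewrite intr_realC; congr (_%:C); rewrite /shifted; ring. Qed.

Lemma shifted_near01 : \forall t \near z0^', 0 < shifted t < 1 /\ t != z0.
Proof.
have /andP[a0 a1] := a01.
have e0 : 0 < Num.min a (1 - a) / 2 by rewrite divr_gt0// lt_min a0 subr_gt0.
apply: filterS (near_dist z0 e0) => t [h tz]; split => //.
have h1 : `|t - z0| <= a / 2 by rewrite (le_trans h)// ler_pM2r// ge_min lexx.
have h2 : `|t - z0| <= (1 - a) / 2 by rewrite (le_trans h)// ler_pM2r// ge_min lexx orbT.
have E : shifted t = a + (t - z0) by rewrite /shifted /z0; ring.
move: h1 h2; rewrite !ler_norml E => /andP[h1 h2] /andP[h3 h4].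
by apply/andP; split; lra.
Qed.

Let qd (t : R) (n : int) : R := (n%:~R + a) * (n%:~R + shifted t).

Lemma tends_total : tends z0^' (fun t : R => total u (shifted t)%:C) (total u u).
Proof.
have un : nonpole u by rewrite -[u]add0r; exact: (nonint_pole 0).
have un' : nonpole (1 - u) by rewrite -[u]add0r; exact: (nonint_pole' 0).
have h1 := @invsum_tends_shift R u 1 z0 (normr1 _) un.
have h2 := @invsum_tends_shift R (1 - u) (-1) z0 (normrN1 _) un'.
apply: (tends_ext _ (tendsD h1 h2)); apply: nearW => t.
rewrite /total shiftedE mul1r mulN1r real_cN; congr (_ + invsum _ _).
by move: ((t - z0)%:C : C) => h; ring.
Qed.

Lemma tends_invsum n : tends z0^' (fun t : R => invsum (n%:~R + u) (n%:~R + (shifted t)%:C))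
  (invsum (n%:~R + u) (n%:~R + u)).
Proof.
have h1 := @invsum_tends_shift R (n%:~R + u) 1 z0 (normr1 _) (nonint_pole n ui).
by apply: (tends_ext _ h1); apply: nearW => t; rewrite shiftedE mul1r addrA.
Qed.

Lemma shifted_data t : 0 < shifted t < 1 -> t != z0 ->
  [/\ nonint (shifted t)%:C, (forall n, 0 < qd t n),
      (forall n : int, (n%:~R + u) * (n%:~R + (shifted t)%:C) = (qd t n)%:C),
      0 <= complex.Re (shifted t)%:C < 1 & u != (shifted t)%:C].
Proof.
move=> h tz; split.
- exact: nonint_real.
- by move=> n; exact: int_add_prod_gt0.
- by move=> n; rewrite !intr_realC -real_cM.
- by have /andP[h1 h2] := h; rewrite /= ltW.
- by rewrite shiftedE -subr_eq0 opprD addNKr oppr_eq0 -normc_gt0 normc_real normr_gt0 subr_eq0.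
Qed.

Let u01 : 0 <= complex.Re u < 1. Proof. by have /andP[h1 h2] := a01; rewrite /= ltW. Qed.

Let qC n : (n%:~R + u) * (n%:~R + u) = ((n%:~R + a) ^+ 2)%:C.
Proof. by rewrite intr_realC -real_cM. Qed.

Let q0 n : 0 < (n%:~R + a) ^+ 2.
Proof. by rewrite lt_neqAle sqr_ge0 eq_sym sqrf_eq0 (int_add_neq0 a01). Qed.

Let total_neq0 : total u u != 0.
Proof.
rewrite (total_real ui ui qC) -normc_gt0 normc_real normr_gt0 gt_eqF//.
exact: (mass_gt0 ui ui q0 qC).
Qed.

Lemma gamma_kernel_equal x y : gamma_kernel z z x y =
  lim ((gamma_kernel_neq z t%:C x y : R[i]^o) @[t --> z0^']).
Proof. by rewrite /gamma_kernel eqxx {2}z_realE. Qed.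

Lemma kernel_equal_diag (x : halfint) : gamma_kernel z z x x = (density u u (x + 1 + m))%:C.
Proof.
rewrite gamma_kernel_equal; set n := x + 1 + m.
suff T : tends z0^' (fun t : R => gamma_kernel_neq z t%:C x x) (density u u n)%:C.
  exact: (tends_lim T).
have -> : (density u u n)%:C = invsum (n%:~R + u) (n%:~R + u) * (total u u)^-1.
  by rewrite (tail_series ui ui qC n).1 (total_real ui ui qC) /density real_cM real_cV.
apply: (tends_ext _ (tendsM (tends_invsum n) (tendsV total_neq0 tends_total))).
apply: filterS shifted_near01 => t [t01 tz].
have [vi vq vE v01 uv] := shifted_data t01 tz.
have /andP[p0 _] := t01; have /andP[a0 _] := a01.
rewrite (shift_backE t) /z (kernel_neq_diag m ui vi vq vE) ?/density//.
- by rewrite (tail_series ui vi vE n).1 (total_real ui vi vE) real_cM real_cV.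
- exact: conj_stable_real.
- exact: cgamma_real_prod_pos.
Qed.

Lemma cgamma_real_int (b : R) (n : int) : nonint (b%:C : C) ->
  cgamma (n%:~R + b%:C) = (complex.Re (cgamma (n%:~R + b%:C : C)))%:C.
Proof.
move=> bi; apply: conj_real; rewrite -cgamma_conj; last exact: nonint_pole.
by rewrite intr_realC conjc_real.
Qed.

Let g (n : int) : R := complex.Re (cgamma (n%:~R + u)).

(** The limit exists because the sign of the kernel at (x, y), the sign of g n
    * g k, does not depend on the parameter t near z0. *)
Lemma kernel_equal_off (x y : halfint) : x != y -> let n := x + 1 + m in let k := y + 1 + m in
  gamma_kernel z z x y = (Num.sg (g n * g k))%:C * (total u u)^-1 * invsum (n%:~R + u) (k%:~R + u).
Proof.
move=> xy n k; rewrite gamma_kernel_equal.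
set l := invsum _ _; set sg := Num.sg _.
suff T : tends z0^' (fun t : R => gamma_kernel_neq z t%:C x y) (sg%:C * (total u u)^-1 * l).
  exact: (tends_lim T).
have [L1 L2] := gamma_quot_tends z0 (nonint_pole n ui) (nonint_pole k ui)
  (invsum_tends (nonint_pole n ui) (nonint_pole k ui)).
pose rho (t : R) : R := complex.Re (gamma_quot (n%:~R + u) (k%:~R + u) (t - z0)).
have s1 : (fun t : R => Num.sqrt (rho t)) @ z0^' --> (1 : R).
  have r1 : rho @ z0^' --> (1 : R) by exact: (tends_Re L1).
  by rewrite -[X in _ --> X]sqrtr1; apply: (continuous_cvg _ _ r1); exact: sqrt_continuous.
have d0 : (x - y)%:~R != 0 :> C by rewrite intr_eq0 subr_eq0.
have -> : sg%:C * (total u u)^-1 * l = sg%:C * (total u u)^-1 * (1%:C)^-1 *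
    ((k%:~R + u - (n%:~R + u)) * l) * - ((x - y)%:~R)^-1.
  have -> : k%:~R + u - (n%:~R + u) = - (x - y)%:~R.
    by rewrite /n /k !intrD intrN; ring.
  rewrite (_ : 1%:C = 1 :> C)// invr1.
  by move: (total u u)^-1 ((x - y)%:~R) d0 => ti d d0; field.
have one0 : (1%:C : C) != 0 by exact: oner_neq0.
apply: (tends_ext _ (tendsM (tendsM (tendsM (tendsM (tends_cst sg%:C) (tendsV total_neq0 tends_total))
  (tendsV one0 (tends_real s1))) L2) (tends_cst (- ((x - y)%:~R)^-1)))).
apply: filterS shifted_near01 => t [t01 tz].
have [vi vq vE v01 uv] := shifted_data t01 tz.
have /andP[p0 _] := t01; have /andP[a0 _] := a01.
have sc : conj_stable u (shifted t)%:C := conj_stable_real a (shifted t).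
have g0 := cgamma_real_prod_pos a0 p0.
have [A A0 hA] := gamma_prod_pos ui vi vq vE g0 n.
have [B B0 hB] := gamma_prod_pos ui vi vq vE g0 k.
have kf := sine_factor_mass m ui vi vq vE u01 v01 uv.
have tot := total_real ui vi vE.
rewrite (shift_backE t) /z /gamma_kernel_neq (negbTE xy) /gamma_expr -/(sine_factor _ _) !gamma_arg !idx_shift kf -/n -/k.
have -> : (hval R x - hval R y)%:C = (x - y)%:~R :> C.
  by rewrite /hval opprD addrACA subrr addr0 -intrB -intC.
have huv : u - (shifted t)%:C = - (t - z0)%:C by rewrite shiftedE; ring.
rewrite huv tot.
have gE j : cgamma (j%:~R + u) = (g j)%:C by exact: cgamma_real_int.
have gn0 j : g j != 0.
  by have := cgamma_int_neq0 j ui; rewrite gE -normc_gt0 normc_real normr_gt0.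
have gC j : (g j)%:C != 0 :> C by rewrite -gE cgamma_int_neq0.
have TE j D : cgamma (j%:~R + u) * cgamma (j%:~R + (shifted t)%:C) = D%:C ->
    cgamma (j%:~R + (shifted t)%:C) = (D / g j)%:C.
  by move=> h; rewrite real_cM real_cV -h gE mulrAC divff// mul1r.
have Tn := TE n A hA; have Tk := TE k B hB.
pose Q := g n ^+ 2 * B / (A * g k ^+ 2).
have g2 j : 0 < g j ^+ 2 by rewrite lt_neqAle sqr_ge0 eq_sym sqrf_eq0 gn0.
have Q0 : 0 < Q by rewrite divr_gt0// mulr_gt0.
have gq : gamma_quot (n%:~R + u) (k%:~R + u) (t - z0) = Q%:C.
  rewrite /gamma_quot -!addrA -shiftedE Tn Tk !gE -!real_cM -real_cV -real_cM; congr (_%:C).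
  by rewrite /Q; field; rewrite !gn0 gt_eqF.
rewrite /rho gq Tn Tk !gE.
pose W := Num.sqrt Q; have W0 : 0 < W by rewrite sqrtr_gt0.
have W2 : W ^+ 2 = Q by rewrite sqr_sqrtr// ltW.
have sg2 : sg * sg = 1.
  by rewrite -expr2 sqr_sg mulf_neq0// gn0.
have sg0 : 0 <= sg * (g n * g k) by rewrite -normrEsg.
(* The square root, made positive by the sign sg. *)
pose X := sg * (A * g k / g n) * W.
have X0 : 0 <= X.
  rewrite /X mulr_ge0 ?(ltW W0)//.
  have -> : sg * (A * g k / g n) = A * (sg * (g n * g k)) / g n ^+ 2.
    by move: (g n) (g k) (gn0 n) => c d c0; field.
  by apply: divr_ge0; [apply: mulr_ge0 => //; exact: ltW|exact: sqr_ge0].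
have -> : (g n)%:C * (A / g n)%:C * (g k)%:C * (B / g k)%:C = X%:C ^+ 2 :> C.
  rewrite -!real_cM -real_cX; congr (_%:C); rewrite /X exprMn W2 exprMn expr2 sg2 /Q.
  by field; rewrite !gn0 gt_eqF.
rewrite sqrtC_sqr_real// (_ : complex.Re Q%:C = Q)// -/W.
have tz0 : (t - z0)%:C != 0 :> C by rewrite -normc_gt0 normc_real normr_gt0 subr_eq0.
have wC : W%:C != 0 :> C by rewrite -normc_gt0 normc_real normr_gt0 gt_eqF.
have mC : (mass u (shifted t)%:C)%:C != 0 :> C.
  by rewrite -normc_gt0 normc_real normr_gt0 gt_eqF// (mass_gt0 ui vi vq vE).
have sC : sg%:C * sg%:C = 1 :> C by rewrite -real_cM sg2.
have sC0 : sg%:C != 0 :> C.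
  by apply/eqP => s0; move: sC; rewrite s0 mul0r => /eqP; rewrite eq_sym oner_eq0.
have num : (g n)%:C * (B / g k)%:C - (A / g n)%:C * (g k)%:C = (A * g k / g n)%:C * (Q%:C - 1) :> C.
  rewrite -[1]/((1 : R)%:C) -!real_cM -!real_cB -real_cM; congr (_%:C); rewrite /Q.
  by field; rewrite !gn0 gt_eqF.
rewrite num /X [(_ * W)%:C]real_cM [(sg * _)%:C]real_cM real_cV.
have E0 : (A * g k / g n)%:C != 0 :> C.
  by rewrite -normc_gt0 normc_real normr_gt0 !mulf_neq0 ?invr_neq0 ?gn0// gt_eqF.
have sV : (sg%:C)^-1 = sg%:C :> C by apply: (mulfI sC0); rewrite divff.
rewrite -{1}sV; move: (_ / g n)%:C E0 => E E0.
move: tz0 wC mC d0 sC0; move: ((t - z0)%:C) (W%:C) ((mass _ _)%:C) ((x - y)%:~R) (sg%:C) (Q%:C).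
move=> h' W' m' d' s' Q' h1 h2 h3 h4 h5.
by field; rewrite ?h1 ?h2 ?h3 ?h4 ?h5 ?E0.
Qed.

Let psi (n : int) : R := complex.Re (n%:~R * invsum u (n%:~R + u)).

Let invsum_int (x n : int) : C := invsum (x%:~R + u) (n%:~R + u).

Lemma invsum_int_real x n : invsum_int x n = (complex.Re (invsum_int x n))%:C.
Proof.
have [] := @invsum_real R (x%:~R + u) (n%:~R + u)
  (fun k => (x%:~R + a + k%:R) * (n%:~R + a + k%:R)) (nonint_pole x ui) (nonint_pole n ui) => //.
by move=> k; rewrite !intr_realC natC -!real_cD -real_cM.
Qed.

Lemma psi_diff x n : (psi n - psi x)%:C = (n - x)%:~R * invsum_int x n.
Proof.
have un : nonpole u by rewrite -[u]add0r; exact: (nonint_pole 0).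
have psiC k : (psi k)%:C = (k%:~R + u - u) * invsum u (k%:~R + u).
  rewrite addrK /psi; have := invsum_int_real 0 k; rewrite /invsum_int add0r => ->.
  by rewrite intC -real_cM.
have D k := invsum_diff un (nonint_pole k ui).
have T : tends \oo (fun N => \sum_(0 <= j < N) ((u + j%:R)^-1 - (n%:~R + u + j%:R)^-1) -
    \sum_(0 <= j < N) ((u + j%:R)^-1 - (x%:~R + u + j%:R)^-1)) (psi n - psi x)%:C.
  by rewrite real_cB !psiC; exact: (tendsB (D n) (D x)).
have T2 := invsum_diff (nonint_pole x ui) (nonint_pole n ui).
have -> : (n - x)%:~R = n%:~R + u - (x%:~R + u) :> C by rewrite intrB; ring.
apply: (tends_uniq _ T2); apply: (tends_ext _ T); apply: nearW => N.
by rewrite -sumrB; apply: eq_bigr => k _; ring.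
Qed.

Lemma psi_step n : psi (n + 1) = psi n + (n%:~R + a)^-1.
Proof.
have E : (psi (n + 1) - psi n)%:C = ((n%:~R + a)^-1)%:C :> C.
  rewrite psi_diff (_ : n + 1 - n = 1); last by ring.
  have T := invsum_diff (nonint_pole n ui) (nonint_pole (n + 1) ui).
  have d1 : (n + 1)%:~R + u - (n%:~R + u) = 1%:~R by rewrite intrD; ring.
  rewrite d1 in T; apply: (tends_uniq T).
  have V : tends \oo (fun N : nat => (n%:~R + u)^-1 - (n%:~R + u + N%:R)^-1) (n%:~R + u)^-1.
    rewrite -[X in tends _ _ X]subr0; apply: tendsB; first exact: tends_cst.
    apply: (@tends_squeeze _ _ _ _ _ (fun N : nat => (normc (n%:~R + u + N%:R))^-1)).
      by apply: nearW => N; rewrite subr0 normcV.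
    exact: nonpole_inv_cvg0 (nonint_pole n ui).
  rewrite real_cV -intr_realC; apply: (tends_ext _ V); apply: nearW => N.
  elim: N => [|N IH]; first by rewrite big_geq// addr0 subrr.
  have shift : (n + 1)%:~R + u + N%:R = n%:~R + u + N.+1%:R :> C.
    by rewrite intrD -natr1; ring.
  by rewrite big_nat_recr//= -IH shift; ring.
have /= e := congr1 (@complex.Re R) E.
by rewrite -e [psi n + _]addrC subrK.
Qed.

Lemma rigid_complementary_eq (P : probability (borel_conf R) R) :
  determinantal P (gamma_kernel z z) -> rigid P.
Proof.
move=> hP.
apply: (@rigid_equal R a psi a01 psi_step (fun n => (n%:~R + a) ^+ 2) _ ui P _ hP m) => //.
  exact: kernel_equal_diag.
move=> x y xy; have yx : y != x by rewrite eq_sym.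
rewrite !kernel_equal_off//; set n := x + 1 + m; set k := y + 1 + m.
have nk : (k - n)%:~R != 0 :> C.
  rewrite intr_eq0 subr_eq0; apply: contra_neq xy => /addIr/addIr ->//.
rewrite (invsum_sym (k%:~R + u)) (mulrC (g k)).
have sg2 : Num.sg (g n * g k) ^+ 2 = 1.
  rewrite sqr_sg; have gn0 j : g j != 0.
    have := cgamma_int_neq0 j ui.
    by rewrite (cgamma_real_int j ui) -normc_gt0 normc_real normr_gt0.
  by rewrite mulf_neq0.
have E : invsum (n%:~R + u) (k%:~R + u) = ((psi k - psi n) / (k - n)%:~R)%:C.
  by rewrite real_cM psi_diff real_cV -intC mulrAC divff// mul1r.
rewrite E (total_real ui ui qC) -!real_cV -!real_cM; congr (_%:C).
move: ((psi k - psi n) / (k - n)%:~R) (mass u u)^-1 (Num.sg _) sg2 => T b S sg2.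
by transitivity (S ^+ 2 * (b ^+ 2 * T ^+ 2)); [ring|rewrite sg2 mul1r].
Qed.

End equal_parameters.

Theorem proposition4p3 (R : realType) (z z' : R[i])
    (hz : principal_series z z' \/ complementary_series z z')
    (P : probability (borel_conf R) R)
    (hP : determinantal P (gamma_kernel z z')) :
  rigid P.
Proof.
case: hz => [[z_realE' zR]|[m [a [a' [z_realE z_realE' /andP[a0 a1] /andP[a'0 a'1]]]]]].
  apply: (@rigid_principal R z P); last by rewrite z_realE' in hP.
  apply: contra zR ; case: (z) => c d /= /eqP ->.
  by rewrite complex_real eqxx.
have H (b : R) : m%:~R < b < (m + 1)%:~R -> 0 < b - m%:~R < 1.
  by rewrite intrD => /andP[h1 h2]; apply/andP; split; lra.
have h1 := H a; rewrite a0 a1 in h1; have {}h1 := h1 isT.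
have h2 := H a'; rewrite a'0 a'1 in h2; have {}h2 := h2 isT.
have E b : b%:C = m%:~R + (b - m%:~R)%:C :> R[i] by rewrite intC -real_cD addrC subrK.
rewrite z_realE z_realE' (E a) (E a') in hP.
have [e|ne] := eqVneq (a - m%:~R) (a' - m%:~R).
  by rewrite -e in hP; exact: (rigid_complementary_eq h1 hP).
exact: (rigid_complementary_neq h1 h2 ne hP).
Qed.
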